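(* On $\mathbb{C}P^2$, in the coordinates $(c_3,s,\theta_1,\theta_2)$ (with $0<c_3<1/27$), the Hitchin Poisson structure $Q=4\,\mathrm{Im}\,\sigma$ reads $$Q=\frac{4c_3\pi}{\omega_1}\partial_{c_3}\wedge\partial_s-\partial_{\theta_1}\wedge\partial_{\theta_2}.$$ The standard complex structure $J$ reads $$\begin{pmatrix}J^{\theta_1}{}_s\\ J^{\theta_2}{}_s\end{pmatrix}=\frac{\omega_1}{2\pi}\begin{pmatrix}3y^2-1\\ 1-3y^1\end{pmatrix},\qquad \begin{pmatrix}J^{c_3}{}_{\theta_1}& J^{c_3}{}_{\theta_2}\end{pmatrix}=\frac{4\pi c_3}{\omega_1}\begin{pmatrix}-J^{\theta_2}{}_s& J^{\theta_1}{}_s\end{pmatrix},$$ $$\begin{pmatrix}J^{\theta_1}{}_{c_3}\\ J^{\theta_2}{}_{c_3}\end{pmatrix}=\frac{1}{4c_3(1-27c_3)}\begin{pmatrix}1+3y^2-18y^1y^2-6\varsigma(s)(1-3y^2)\\ 1+3y^1-18y^1y^2+6\varsigma(s)(1-3y^1)\end{pmatrix},$$ $$\begin{pmatrix}J^{s}{}_{\theta_1}& J^{s}{}_{\theta_2}\end{pmatrix}=\frac{4c_3\pi}{\omega_1}\begin{pmatrix}J^{\theta_2}{}_{c_3}& -J^{\theta_1}{}_{c_3}\end{pmatrix},$$ where $J^{a}{}_{b}=\langle da,J\partial_b\rangle$ and $$y^k(s)=\frac{c_3}{\frac1{12}-\wp\big(\omega_2+\frac{\omega_1}{\pi}(s+\frac{2\pi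 k}{3})\big)}.$$
   Context: **Elliptic functions.** For $c_3\in(0,1/27)$ put $g_2=\frac1{12}-2c_3$, $g_3=\frac{c_3}{6}-\frac1{216}-c_3^2$. Let $\wp,\zeta$ be the Weierstrass functions with $(\wp')^2=4\wp^3-g_2\wp-g_3$, $\zeta'=-\wp$, $\zeta$ odd; period lattice $2\omega_1\mathbb{Z}+2\omega_2\mathbb{Z}$ (rectangular, since the discriminant $c_3^3(1-27c_3)$ is positive), with $\omega_1>0$, $\omega_2\in i\mathbb{R}_{>0}$. Put $\eta_i=\zeta(\omega_i)$ and $$\varsigma(x)=\zeta\big(\omega_2+\tfrac{x\omega_1}{\pi}\big)-\eta_2-\tfrac{x}{\pi}\eta_1,$$ which for real $x$ is real and $2\pi$-periodic. **Coordinates.** Let $z^1,z^2$ be the standard inhomogeneous coordinates of $\mathbb{C}P^2$, $\theta_a=\arg z^a$, $y^a=|z^a|^2/(1+|z^1|^2+|z^2|^2)$ for $a=1,2$, $y^3=1-y^1-y^2$, and $c_3=y^1y^2y^3$. On $0<c_3<1/27$ the coordinate $s\in\mathbb{R}/2\pi\mathbb{Z}$ is determined by the displayed formula for $y^k$, $k=1,2,3$. The holomorphic Poisson tensor is $\sigma=iz^1z^2\,\partial_{z^1}\wedge\partial_{z^2}$, so that $Q=4y^1y^2y^3\,\partial_{y^1}\wedge\partial_{y^2}-\partial_{\theta_1}\wedge\partial_{\theta_2}$. The components of $J$ not listed are zero. *)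

(* Defs.v *)
From HB Require Import structures.
From mathcomp Require Import all_boot all_order all_algebra.
From mathcomp Require Import complex.
From mathcomp Require Import all_classical all_reals all_analysis.

Set Implicit Arguments.
Unset Strict Implicit.
Unset Printing Implicit Defensive.

Import Order.TTheory GRing.Theory Num.Theory.
Import numFieldNormedType.Exports.

Local Open Scope classical_set_scope.
Local Open Scope complex_scope.
Local Open Scope ring_scope.

(** * Weierstrass functions *)

Definition period_lattice (R : realType) (om1 : R) (om2 : R[i]) : set R[i] :=
  [set w | exists m n : int,
     w = (2 * om1)%:C *~ m + (2 * om2) *~ n].

Record weierstrass_data (R : realType) := WeierstrassData {
  omega1 : R;
  omega2 : R[i];
  wp : R[i]^o -> R[i]^o;
  wzeta : R[i]^o -> R[i]^o }.

(* [E] consists of the Weierstrass functions with invariants g2, g3, whose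
   period lattice is rectangular.  Derivatives are complex derivatives.  The
   values of [wp E] and [wzeta E] at lattice points are unconstrained.
   The normalisation at the pole 0 rules out the constant solutions of the
   differential equation; as [wp E] is holomorphic off the lattice, its periods
   are then exactly the lattice points. *)
Record is_weierstrass (R : realType) (g2 g3 : R) (E : weierstrass_data R) :
    Prop := IsWeierstrass {
  omega1_gt0 : 0 < omega1 E;
  Re_omega2 : complex.Re (omega2 E) = 0;
  Im_omega2_gt0 : 0 < complex.Im (omega2 E);
  wp_periodic : forall z w : R[i]^o,
    ~ period_lattice (omega1 E) (omega2 E) z ->
    period_lattice (omega1 E) (omega2 E) w ->
    wp E (z + w) = wp E z;
  wp_pole : wp E z - z ^- 2 @[z --> (0 : R[i]^o)^'] --> (0 : R[i]^o);
  wp_derivable : forall z : R[i]^o,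
    ~ period_lattice (omega1 E) (omega2 E) z -> derivable (wp E) z 1;
  wp_ode : forall z : R[i]^o,
    ~ period_lattice (omega1 E) (omega2 E) z ->
    ((wp E)^`()%classic z) ^+ 2 = 4 * wp E z ^+ 3 - g2%:C * wp E z - g3%:C;
  wzeta_derive : forall z : R[i]^o,
    ~ period_lattice (omega1 E) (omega2 E) z ->
    is_derive z 1 (wzeta E) (- wp E z);
  wzeta_odd : forall z : R[i]^o,
    ~ period_lattice (omega1 E) (omega2 E) z ->
    wzeta E (- z) = - wzeta E z }.

Definition inv2 (R : realType) (c : R) : R := 12^-1 - 2 * c.

Definition inv3 (R : realType) (c : R) : R := c / 6 - 216^-1 - c ^+ 2.

Definition c3_range (R : realType) : set R := [set c | 0 < c < 27^-1].

(* [W c] plays the role of omega_1, omega_2, wp, zeta at the value c of c_3. *)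
Definition elliptic_family (R : realType) (W : R -> weierstrass_data R) : Prop :=
  forall c, c3_range c -> is_weierstrass (inv2 c) (inv3 c) (W c).

Definition varsigmaC (R : realType) (W : R -> weierstrass_data R) (c x : R) :
    R[i] :=
  wzeta (W c) (omega2 (W c) + (x * omega1 (W c) / pi)%:C)
  - wzeta (W c) (omega2 (W c))
  - (x / pi)%:C * wzeta (W c) (omega1 (W c))%:C.

Definition varsigma (R : realType) (W : R -> weierstrass_data R) (c x : R) : R :=
  complex.Re (varsigmaC W c x).

Definition ysC (R : realType) (W : R -> weierstrass_data R) (c s : R) (k : nat) :
    R[i] :=
  c%:C / (12^-1 - wp (W c) (omega2 (W c)
            + (omega1 (W c) / pi * (s + 2 * pi * k%:R / 3))%:C)).

Definition ys (R : realType) (W : R -> weierstrass_data R) (c s : R) (k : nat) :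
    R :=
  complex.Re (ysC W c s k).

(** * The affine chart of the complex projective plane *)

(* A point (z^1, z^2) of C^2, or a real tangent vector there, is the row
   (Re z^1, Im z^1, Re z^2, Im z^2). *)
Definition realify (R : realType) (z1 z2 : R[i]) : 'rV[R]_4 :=
  \row_(j < 4)
    [:: complex.Re z1; complex.Im z1; complex.Re z2; complex.Im z2]`_j.

Definition i0 : 'I_4 := @Ordinal 4 0 isT.
Definition i1 : 'I_4 := @Ordinal 4 1 isT.
Definition i2 : 'I_4 := @Ordinal 4 2 isT.
Definition i3 : 'I_4 := @Ordinal 4 3 isT.

Definition z1 (R : realType) (v : 'rV[R]_4) : R[i] := v 0 i0 +i* v 0 i1.
Definition z2 (R : realType) (v : 'rV[R]_4) : R[i] := v 0 i2 +i* v 0 i3.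

(* The squared modulus, as a real number. *)
Definition sqmod (R : realType) (z : R[i]) : R :=
  complex.Re z ^+ 2 + complex.Im z ^+ 2.

Definition y1 (R : realType) (v : 'rV[R]_4) : R :=
  sqmod (z1 v) / (1 + sqmod (z1 v) + sqmod (z2 v)).
Definition y2 (R : realType) (v : 'rV[R]_4) : R :=
  sqmod (z2 v) / (1 + sqmod (z1 v) + sqmod (z2 v)).
Definition y3 (R : realType) (v : 'rV[R]_4) : R := 1 - y1 v - y2 v.
Definition c3 (R : realType) (v : 'rV[R]_4) : R := y1 v * y2 v * y3 v.

Definition Jstd (R : realType) (v : 'rV[R]_4) : 'rV[R]_4 :=
  realify ('i * z1 v) ('i * z2 v).

(** Bivectors, as antisymmetric matrices *)

Definition wedge (K : pzRingType) (n : nat) (u v : 'rV[K]_n) : 'M[K]_n :=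
  u^T *m v - v^T *m u.

Definition d_z1 (R : realType) : 'rV[R[i]]_4 :=
  2^-1 *: (delta_mx 0 i0 - 'i *: delta_mx 0 i1).
Definition d_z2 (R : realType) : 'rV[R[i]]_4 :=
  2^-1 *: (delta_mx 0 i2 - 'i *: delta_mx 0 i3).

Definition sigma (R : realType) (v : 'rV[R]_4) : 'M[R[i]]_4 :=
  ('i * z1 v * z2 v) *: wedge (d_z1 R) (d_z2 R).

Definition hitchinQ (R : realType) (v : 'rV[R]_4) : 'M[R]_4 :=
  4 *: map_mx (fun z : R[i] => complex.Im z) (sigma v).

(** * The coordinates (c_3, s, theta_1, theta_2) *)

Definition mkcoord (R : realType) (c s th1 th2 : R) : 'rV[R]_4 :=
  \row_(j < 4) [:: c; s; th1; th2]`_j.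

Definition expi (R : realType) (t : R) : R[i] := cos t +i* sin t.

(* The point with coordinates p: since y^a / y^3 = |z^a|^2, this is the point
   with y^k = y^k(s) and arg z^a = theta_a. *)
Definition chart (R : realType) (W : R -> weierstrass_data R) (p : 'rV[R]_4) :
    'rV[R]_4 :=
  let c := p 0 i0 in let s := p 0 i1 in
  realify ((Num.sqrt (ys W c s 1 / ys W c s 3))%:C * expi (p 0 i2))
          ((Num.sqrt (ys W c s 2 / ys W c s 3))%:C * expi (p 0 i3)).

(* theta is a value of arg z *)
Definition is_arg (R : realType) (z : R[i]) (theta : R) : Prop :=
  exists2 r : R, 0 < r & z = r%:C * expi theta.

Definition eqmod_2pi (R : realType) (x y : R) : Prop :=
  exists m : int, x - y = (2 * pi) *~ m.

(* [p] = (c_3, s, theta_1, theta_2) are coordinates of the point [v]. *)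
Definition coordinates_of (R : realType) (W : R -> weierstrass_data R)
    (v p : 'rV[R]_4) : Prop :=
  [/\ p 0 i0 = c3 v,
      [/\ (y1 v)%:C = ysC W (c3 v) (p 0 i1) 1,
          (y2 v)%:C = ysC W (c3 v) (p 0 i1) 2 &
          (y3 v)%:C = ysC W (c3 v) (p 0 i1) 3],
      is_arg (z1 v) (p 0 i2) &
      is_arg (z2 v) (p 0 i3)].

(* The coordinate vector fields, and the covector da as a column. *)
Definition dvec (R : realType) (W : R -> weierstrass_data R) (p : 'rV[R]_4)
    (b : 'I_4) : 'rV[R]_4 :=
  row b (jacobian (chart W) p).
Definition dcovec (R : realType) (W : R -> weierstrass_data R) (p : 'rV[R]_4)
    (a : 'I_4) : 'cV[R]_4 :=
  col a (invmx (jacobian (chart W) p)).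

(* J^a_b = <da, J d_b> *)
Definition Jcoef (R : realType) (W : R -> weierstrass_data R) (p : 'rV[R]_4)
    (a b : 'I_4) : R :=
  (Jstd (dvec W p b) *m dcovec W p a) 0 0.

(* (c_3, s, theta_1, theta_2) is a coordinate system on 0 < c_3 < 1/27, with s,
   theta_1, theta_2 in R / 2 pi Z, and [chart] is its inverse. *)
Definition is_coordinate_system (R : realType) (W : R -> weierstrass_data R) :
    Prop :=
  [/\ forall v : 'rV[R]_4, c3_range (c3 v) -> exists p : 'rV[R]_4,
         coordinates_of W v p,
      forall v p q : 'rV[R]_4, c3_range (c3 v) -> coordinates_of W v p ->
        (coordinates_of W v q <->
         [/\ q 0 i0 = p 0 i0, eqmod_2pi (q 0 i1) (p 0 i1),
             eqmod_2pi (q 0 i2) (p 0 i2) & eqmod_2pi (q 0 i3) (p 0 i3)]),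
      forall v p : 'rV[R]_4, c3_range (p 0 i0) ->
        (coordinates_of W v p <-> v = chart W p) &
      forall p : 'rV[R]_4, c3_range (p 0 i0) ->
        differentiable (chart W) p /\ jacobian (chart W) p \in unitmx].

(* Main.v *)
Require Import Defs.
From HB Require Import structures.
From mathcomp Require Import all_boot all_order all_algebra.
From mathcomp Require Import complex ring lra.
From mathcomp Require Import all_classical all_reals all_analysis.

Set Implicit Arguments.
Unset Strict Implicit.
Unset Printing Implicit Defensive.

Import Order.TTheory GRing.Theory Num.Theory.
Import numFieldNormedType.Exports.

Local Open Scope classical_set_scope.
Local Open Scope complex_scope.
Local Open Scope ring_scope.
Import Normc.

(** Why the formulas hold.

    The coordinates [theta_a] are the arguments of [z^a], and
    [|z^a|^2 = y^a / y^3]. In the coordinate frame the vectors along [c_3] and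
    [s] are therefore radial in each [z^a], with logarithmic speeds [alpha_a]
    and [beta_a], the derivatives of [log |z^a|], whereas the vectors along
    [theta_a] are rotations. As [J] is multiplication by ['i], it maps radial
    to rotational: the entries [J^theta_a_c3] and [J^theta_a_s] are [alpha_a]
    and [beta_a], the remaining ones come from the inverse of the 2x2 matrix of
    these numbers, and the bivector [Q] only involves its determinant
    (lemmas [frame_dual] and [frame_hitchin]). It remains to compute [alpha_a]
    and [beta_a], to see that the determinant is [omega_1 / (4 pi c_3)]
    ([jet_det]), and to show that these are coordinates at all.

    Derivatives in [s]. On the line [omega_2 + R] the function
    [v = 1/12 - wp] is real and positive, and [y^3 = c_3 / v] together with its
    translates by thirds of the period is a periodic orbit of the cyclic
    Lotka-Volterra system [y1' = y1 (y2 - y3)] (and cyclically) on the level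
    [y1 + y2 + y3 = 1], [y1 y2 y3 = c_3] ([weierstrass_orbit], [lvo_shift]).
    The hypotheses describe wp by its differential equation, its lattice and its
    pole, so that it is first identified on that line. A reference solution is
    built from the Jacobi functions, which are obtained by inverting the
    elliptic integral. A solution with a double pole is unique near the pole
    ([pole_unique]) and continues uniquely along lines ([ode_unique]); so both
    functions agree on vertical lines near the origin, and a blow-up argument on
    both axes shows that the lattices agree as well ([wp_like_half_line]). The
    zeta function is a primitive of [- wp] on the line ([zeta_row]).

    Derivatives in [c_3]. At a fixed time the derivative of the orbit in the
    level solves the linearised system, which has an explicit solution: the
    velocity multiplied by a combination of zeta and of the time, plus a
    polynomial in the [y^k] ([vd_linear]). Gronwall estimates show that this is
    indeed the derivative, with a quadratic error uniform on bounded time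
    intervals ([orbit_level_derivative]). The half period is the time at which
    the orbit crosses [y1 = y2] again, so that it is differentiable by an
    implicit function argument ([half_period_derivative]). When the time is
    rescaled by the half period, the terms linear in the time cancel and zeta
    turns into the periodic function of the statement
    ([orbit_total_derivative]).

    Coordinates. During one period the orbit runs exactly once through the level
    curve ([lvo_inj], [lvo_surj]), so that [s] is determined modulo [2 pi] by
    the [y^k]; polar coordinates do the rest ([chart_coordinate_system]). *)

(** * Differentiation of real functions *)

Section RealTools.
Context {R : realType}.
Implicit Types (f g : R -> R) (x a b : R).

(** The Weierstrass form of differentiability, on which all later estimates
    rest. *)
Lemma derP f x d : is_derive x 1 f d <->
  (forall e, 0 < e -> exists2 r, 0 < r &
     forall h, `|h| < r -> `|f (x + h) - f x - d * h| <= e * `|h|).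
Proof.
split=> [[df dE] e e0|H].
  have : (fun h => h^-1 *: (f (h *: 1 + x) - f x)) @ 0^' --> d.
    by rewrite -dE; exact: df.
  move/cvgrPdist_le => /(_ e e0); rewrite near_withinE => -[r /= r0 Hr].
  exists r => // h hr; have [->|h0] := eqVneq h 0.
    by rewrite addr0 subrr mulr0 subr0 normr0 mulr0.
  have := Hr h; rewrite /= sub0r normrN => /(_ hr h0).
  rewrite -[h *: 1]/(h * 1) mulr1 -[_ *: _]/(_ * _) (addrC h) => E.
  have -> : f (x + h) - f x - d * h = - (h * (d - h^-1 * (f (x + h) - f x))).
    by field.
  by rewrite normrN normrM mulrC ler_wpM2r.
have C : (fun h => h^-1 *: (f (h *: 1 + x) - f x)) @ 0^' --> d.
  apply/cvgrPdist_le => e e0; have [r r0 Hr] := H e e0.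
  rewrite near_withinE; exists r => //= h; rewrite /= sub0r normrN => hr h0.
  rewrite -[h *: 1]/(h * 1) mulr1 -[_ *: _]/(_ * _) (addrC h).
  have -> : d - h^-1 * (f (x + h) - f x) = - (h^-1 * (f (x + h) - f x - d * h)).
    by field.
  rewrite normrN normrM normfV mulrC ler_pdivrMr ?normr_gt0 //; exact: Hr.
by split; [apply/cvg_ex; exists d|exact: cvg_lim].
Qed.

Lemma der_cont f x d : is_derive x 1 f d -> {for x, continuous f}.
Proof. by case=> /derivable1_diffP /differentiable_continuous. Qed.

Lemma derD f g x a b : is_derive x 1 f a -> is_derive x 1 g b ->
  is_derive x 1 (fun t => f t + g t) (a + b).
Proof. by move=> H K; exact: is_deriveD. Qed.
Lemma derB f g x a b : is_derive x 1 f a -> is_derive x 1 g b ->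
  is_derive x 1 (fun t => f t - g t) (a - b).
Proof. by move=> H K; exact: is_deriveB. Qed.
Lemma derN f x a : is_derive x 1 f a -> is_derive x 1 (fun t => - f t) (- a).
Proof. by move=> H; exact: is_deriveN. Qed.
Lemma derM f g x a b : is_derive x 1 f a -> is_derive x 1 g b ->
  is_derive x 1 (fun t => f t * g t) (a * g x + f x * b).
Proof.
move=> H K; apply: (@is_derive_eq _ _ _ (f * g : R -> R)).
by rewrite -[_ *: b]/(_ * _) -[_ *: a]/(_ * _); ring.
Qed.
Lemma der_cst x a : is_derive x 1 (fun=> a) 0.
Proof. exact: is_derive_cst. Qed.
Lemma der_id x : is_derive x 1 (fun t : R => t) 1.
Proof. exact: is_derive_id. Qed.
Lemma der_comp f g x a b : is_derive x 1 g b -> is_derive (g x) 1 f a ->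
  is_derive x 1 (fun t => f (g t)) (a * b).
Proof. by move=> H K; exact: (@is_derive1_comp _ f g). Qed.
Lemma derV f x a : f x != 0 -> is_derive x 1 f a ->
  is_derive x 1 (fun t => (f t)^-1) (- a / (f x) ^+ 2).
Proof.
move=> f0 H; apply: (is_derive_eq (is_deriveV f0 H)).
by rewrite -[_ *: a]/(_ * _); ring.
Qed.
Lemma derX f n x a : is_derive x 1 f a ->
  is_derive x 1 (fun t => f t ^+ n) (n%:R * f x ^+ n.-1 * a).
Proof.
move=> H; have -> : (fun t => f t ^+ n) = f ^+ n.
  by apply/funext => t; rewrite !fctE.
exact: is_deriveX.
Qed.
Lemma der_sqrt f x a : 0 < f x -> is_derive x 1 f a ->
  is_derive x 1 (fun t => Num.sqrt (f t)) (a / (2 * Num.sqrt (f x))).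
Proof. by move=> f0 H; rewrite mulrC; apply: der_comp => //; exact: is_derive1_sqrt. Qed.
Lemma der_sin f x a : is_derive x 1 f a ->
  is_derive x 1 (fun t => sin (f t)) (cos (f x) * a).
Proof. by move=> H; apply: der_comp. Qed.
Lemma der_cos f x a : is_derive x 1 f a ->
  is_derive x 1 (fun t => cos (f t)) (- sin (f x) * a).
Proof. by move=> H; apply: der_comp. Qed.
Lemma der_exp f x a : is_derive x 1 f a ->
  is_derive x 1 (fun t => expR (f t)) (expR (f x) * a).
Proof. by move=> H; apply: der_comp. Qed.
Lemma der_eq f x a b : is_derive x 1 f a -> a = b -> is_derive x 1 f b.
Proof. by move=> H <-. Qed.
Lemma der_val f x a b : is_derive x 1 f a -> is_derive x 1 f b -> a = b.
Proof. by move=> [_ <-] [_ <-]. Qed.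
Lemma der_ext f g x a : (forall t, f t = g t) -> is_derive x 1 f a ->
  is_derive x 1 g a.
Proof. by move=> /funext ->. Qed.
Lemma der_near f g x a r : 0 < r -> (forall t, `|t - x| < r -> f t = g t) ->
  is_derive x 1 f a -> is_derive x 1 g a.
Proof.
move=> r0 fg /derP H; apply/derP => e e0; have [r' r'0 Hr] := H e e0.
exists (Num.min r r') => [|h]; rewrite lt_min ?r0 // => /andP[h1 h2].
by rewrite -!fg ?subrr ?normr0 //; [exact: Hr|rewrite addrC addKr].
Qed.

End RealTools.

(* The head symbol of the function selects the rule; the function is
   eta-expanded first, as unification would otherwise not find the factors of a
   point-free product. *)
Ltac der_step :=
  lazymatch goal with |- is_derive ?x ?v ?f ?d =>
    let T := type of x in
    let f' := eval cbv beta in (fun t : T => f t) in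
    change (is_derive x v f' d) end;
  lazymatch goal with
  | |- is_derive _ _ (fun _ => ?a) _ => notypeclasses refine (der_cst _ _)
  | |- is_derive _ _ (fun t => t) _ => notypeclasses refine (der_id _)
  | |- is_derive _ _ (fun t => @?f t + - @?g t) _ =>
      notypeclasses refine (derB _ _)
  | |- is_derive _ _ (fun t => @?f t + @?g t) _ =>
      notypeclasses refine (derD _ _)
  | |- is_derive _ _ (fun t => @?f t * @?g t) _ =>
      notypeclasses refine (derM _ _)
  | |- is_derive _ _ (fun t => - @?f t) _ => notypeclasses refine (derN _)
  | |- is_derive _ _ (fun t => (@?f t)^-1) _ =>
      notypeclasses refine (derV _ _)
  | |- is_derive _ _ (fun t => @?f t ^+ _) _ =>
      notypeclasses refine (derX _ _)
  | |- is_derive _ _ (fun t => Num.sqrt (@?f t)) _ =>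
      notypeclasses refine (der_sqrt _ _)
  | |- is_derive _ _ (fun t => sin (@?f t)) _ => notypeclasses refine (der_sin _)
  | |- is_derive _ _ (fun t => cos (@?f t)) _ => notypeclasses refine (der_cos _)
  | |- is_derive _ _ (fun t => expR (@?f t)) _ => notypeclasses refine (der_exp _)
  end.
(* [der] replaces the goal [is_derive x 1 f d] by the equation between the
   formally computed derivative and [d]; hypotheses on the derivatives of
   unknown functions are found in the context. *)
Ltac der_with tac := repeat first [tac | eassumption | der_step].
Tactic Notation "der" "with" tactic0(tac) :=
  notypeclasses refine (der_eq _ _); [der_with tac | cbv beta].
Tactic Notation "der" := der with fail.

Section RealTools2.
Context {R : realType}.
Implicit Types (f g : R -> R) (x a b : R).

Lemma der_MVT f (d : R -> R) a b : a < b ->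
  (forall x, a <= x <= b -> is_derive x 1 f (d x)) ->
  exists2 c, a < c < b & f b - f a = d c * (b - a).
Proof.
move=> ab H.
have [||c cab E] := @MVT _ f d a b ab; last by exists c => //; move: cab; rewrite in_itv.
  by move=> x; rewrite in_itv /= => /andP[/ltW h1 /ltW h2]; apply: H; rewrite h1.
apply: continuous_in_subspaceT => x; rewrite inE /= in_itv /= => xab.
exact: der_cont (H _ xab).
Qed.

Lemma der_ge0_le f (d : R -> R) a b : a <= b ->
  (forall x, a <= x <= b -> is_derive x 1 f (d x)) ->
  (forall x, a < x < b -> 0 <= d x) -> f a <= f b.
Proof.
rewrite le_eqVlt => /predU1P[-> //|ab] H H0; have [c cab E] := der_MVT ab H.
by rewrite -subr_ge0 E mulr_ge0 ?H0 // subr_ge0 ltW.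
Qed.

Lemma der_gt0_lt f (d : R -> R) a b : a < b ->
  (forall x, a <= x <= b -> is_derive x 1 f (d x)) ->
  (forall x, a < x < b -> 0 < d x) -> f a < f b.
Proof.
move=> ab H H0; have [c cab E] := der_MVT ab H.
by rewrite -subr_gt0 E mulr_gt0 ?H0 // subr_gt0.
Qed.

Lemma der0_cst f a b : a <= b ->
  (forall x, a <= x <= b -> is_derive x 1 f 0) -> f a = f b.
Proof.
rewrite le_eqVlt => /predU1P[-> //|ab] H.
have [c cab E] := @der_MVT f (fun=> 0) _ _ ab H.
by apply/esym/eqP; rewrite -subr_eq0 E mul0r.
Qed.

Lemma der_IVT f a b v : a <= b ->
  (forall x, a <= x <= b -> {for x, continuous f}) ->
  f a <= v <= f b -> exists2 c, a <= c <= b & f c = v.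
Proof.
move=> ab H vab; have /andP[v1 v2] := vab.
have [||c cab E] := @IVT _ f a b v ab.
- apply: continuous_in_subspaceT => x; rewrite inE /= in_itv /=; exact: H.
- by rewrite (min_idPl (le_trans v1 v2)) (max_idPr (le_trans v1 v2)).
- by exists c => //; move: cab; rewrite in_itv.
Qed.

(** The function [f x * expR (- K * x)] does not increase, whatever the sign of
    [f]. *)
Lemma gronwall f (d : R -> R) K a b : a <= b ->
  (forall x, a <= x <= b -> is_derive x 1 f (d x)) ->
  (forall x, a < x < b -> d x <= K * f x) -> f b <= f a * expR (K * (b - a)).
Proof.
move=> ab H HK.
pose g x := - (f x * expR (- K * x)).
have gab : g a <= g b.
  apply: (@der_ge0_le g (fun x => (K * f x - d x) * expR (- K * x))) => // x xab.
    by rewrite /g; der with (exact: H xab); ring.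
  by rewrite mulr_ge0 ?expR_ge0 // subr_ge0 HK.
move: gab; rewrite /g lerN2 -(ler_pM2r (expR_gt0 (K * b))) -!mulrA -!expRD.
rewrite -mulrDl addNr mul0r expR0 mulr1.
by have -> : - K * a + K * b = K * (b - a) by ring.
Qed.

(** The case [x < 0] is the case [x > 0] for the reflected function; the bound
    on [d] makes [f 0] nonnegative. *)
Lemma gronwall_abs f (d : R -> R) K X : 0 < K ->
  (forall x, `|x| <= X -> is_derive x 1 f (d x)) ->
  (forall x, `|x| <= X -> `|d x| <= K * f x) ->
  forall x, `|x| <= X -> f x <= f 0 * expR (K * X).
Proof.
move=> K0 H HK.
have aux g (e : R -> R) : (forall x, `|x| <= X -> is_derive x 1 g (e x)) ->
    (forall x, `|x| <= X -> `|e x| <= K * g x) ->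
    0 <= g 0 -> forall x, 0 <= x -> `|x| <= X -> g x <= g 0 * expR (K * X).
  move=> Hg Ke g0 x x0; rewrite ger0_norm // => xX.
  have I y : 0 <= y <= x -> `|y| <= X.
    by case/andP=> y0 yx; rewrite ger0_norm //; apply: le_trans yx xX.
  apply: le_trans (@gronwall g e K 0 x x0 _ _) _.
  - by move=> y /I; exact: Hg.
  - move=> y /andP[y0 yx]; apply: le_trans (ler_norm _) (Ke _ _).
    by apply: I; rewrite !ltW.
  - by rewrite subr0 ler_wpM2l // ler_expR ler_wpM2l // ltW.
move=> x xX.
have X0 : `|0 : R| <= X by rewrite normr0; apply: le_trans xX.
have f0 : 0 <= f 0.
  have := le_trans (normr_ge0 _) (HK _ X0).
  by rewrite pmulr_rge0.
have [x0|x0] := leP 0 x; first exact: aux H HK f0 x x0 xX.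
have := aux (fun y => f (- y)) (fun y => d (- y) * - 1).
move=> /(_ _ _ _ (- x)); rewrite oppr0 opprK normrN oppr_ge0; apply => //.
- move=> y yX; have Hy : is_derive (- y) 1 f (d (- y)) by apply: H; rewrite normrN.
  exact: (der_comp (derN (der_id y)) Hy).
- by move=> y yX; rewrite mulrN1 normrN; apply: HK; rewrite normrN.
- exact: ltW.
Qed.

(* The two halves of the first order test at the end points of an interval, in
   the form used by [darboux]. *)
Lemma der_pos_right f x d : 0 < d -> is_derive x 1 f d ->
  exists2 r, 0 < r & forall h, 0 < h < r -> f x < f (x + h).
Proof.
move=> d0 /derP /(_ (d / 2)) []; first by lra.
move=> r r0 H; exists r => // h /andP[h0 hr].
have := H h; rewrite gtr0_norm // => /(_ hr) /ler_normlP[+ _].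
by nra.
Qed.

Lemma der_neg_left f x d : d < 0 -> is_derive x 1 f d ->
  exists2 r, 0 < r & forall h, 0 < h < r -> f x < f (x - h).
Proof.
move=> d0 H.
have [] := @der_pos_right (fun y => f (- y)) (- x) (- d) _ _; first by lra.
  by rewrite -[x]opprK in H; der with (exact: (der_comp (derN (der_id _)) H)); ring.
move=> r r0 Hr; exists r => // h /Hr; rewrite opprK.
by have -> : - (- x + h) = x - h by ring.
Qed.

(** Derivatives have the intermediate value property, even if they are not
    continuous: otherwise [f] would have an interior maximum. *)
Lemma darboux f (d : R -> R) a b : a <= b ->
  (forall x, a <= x <= b -> is_derive x 1 f (d x)) ->
  (forall x, a <= x <= b -> d x != 0) -> 0 < d a -> 0 < d b.
Proof.
move=> ab H H0 da; rewrite lt_def H0 ?ab ?lexx //= leNgt; apply/negP => db.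
have [|c] := EVT_max ab (f := f).
  apply: continuous_in_subspaceT => x; rewrite inE /= in_itv /= => xab.
  exact: der_cont (H _ xab).
rewrite in_itv /= => /andP[ac cb] M.
have {}M t : a <= t <= b -> f t <= f c by move=> tab; apply: M; rewrite in_itv.
have altb : a < b.
  by rewrite lt_neqAle ab andbT; apply/eqP => E; move: db; rewrite -E ltNge ltW.
move: ac; rewrite le_eqVlt => /predU1P[E|ac].
  have [|r r0 Hr] := der_pos_right da (H a _); first by rewrite lexx.
  pose h := Num.min (r / 2) (b - a).
  have h0 : 0 < h by rewrite lt_min divr_gt0 // subr_gt0.
  have hr : h < r by rewrite gt_min; apply/orP; left; lra.
  have hb : h <= b - a by rewrite ge_min lexx orbT.
  have := Hr h; rewrite h0 hr => /(_ isT); rewrite ltNge E M //; lra.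
move: cb; rewrite le_eqVlt => /predU1P[E|cb].
  have [|r r0 Hr] := der_neg_left db (H b _); first by rewrite lexx andbT.
  pose h := Num.min (r / 2) (b - a).
  have h0 : 0 < h by rewrite lt_min divr_gt0 // subr_gt0.
  have hr : h < r by rewrite gt_min; apply/orP; left; lra.
  have hb : h <= b - a by rewrite ge_min lexx orbT.
  have := Hr h; rewrite h0 hr => /(_ isT); rewrite ltNge -E M //; lra.
have cab : a <= c <= b by rewrite !ltW.
have D : is_derive c 1 f 0.
  apply: (@derive1_at_max _ f a b c ab).
  - move=> t; rewrite in_itv /= => /andP[/ltW t1 /ltW t2].
    by have [] := H t; rewrite ?t1 ?t2.
  - by rewrite in_itv /= ac.
  - by move=> t; rewrite in_itv /= => /andP[/ltW t1 /ltW t2]; apply: M; rewrite t1.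
by have := H0 c cab; rewrite (der_val (H c cab) D) eqxx.
Qed.

(** The supremum of the points up to which [P] holds is reached by the limit
    hypothesis and passed by the step hypothesis. *)
Lemma real_induction (P : R -> Prop) a b :
  P a ->
  (forall t, a < t < b -> (forall s, a <= s < t -> P s) -> P t) ->
  (forall t, a <= t < b -> P t ->
     exists2 r, 0 < r & forall s, t <= s < t + r -> P s) ->
  forall t, a <= t < b -> P t.
Proof.
move=> Pa Plim Pstep t /andP[a_t tb].
apply: contrapT => nPt.
pose S : set R := [set x | a <= x <= t /\ forall s, a <= s <= x -> P s].
have Sa : S a by split; [rewrite lexx|move=> s; rewrite -eq_le => /eqP <-].
have St x : S x -> x <= t by case=> /andP[].
have hs : has_sup S by split; [exists a|exists t => x /St].
pose m := sup S.
have am : a <= m by apply: ub_le_sup => //; exact: hs.2.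
have mt : m <= t by apply: ge_sup; [exists a|move=> x /St].
have below s : a <= s < m -> P s.
  case/andP=> as_ sm; have [x Sx sx] := sup_gt (ex_intro _ a Sa) sm.
  by apply: Sx.2; rewrite as_ ltW.
have Pm : P m.
  move: am; rewrite le_eqVlt => /predU1P[<- //|am].
  by apply: Plim => //; rewrite am (le_lt_trans mt tb).
have mt' : m < t by rewrite lt_neqAle mt andbT; apply/eqP => E; apply: nPt; rewrite -E.
have [|r r0 Hr] := Pstep m _ Pm; first by rewrite am (lt_trans mt' tb).
pose x := Num.min t (m + r / 2).
have mx : m < x by rewrite lt_min mt'; lra.
have xr : x < m + r by rewrite gt_min; apply/orP; right; lra.
have : S x.
  split; first by rewrite (ltW (le_lt_trans am mx)) ge_min lexx.
  move=> s /andP[as_ sx]; have [ms|sm] := leP m s.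
    by apply: Hr; rewrite ms (le_lt_trans sx xr).
  by apply: below; rewrite as_.
by move=> /(ub_le_sup hs.2); rewrite leNgt mx.
Qed.

End RealTools2.

(** * Primitives of continuous functions *)

Section Primitive.
Context {R : realType}.

Lemma primitive_on (h : R -> R) (a : R) : continuous h ->
  exists F : R -> R, forall x, a < x -> is_derive x 1 F (h x).
Proof.
move=> hc; exists (fun x => \int[lebesgue_measure]_(t in `[a, x]) h t)%R => x ax.
have [] := @continuous_FTC1_closed R h a x (x + 1) _ _ ax (hc x); first by rewrite ltrDl.
  apply: continuous_compact_integrable; first exact: segment_compact.
  exact: continuous_subspaceT.
move=> D E; apply: DeriveDef; first exact: D.
by rewrite -derive1E; exact: E.
Qed.

(** The primitives on the half-lines from [- n.+1] that vanish at 0 agree on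
    their common domains, and can be glued. *)
Lemma primitive (h : R -> R) : continuous h ->
  exists2 F : R -> R, F 0 = 0 & forall x : R, is_derive x 1 F (h x).
Proof.
move=> hc.
have /choice[F HF] : forall n : nat, exists F : R -> R,
    F 0 = 0 /\ forall x : R, - n.+1%:R < x -> is_derive x 1 F (h x).
  move=> n; have [G HG] := primitive_on (- n.+1%:R) hc.
  exists (fun x => G x - G 0); split=> [|x nx]; first by rewrite subrr.
  by der with (exact: HG); rewrite subr0.
have F0 n : F n 0 = 0 by have [] := HF n.
have agree n m (x : R) : (n <= m)%N -> - n.+1%:R < x -> F n x = F m x.
  move=> nm nx; have nm' : - m.+1%:R <= - n.+1%:R :> R by rewrite lerN2 ler_nat.
  have n0 : - n.+1%:R < 0 :> R by rewrite oppr_lt0.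
  have D (y : R) : - n.+1%:R < y -> is_derive y 1 (fun t => F n t - F m t) 0.
    move=> ny; have H1 := (HF n).2 y ny; have H2 := (HF m).2 y (le_lt_trans nm' ny).
    by der; rewrite subrr.
  apply/eqP; rewrite -subr_eq0; apply/eqP.
  transitivity ((fun t => F n t - F m t) 0); last by rewrite /= !F0 subrr.
  have [x0|x0] := leP x 0.
    by apply: (der0_cst (f := fun t => F n t - F m t) x0) => y /andP[xy _]; apply: D; exact: lt_le_trans xy.
  apply/esym; apply: (der0_cst (f := fun t => F n t - F m t) (ltW x0)) => y /andP[xy _]; apply: D; exact: lt_le_trans xy.
pose N (x : R) := (Num.truncn `|x|).+1.
have NP (x y : R) : `|y - x| < 1 -> - (N x).+1%:R < y.
  move=> yx; have := truncnS_gt `|x| => xN.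
  have := ler_norm (- y); have := ler_normB y (y - x).
  have -> : y - (y - x) = x by ring.
  rewrite /N -!(natr1 _.+1) in xN *; have := ler_normD (y - x) x; rewrite subrK normrN. lra.
exists (fun x => F (N x) x); first exact: F0.
move=> x; apply: (@der_near _ (F (N x)) _ _ _ 1) => //; last first.
  by apply: (HF _).2; apply: NP; rewrite subrr normr0.
move=> t tx; have t1 : - (N t).+1%:R < t by apply: NP; rewrite subrr normr0.
have t2 := NP _ _ tx.
by case/orP: (leq_total (N x) (N t)) => le; [exact: agree|exact/esym/agree].
Qed.

End Primitive.

(** * Jacobi elliptic functions on the real line *)

(** The functions [s], [c], [d] are sn, cn, dn for the modulus [k], and [K] is
    the quarter period. *)
Record is_jacobi (R : realType) (k : R) (s c d : R -> R) (K : R) : Prop := {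
  jacobi_K_gt0 : 0 < K;
  jacobi_ds : forall x : R, is_derive x 1 s (c x * d x);
  jacobi_dc : forall x : R, is_derive x 1 c (- (s x * d x));
  jacobi_dd : forall x : R, is_derive x 1 d (- (k ^+ 2 * s x * c x));
  jacobi_sc : forall x, s x ^+ 2 + c x ^+ 2 = 1;
  jacobi_sd : forall x, k ^+ 2 * s x ^+ 2 + d x ^+ 2 = 1;
  jacobi_d_gt0 : forall x, 0 < d x;
  jacobi_s0 : s 0 = 0;
  jacobi_c0 : c 0 = 1;
  jacobi_sN : forall x, s (- x) = - s x;
  jacobi_cN : forall x, c (- x) = c x;
  jacobi_sD : forall x, s (x + 2 * K) = - s x;
  jacobi_cD : forall x, c (x + 2 * K) = - c x;
  jacobi_sK : s K = 1;
  jacobi_s_gt0 : forall x, 0 < x < 2 * K -> 0 < s x;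
  jacobi_c_gt0 : forall x, - K < x < K -> 0 < c x }.

(** The amplitude [am] is the inverse of the incomplete elliptic integral [F],
    and the three functions are [sin am], [cos am] and
    [sqrt (1 - k^2 sin^2 am)]. The (quasi-)periods come from the identity
    [F (x + pi) = F x + F pi]. *)
Lemma jacobi_exists (R : realType) (k : R) : 0 < k < 1 ->
  exists s c d K, is_jacobi k s c d K.
Proof.
move=> /andP[k0 k1].
pose w (t : R) := 1 - k ^+ 2 * sin t ^+ 2.
have w0 t : 0 < w t.
  have s1 : sin t ^+ 2 <= 1 by rewrite sin2cos2 gerBl sqr_ge0.
  by rewrite /w; have := sqr_ge0 (sin t); nra.
have w1 t : w t <= 1 by rewrite /w gerBl mulr_ge0 ?sqr_ge0.
have rw0 t : 0 < Num.sqrt (w t) by rewrite sqrtr_gt0.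
pose h (t : R) := (Num.sqrt (w t))^-1.
have h0 t : 0 < h t by rewrite invr_gt0.
have h1 t : 1 <= h t.
  by rewrite invf_ge1 // -[leRHS]sqrtr1 ler_wsqrtr.
have hc : continuous h.
  move=> t; apply: (@der_cont _ h t); rewrite /h /w.
  by der; [exact: lt0r_neq0 (rw0 t)|exact: w0|reflexivity].
have [F F0 HF] := primitive hc.
have Fc x : {for x, continuous F} := der_cont (HF x).
have Flt x y : x < y -> F x < F y.
  by move=> xy; exact: (@der_gt0_lt _ F h _ _ xy (fun z _ => HF z) (fun z _ => h0 z)).
have Finj : injective F.
  move=> x y E; apply/eqP; rewrite eq_le !leNgt.
  by apply/andP; split; apply/negP => /Flt; rewrite E ltxx.
have Fle x y : x <= y -> y - x <= F y - F x.
  move=> xy; have := @der_ge0_le _ (fun t => F t - t) (fun t => h t - 1) x y xy.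
  move=> H; suff : F x - x <= F y - y by lra.
  apply: H => z _; by rewrite subr_ge0.
have Fsurj x : exists p, F p = x.
  have [x0|x0] := leP 0 x.
    have [||c _ <-] := @der_IVT _ F 0 x x x0; [by move=> *; exact: Fc| |by exists c].
    by have := Fle _ _ x0; rewrite F0 x0 !subr0.
  have [||c _ <-] := @der_IVT _ F x 0 x (ltW x0); [by move=> *; exact: Fc| |by exists c].
  by have := Fle _ _ (ltW x0); rewrite F0 (ltW x0) andbT; lra.
have [am amK] := choice Fsurj.
have amK' : cancel F am by move=> p; apply: Finj; rewrite amK.
have dam (x : R) : is_derive x 1 am (Num.sqrt (w (am x))).
  rewrite -{1}(amK x) -[Num.sqrt _]invrK; apply: (@is_derive_inverse _ F am (h (am x))).
  - by near=> z; exact: amK'.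
  - by near=> z; exact: Fc.
  - exact: lt0r_neq0.
have FN x : F (- x) = - F x.
  have Dg (z : R) : is_derive z 1 (fun t => F (- t) + F t) 0.
    have H1 := HF z; have H2 := HF (- z).
    der with (notypeclasses refine (der_comp (derN (der_id _)) H2)).
    by rewrite /h /w sinN sqrrN; ring.
  have := is_derive_0_is_cst x 0 Dg.
  by rewrite oppr0 F0 addr0 => /eqP; rewrite addr_eq0 => /eqP.
have FD x : F (x + pi) = F x + F pi.
  have Dg (z : R) : is_derive z 1 (fun t => F (t + pi) - F t) 0.
    have H1 := HF z; have H2 := HF (z + pi).
    der with (notypeclasses refine (der_comp (derD (der_id _) (der_cst _ _)) H2)).
    by rewrite /h /w sinDpi sqrrN; ring.
  have := is_derive_0_is_cst x 0 Dg.
  by rewrite add0r F0 subr0 => <-; ring.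
pose K := F (pi / 2).
have Fpi : F pi = 2 * K.
  have E : pi = - (pi / 2) + pi + pi / 2 :> R by field.
  have := FD (- (pi / 2)); rewrite FN.
  have -> : - (pi / 2) + pi = pi / 2 :> R by field.
  rewrite -/K; lra.
have pi0 := @pi_gt0 R.
have amD x : am (x + 2 * K) = am x + pi.
  by apply: Finj; rewrite amK FD amK Fpi.
have amN x : am (- x) = - am x by apply: Finj; rewrite FN !amK.
have am0 : am 0 = 0 by apply: Finj; rewrite amK F0.
have amlt x y : x < y -> am x < am y.
  move=> xy; rewrite ltNge le_eqVlt; apply/negP => /predU1P[E|/Flt].
    by move: xy; rewrite -(amK x) -(amK y) E ltxx.
  by rewrite !amK ltNge ltW.
have amKK : am K = pi / 2 by rewrite /K amK'.
exists (fun x => sin (am x)), (fun x => cos (am x)), (fun x => Num.sqrt (w (am x))), K.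
split=> //=.
- by rewrite -F0 Flt // divr_gt0.
- by move=> x; have Hx := dam x; der.
- by move=> x; have Hx := dam x; der; ring.
- move=> x; have Hx := dam x; rewrite /w; der; first exact: w0.
  rewrite -/(w _) /=; have := lt0r_neq0 (rw0 (am x)) => ?; by field.
- by move=> x; rewrite addrC cos2Dsin2.
- by move=> x; rewrite sqr_sqrtr ?ltW // /w; ring.
- by rewrite am0 sin0.
- by rewrite am0 cos0.
- by move=> x; rewrite amN sinN.
- by move=> x; rewrite amN cosN.
- by move=> x; rewrite amD sinDpi.
- by move=> x; rewrite amD cosDpi.
- by rewrite amKK sin_pihalf.
- move=> x /andP[/amlt + /amlt]; rewrite am0 -[2 * K]add0r amD am0 add0r => a b.
  by apply: sin_gt0_pi; rewrite a.
- move=> x /andP[/amlt + /amlt]; rewrite amN amKK => a b.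
  by apply: cos_gt0_pihalf; rewrite a.
Unshelve. all: by end_near. Qed.

(** * Complex-valued functions of a real variable *)

Section Curves.
Context {R : realType}.
Local Notation C := R[i].
Local Notation Re := (@complex.Re R).
Local Notation Im := (@complex.Im R).
Implicit Types (F G : R -> C) (t : R) (z w : C).

Lemma normcE z : `|z| = (normc z)%:C. Proof. by []. Qed.
Lemma normc_ge0 z : 0 <= normc z.
Proof. by rewrite -lecR -normcE normr_ge0. Qed.
Lemma normc_real (x : R) : normc x%:C = `|x|.
Proof. by rewrite /= expr0n addr0 sqrtr_sqr. Qed.
Lemma normc_sqr z : normc z ^+ 2 = sqmod z.
Proof. by case: z => a b; rewrite /= sqr_sqrtr // addr_ge0 ?sqr_ge0. Qed.
Lemma normc_i : normc ('i : C) = 1.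
Proof. by rewrite /= expr0n add0r expr1n sqrtr1. Qed.
Lemma normc_gt0 z : (0 < normc z) = (z != 0).
Proof. by rewrite -ltcR -normcE normr_gt0. Qed.
Lemma normr_Re z : `|Re z| <= normc z.
Proof. by case: z => a b; rewrite /= -sqrtr_sqr ler_wsqrtr // lerDl sqr_ge0. Qed.
Lemma normr_Im z : `|Im z| <= normc z.
Proof. by case: z => a b; rewrite /= -sqrtr_sqr ler_wsqrtr // lerDr sqr_ge0. Qed.
Lemma normc_le_ReIm z : normc z <= `|Re z| + `|Im z|.
Proof.
rewrite -(@ler_pXn2r _ 2) ?nnegrE ?addr_ge0 ?normc_ge0 ?normr_ge0 //.
rewrite normc_sqr /sqmod -(real_normK (num_real (Re z))) -(real_normK (num_real (Im z))).
have := normr_ge0 (Re z); have := normr_ge0 (Im z); nra.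
Qed.
Lemma ReD z w : Re (z + w) = Re z + Re w. Proof. by case: z w => ? ? []. Qed.
Lemma ImD z w : Im (z + w) = Im z + Im w. Proof. by case: z w => ? ? []. Qed.
Lemma ReN z : Re (- z) = - Re z. Proof. by case: z. Qed.
Lemma ImN z : Im (- z) = - Im z. Proof. by case: z. Qed.
Lemma ReM z w : Re (z * w) = Re z * Re w - Im z * Im w.
Proof. by case: z w => ? ? []. Qed.
Lemma ImM z w : Im (z * w) = Re z * Im w + Im z * Re w.
Proof. by case: z w => ? ? [] ? ? /=; ring. Qed.
Lemma ReV z : Re z^-1 = Re z / (Re z ^+ 2 + Im z ^+ 2). Proof. by case: z. Qed.
Lemma ImV z : Im z^-1 = - Im z / (Re z ^+ 2 + Im z ^+ 2).
Proof. by case: z => a b; rewrite mulNr. Qed.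
Definition ReImE := (ReD, ImD, ReN, ImN, ReM, ImM).

Lemma cplx_eq z w : Re z = Re w -> Im z = Im w -> z = w.
Proof. by case: z w => ? ? [? ?] /= -> ->. Qed.

Lemma ccvgP (f : C^o -> C^o) (l : C) :
  f h @[h --> (0 : C^o)^'] --> (l : C^o) ->
  forall e, 0 < e -> exists2 r : R, 0 < r &
    forall h : C, h != 0 -> normc h < r -> normc (f h - l) <= e.
Proof.
move=> /cvgrPdist_le H e e0; have := H e%:C; rewrite ltcR => /(_ e0).
rewrite near_withinE => -[r /= r0 Hr].
have rr : r = (Re r)%:C by apply: cplx_eq => //; move: r0; rewrite ltcE => /andP[/eqP ->].
exists (Re r); first by rewrite -ltcR -rr.
move=> h h0 hr; rewrite -lecR -normcE -normrN opprB; apply: Hr => //=.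
by rewrite sub0r normrN rr normcE ltcR.
Qed.

Lemma cderivP (f : C^o -> C^o) (z : C^o) (d : C) : is_derive z (1 : C^o) f d ->
  forall e, 0 < e -> exists2 r : R, 0 < r &
    forall h : C, normc h < r ->
      normc (f (z + h) - f z - d * h) <= e * normc h.
Proof.
move=> [df dE] e e0.
have C : (fun h : C^o => h^-1 *: (f (h *: (1 : C^o) + z) - f z)) @ (0 : C^o)^' --> (d : C^o).
  by rewrite -dE; exact: df.
have [r r0 Hr] := ccvgP C e0; exists r => // h hr.
have [->|h0] := eqVneq h 0.
  by rewrite addr0 subrr mulr0 subr0 normc0 mulr0.
have := Hr h h0 hr; rewrite -[h *: 1]/(h * 1) mulr1 -[_ *: _]/(_ * _) (addrC h) => E.
have -> : f (z + h) - f z - d * h = h * (h^-1 * (f (z + h) - f z) - d).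
  by field.
by rewrite normcM mulrC ler_wpM2r // normc_ge0.
Qed.

(** Working with the two real components makes the calculus of real functions,
    the mean value theorem included, available for curves. *)
Definition cder (F : R -> C) (t : R) (d : C) : Prop :=
  is_derive t (1 : R) (fun x => Re (F x)) (Re d) /\
  is_derive t (1 : R) (fun x => Im (F x)) (Im d).

Lemma cder_eq F t d d' : cder F t d -> d = d' -> cder F t d'.
Proof. by move=> H <-. Qed.

Lemma cder_ext F G t d : (forall x, F x = G x) -> cder F t d -> cder G t d.
Proof. by move=> /funext ->. Qed.

Lemma cderP F t d : cder F t d <->
  (forall e, 0 < e -> exists2 r, 0 < r & forall h, `|h| < r ->
     normc (F (t + h) - F t - d * h%:C) <= e * `|h|).
Proof.
split=> [[/derP H1 /derP H2] e e0|H].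
  have e20 : 0 < e / 2 by lra.
  have [r1 r10 Hr1] := H1 _ e20; have [r2 r20 Hr2] := H2 _ e20.
  exists (Num.min r1 r2) => [|h]; rewrite lt_min ?r10 // => /andP[h1 h2].
  apply: le_trans (normc_le_ReIm _) _.
  have := Hr1 h h1; have := Hr2 h h2; rewrite !ReImE /= !mulr0 subr0 add0r; lra.
split; apply/derP => e e0; have [r r0 Hr] := H e e0; exists r => // h hr.
- apply: le_trans (Hr h hr); apply: le_trans (normr_Re _).
  by rewrite !ReImE /= mulr0 subr0.
- apply: le_trans (Hr h hr); apply: le_trans (normr_Im _).
  by rewrite !ReImE /= mulr0 add0r.
Qed.

(** A holomorphic function restricts to differentiable curves on real lines;
    this is the only way in which complex derivatives enter the argument. *)
Lemma cder_line (f : C^o -> C^o) (a v : C) t (d : C) :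
  is_derive (a + t%:C * v : C^o) (1 : C^o) f d ->
  cder (fun x => f (a + x%:C * v)) t (d * v).
Proof.
move=> H; apply/cderP => e e0.
have n0 : 0 < normc v + 1 by rewrite ltr_wpDl ?normc_ge0.
have [r r0 Hr] := cderivP H (divr_gt0 e0 n0).
exists (r / (normc v + 1)); first by rewrite divr_gt0.
move=> h; rewrite ltr_pdivlMr // => hr.
have hv : normc (h%:C * v) = `|h| * normc v by rewrite normcM normc_real.
have h0 := normr_ge0 h.
have -> : a + (t + h)%:C * v = (a + t%:C * v) + h%:C * v by rewrite rmorphD /=; ring.
have := Hr (h%:C * v); rewrite hv => /(_ _)/le_trans.
have -> : d * (h%:C * v) = d * v * h%:C by ring.
apply; first by apply: le_lt_trans hr; rewrite ler_wpM2l // lerDl.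
by rewrite mulrAC ler_pdivrMr //; have := mulr_ge0 (ltW e0) h0; nra.
Qed.

Lemma cder_cont F t d : cder F t d -> forall e, 0 < e ->
  exists2 r, 0 < r & forall x, `|x - t| < r -> normc (F x - F t) < e.
Proof.
move=> /cderP /(_ 1 ltr01)[r r0 Hr] e e0.
have n0 : 0 < normc d + 1 + 1 by have := normc_ge0 d; lra.
exists (Num.min r (e / (normc d + 1 + 1))) => [|x].
  by rewrite lt_min r0 divr_gt0.
rewrite lt_min => /andP[/Hr + xe].
rewrite ltr_pdivlMr // in xe; rewrite subrKC mul1r.
set u := F x - F t => H.
have := le_normcD (u - d * (x - t)%:C) (d * (x - t)%:C).
rewrite subrK normcM normc_real; have := normr_ge0 (x - t); have := normc_ge0 d; nra.
Qed.

Lemma cderD F G t a b : cder F t a -> cder G t b ->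
  cder (fun x => F x + G x) t (a + b).
Proof.
move=> [H1 H2] [K1 K2]; split; rewrite !ReImE.
- by apply: der_ext (derD H1 K1) => x; rewrite ReImE.
- by apply: der_ext (derD H2 K2) => x; rewrite ReImE.
Qed.
Lemma cderN F t a : cder F t a -> cder (fun x => - F x) t (- a).
Proof.
move=> [H1 H2]; split; rewrite !ReImE.
- by apply: der_ext (derN H1) => x; rewrite ReImE.
- by apply: der_ext (derN H2) => x; rewrite ReImE.
Qed.
Lemma cderB F G t a b : cder F t a -> cder G t b ->
  cder (fun x => F x - G x) t (a - b).
Proof. by move=> H K; exact: cderD H (cderN K). Qed.
Lemma cderM F G t a b : cder F t a -> cder G t b ->
  cder (fun x => F x * G x) t (a * G t + F t * b).
Proof.
move=> [H1 H2] [K1 K2]; split.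
- apply: der_ext (_ : is_derive _ _ (fun x => Re (F x) * Re (G x) - Im (F x) * Im (G x)) _).
    by move=> x; rewrite ReImE.
  by der; rewrite !ReImE; ring.
- apply: der_ext (_ : is_derive _ _ (fun x => Re (F x) * Im (G x) + Im (F x) * Re (G x)) _).
    by move=> x; rewrite ReImE.
  by der; rewrite !ReImE; ring.
Qed.
Lemma cder_cst t a : cder (fun=> a) t 0.
Proof. by split; exact: der_cst. Qed.
Lemma cder_real (f : R -> R) t d : is_derive t (1 : R) f d ->
  cder (fun x => (f x)%:C) t d%:C.
Proof. by move=> H; split=> //; exact: der_cst. Qed.
Lemma sqmod_gt0 z : z != 0 -> 0 < Re z ^+ 2 + Im z ^+ 2.
Proof. by rewrite -normc_gt0 => z0; have := normc_sqr z; rewrite /sqmod => <-; rewrite exprn_gt0. Qed.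
Lemma cderV F t a : F t != 0 -> cder F t a ->
  cder (fun x => (F x)^-1) t (- a / F t ^+ 2).
Proof.
move=> F0 [H1 H2]; have m0 := lt0r_neq0 (sqmod_gt0 F0).
split.
- apply: der_ext (_ : is_derive _ _ (fun x => Re (F x) / (Re (F x) ^+ 2 + Im (F x) ^+ 2)) _).
    by move=> x; rewrite ReV.
  der.
  rewrite !ReImE ReV ImV !ReImE; move: m0.
  case: (F t) F0 => u v /= _ m0; field.
  by rewrite m0 /= (_ : _ + _ = (u ^+ 2 + v ^+ 2) ^+ 2) ?expf_neq0 //; ring.
- apply: der_ext (_ : is_derive _ _ (fun x => - Im (F x) / (Re (F x) ^+ 2 + Im (F x) ^+ 2)) _).
    by move=> x; rewrite ImV.
  der.
  rewrite !ReImE ReV ImV !ReImE; move: m0.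
  case: (F t) F0 => u v /= _ m0; field.
  by rewrite m0 /= (_ : _ + _ = (u ^+ 2 + v ^+ 2) ^+ 2) ?expf_neq0 //; ring.
Qed.
Lemma cder_sqmod F t d : cder F t d ->
  is_derive t (1 : R) (fun x => sqmod (F x)) (2 * Re (conjc (F t) * d)).
Proof.
move=> [H1 H2]; rewrite /sqmod; der.
by rewrite /= !ReImE; case: (F t) => u v /=; ring.
Qed.
Lemma cder_comp F (g : R -> R) t a b : is_derive t (1 : R) g b -> cder F (g t) a ->
  cder (fun x => F (g x)) t (a * b%:C).
Proof.
move=> H [K1 K2]; split.
- by notypeclasses refine (der_eq (der_comp H K1) _); rewrite ReM /= mulr0 subr0.
- by notypeclasses refine (der_eq (der_comp H K2) _); rewrite ImM /= mulr0 add0r.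
Qed.
End Curves.

(** * Uniqueness for the Weierstrass equation along lines *)

Section Uniqueness.
Context {R : realType}.
Local Notation C := R[i].
Local Notation Re := (@complex.Re R).
Local Notation Im := (@complex.Im R).
Implicit Types (t : R) (z w : C).

Definition cubic (e1 e2 e3 : R) (w : C) : C := (w - e1%:C) * (w - e2%:C) * (w - e3%:C).

Lemma near1M z w (e : R) : e <= 1 -> normc (z - 1) <= e -> normc (w - 1) <= e ->
  normc (z * w - 1) <= 3 * e.
Proof.
move=> e1 hz hw.
have -> : z * w - 1 = (z - 1) * (w - 1) + ((z - 1) + (w - 1)) by ring.
apply: le_trans (le_normcD _ _) _; rewrite normcM.
have := le_normcD (z - 1) (w - 1); have := normc_ge0 (z - 1).
have := normc_ge0 (w - 1); nra.
Qed.

Lemma near1M3 a b c (e : R) : 3 * e <= 1 -> normc (a - 1 : C) <= e ->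
  normc (b - 1 : C) <= e -> normc (c - 1 : C) <= e ->
  normc (a * b * c - 1) <= 9 * e.
Proof.
move=> e1 ha hb hc; have e0 : 0 <= e by apply: le_trans ha; exact: normc_ge0.
have e3 : e <= 1 by lra.
have := near1M e3 ha hb => hab.
have hc' : normc (c - 1) <= 3 * e by lra.
by have := near1M e1 hab hc'; lra.
Qed.

(** Of the two square roots of a number close to 1, the one in the right half
    plane is close to 1. *)
Lemma root_near1 z (e : R) : e <= 1 / 2 -> 0 < Re z -> normc (z ^+ 2 - 1) <= e ->
  normc (z - 1) <= e.
Proof.
move=> e12 z0 H; have z1 : 1 <= normc (z + 1).
  apply: le_trans (normr_Re _); rewrite ReD /= ger0_norm; lra.
apply: le_trans H; have -> : z ^+ 2 - 1 = (z - 1) * (z + 1) by ring.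
by rewrite normcM ler_peMr ?normc_ge0.
Qed.

Lemma Re_sqr_near1 z : normc (z ^+ 2 - 1) <= 1 / 2 -> Re z != 0.
Proof.
move=> H; have := le_trans (normr_Re _) H; rewrite expr2 ReD ReM ReN /=.
move=> /ler_normlP[+ _]; apply: contraTneq => ->; rewrite -ltNge.
have := sqr_ge0 (Im z); nra.
Qed.

Lemma normc_eq0P z : normc z <= 0 -> z = 0.
Proof. by move=> H; apply: eq0_normc; apply/le_anti; rewrite H normc_ge0. Qed.

Lemma sqmod_le0 z : sqmod z <= 0 -> z = 0.
Proof.
rewrite -normc_sqr => H; apply: normc_eq0P.
by have := normc_ge0 z; nra.
Qed.

(* If [D' = D * rho] then [|D|^2] has the logarithmic derivative [2 Re rho]. *)
Lemma Re_conj_mul z (rho : C) : Re (conjc z * (z * rho)) = sqmod z * Re rho.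
Proof. by case: z rho => a b [c d]; rewrite /sqmod /=; ring. Qed.

Lemma normr_Re_conj z w : Re (conjc z * w) <= normc z * normc w.
Proof.
apply: le_trans (ler_norm _) _; apply: le_trans (normr_Re _) _.
rewrite normcM; have -> : normc (conjc z) = normc z by case: z => a b; rewrite /= sqrrN.
by [].
Qed.

Section ODE.
Variables (kap : C) (e1 e2 e3 : R) (phi phi' psi psi' : R -> C).
Let P w := kap * cubic e1 e2 e3 w.

Let pick (u v : C) : C := (u - e2%:C) * (u - e3%:C) + (v - e1%:C) * (u - e3%:C)
  + (v - e1%:C) * (v - e2%:C).

Let P_diff u v : P u - P v = (u - v) * (kap * pick u v).
Proof. by rewrite /P /cubic /pick; ring. Qed.

(* Local Lipschitz bound for [P]. *)
Let normc_cont u0 v0 : exists2 M, 0 < M &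
  forall u v, normc (u - u0) < 1 -> normc (v - v0) < 1 -> normc (kap * pick u v) <= M.
Proof.
pose A := normc u0 + normc v0 + `|e1| + `|e2| + `|e3| + 1.
have A0 : 0 < A.
  by rewrite ltr_wpDl // !addr_ge0 ?normc_ge0 ?normr_ge0.
exists (normc kap * (A * A + A * A + A * A) + 1).
  by rewrite ltr_wpDl // mulr_ge0 ?normc_ge0 // !addr_ge0 // mulr_ge0 ?ltW.
move=> u v hu hv; rewrite normcM.
suff : normc (pick u v) <= A * A + A * A + A * A.
  by have := normc_ge0 kap; nra.
have b (x : C) x0 (e : R) : normc (x - x0) < 1 -> normc x0 + `|e| + 1 <= A -> normc (x - e%:C) <= A.
  move=> hx hA; have -> : x - e%:C = (x - x0) + (x0 + (- e%:C)) by ring.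
  apply: le_trans (le_normcD _ _) _.
  have := le_normcD x0 (- e%:C); rewrite normcN normc_real; lra.
have bu e : normc u0 + `|e| + 1 <= A -> normc (u - e%:C) <= A by exact: b.
have bv e : normc v0 + `|e| + 1 <= A -> normc (v - e%:C) <= A by exact: b.
have := normc_ge0 u0; have := normc_ge0 v0.
have := normr_ge0 e1; have := normr_ge0 e2; have := normr_ge0 e3.
move=> ? ? ? ? ?.
have u2 : normc (u - e2%:C) <= A by apply: bu; rewrite /A; lra.
have u3 : normc (u - e3%:C) <= A by apply: bu; rewrite /A; lra.
have v1 : normc (v - e1%:C) <= A by apply: bv; rewrite /A; lra.
have v2 : normc (v - e2%:C) <= A by apply: bv; rewrite /A; lra.
apply: le_trans (le_normcD _ _) _; apply: lerD; last by rewrite normcM ler_pM ?normc_ge0.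
by apply: le_trans (le_normcD _ _) _; apply: lerD; rewrite normcM ler_pM ?normc_ge0.
Qed.

(* Along a solution the speed keeps its direction near a point where it does
   not vanish: its square varies continuously, and being a derivative it cannot
   jump between the two square roots. *)
Let direction (F F' : R -> C) t b p : t < b -> F' t = p -> p != 0 ->
  (forall s, t <= s < b -> cder F s (F' s)) ->
  (forall s, t <= s < b -> F' s ^+ 2 = P (F s)) ->
  exists2 r, 0 < r & forall s, t <= s < t + r -> s < b -> 1 / 2 < Re (F' s / p).
Proof.
move=> tb Ft p0 HF HP.
have tt : t <= t < b by rewrite lexx.
have [M M0 HM] := normc_cont (F t) (F t).
have p2 : 0 < normc (p ^+ 2) by rewrite normc_gt0 expf_neq0.
pose e := Num.min 1 (normc (p ^+ 2) / (2 * M)).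
have e0 : 0 < e by rewrite lt_min ltr01 divr_gt0 // mulr_gt0.
have [r r0 Hr] := cder_cont (HF t tt) e0.
exists r => // s /andP[ts sr] sb.
have near1 x : t <= x <= s -> normc ((F' x / p) ^+ 2 - 1) <= 1 / 2.
  move=> /andP[tx xs]; have xb := le_lt_trans xs sb.
  have /Hr : `|x - t| < r by rewrite ger0_norm; lra.
  rewrite lt_min => /andP[h1]; rewrite ltr_pdivlMr ?mulr_gt0 // => h2.
  have -> : (F' x / p) ^+ 2 - 1 = (P (F x) - P (F t)) / p ^+ 2.
    by rewrite -!HP ?tx // Ft; field.
  rewrite P_diff !normcM normcV ler_pdivrMr //.
  have := HM _ (F t) h1; rewrite subrr normc0 normcM => /(_ ltr01).
  have := normc_ge0 (F x - F t); have := normc_ge0 kap; nra.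
have D x : t <= x <= s -> is_derive x (1 : R) (fun y => Re (F y / p)) (Re (F' x / p)).
  move=> /andP[tx xs].
  have Hx : cder F x (F' x) by apply: HF; rewrite tx (le_lt_trans xs).
  have [H1 _] := cderM Hx (cder_cst x p^-1).
  by notypeclasses refine (der_eq H1 _); rewrite mulr0 addr0.
have pos : 0 < Re (F' s / p).
  apply: (darboux ts D) => [x xs|]; first exact: Re_sqr_near1 (near1 x xs).
  by rewrite Ft divff.
have := le_trans (normr_Re _) (near1 s _); rewrite ts lexx => /(_ isT).
move: pos; move: (F' s / p) => X X0; rewrite expr2 ReD ReM ReN /= => /ler_normlP[h _].
have := sqr_ge0 (Im X); nra.
Qed.

(** Two solutions of [w'^2 = P w] with the same initial value and the same
    initial speed agree as long as the speed of one of them does not vanish.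
    The equation is quadratic in the speed, so the difference [D] obeys
    [D' (phi' + psi') = P phi - P psi]; by the choice of direction the sum of
    the speeds stays away from 0 near a point of agreement, and Gronwall's
    inequality applies there. *)
Lemma ode_unique a b :
  (forall t, a <= t < b -> cder phi t (phi' t)) ->
  (forall t, a <= t < b -> cder psi t (psi' t)) ->
  (forall t, a <= t < b -> phi' t ^+ 2 = P (phi t)) ->
  (forall t, a <= t < b -> psi' t ^+ 2 = P (psi t)) ->
  (forall t, a <= t < b -> psi' t != 0) ->
  phi a = psi a -> phi' a = psi' a ->
  forall t, a <= t < b -> phi t = psi t /\ phi' t = psi' t.
Proof.
move=> Hphi Hpsi Ophi Opsi N Ea Ea'.
apply: real_induction => //.
- move=> t /andP[a_t tb] IH.
  have ab : a <= t < b by rewrite ltW.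
  have D := cderB (Hphi t ab) (Hpsi t ab).
  have E0 : phi t - psi t = 0.
    apply: normc_eq0P; apply/ler_addgt0Pl => e e0; rewrite addr0.
    have [r r0 Hr] := cder_cont D e0.
    pose h := Num.min (r / 2) (t - a).
    have h0 : 0 < h by rewrite lt_min; lra.
    have h1 : h <= r / 2 by rewrite ge_min lexx.
    have h2 : h <= t - a by rewrite ge_min lexx orbT.
    have := Hr (t - h); have -> : t - h - t = - h by ring.
    rewrite normrN gtr0_norm // (IH (t - h) _).1; last by lra.
    by rewrite subrr sub0r normcN => H; apply: ltW; apply: H; lra.
  split; first by apply/eqP; rewrite -subr_eq0 E0.
  apply/eqP; rewrite -subr_eq0; apply/eqP; apply: normc_eq0P.
  apply/ler_addgt0Pl => e e0; rewrite addr0.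
  have [r r0 Hr] := (cderP _ _ _).1 D e e0.
  pose h := Num.min (r / 2) (t - a).
  have h0 : 0 < h by rewrite lt_min; lra.
  have h1 : h <= r / 2 by rewrite ge_min lexx.
  have h2 : h <= t - a by rewrite ge_min lexx orbT.
  have := Hr (- h); rewrite normrN gtr0_norm // (IH (t - h) _).1; last by lra.
  rewrite E0 subrr subr0 sub0r normcN normcM normc_real normrN gtr0_norm //.
  by rewrite ler_pM2r //; apply; lra.
- move=> t /[dup] tab /andP[a_t tb] [Et Et'].
  have IN s : t <= s < b -> a <= s < b by case/andP=> ts ->; rewrite (le_trans a_t).
  have p0 := N t tab.
  have [r1 r10 H1] := direction tb Et' p0 (fun s hs => Hphi s (IN s hs)) (fun s hs => Ophi s (IN s hs)).
  have [r2 r20 H2] := direction tb erefl p0 (fun s hs => Hpsi s (IN s hs)) (fun s hs => Opsi s (IN s hs)).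
  have [M M0 HM] := normc_cont (phi t) (psi t).
  have [r3 r30 H3] := cder_cont (Hphi t tab) ltr01.
  have [r4 r40 H4] := cder_cont (Hpsi t tab) ltr01.
  pose r := Num.min (Num.min (Num.min r1 r2) (Num.min r3 r4)) (b - t).
  exists r; first by rewrite !lt_min r10 r20 r30 r40 subr_gt0.
  have sum s : t <= s < t + r -> normc (psi' t) <= normc (phi' s + psi' s).
    rewrite -ltrBlDl !lt_min => /andP[ts /andP[/andP[/andP[h1 h2] _] hb]].
    have sb : s < b by lra.
    have R1 : 1 / 2 < Re (phi' s / psi' t) by apply: H1 => //; lra.
    have R2 : 1 / 2 < Re (psi' s / psi' t) by apply: H2 => //; lra.
    have -> : phi' s + psi' s = psi' t * (phi' s / psi' t + psi' s / psi' t) by field.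
    rewrite normcM ler_peMr ?normc_ge0 //; apply: le_trans (normr_Re _).
    rewrite ReD ger0_norm; lra.
  have p1 : 0 < normc (psi' t) by rewrite normc_gt0.
  have E s : t <= s < t + r -> phi s = psi s.
    move=> /[dup] hs /andP[ts sr].
    apply/eqP; rewrite -subr_eq0; apply/eqP; apply: sqmod_le0.
    have := @gronwall _ (fun x => sqmod (phi x - psi x))
      (fun x => 2 * Re (conjc (phi x - psi x) * (phi' x - psi' x))) (2 * M / normc (psi' t)) t s ts.
    rewrite Et subrr => H; have Z0 : sqmod (0 : C) = 0 by rewrite /sqmod /= expr0n addr0.
    apply: le_trans (H _ _) _; last by rewrite Z0 mul0r.
    + move=> x /andP[tx xs].
      have xb : a <= x < b.
        by apply: IN; move: sr; rewrite -ltrBlDl !lt_min tx => /andP[_]; lra.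
      exact: cder_sqmod (cderB (Hphi x xb) (Hpsi x xb)).
    + move=> x /andP[tx xs].
      have xr : t <= x < t + r by lra.
      have := sum x xr; move: xr; rewrite -ltrBlDl !lt_min => /andP[_ /andP[/andP[_ /andP[h3 h4]] hb]].
      have xb : a <= x < b by apply: IN; lra.
      have /H3 n3 : `|x - t| < r3 by rewrite ger0_norm; lra.
      have /H4 n4 : `|x - t| < r4 by rewrite ger0_norm; lra.
      set D := phi x - psi x; set d := phi' x - psi' x => hsum.
      have Dd : normc d * normc (phi' x + psi' x) <= normc D * M.
        rewrite -normcM; have -> : d * (phi' x + psi' x) = phi' x ^+ 2 - psi' x ^+ 2.
          by rewrite /d; ring.
        by rewrite Ophi // Opsi // P_diff normcM ler_wpM2l ?normc_ge0 // HM.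
      have {}Dd : normc d <= normc D * M / normc (psi' t).
        rewrite ler_pdivlMr //; apply: le_trans Dd.
        by rewrite ler_wpM2l ?normc_ge0.
      rewrite -mulrA -mulrA ler_wpM2l //.
      apply: le_trans (normr_Re_conj _ _) _; rewrite -/D -normc_sqr.
      have := normc_ge0 D; move: Dd; set q := (normc (psi' t))^-1; nra.
  move=> s /[dup] hs /andP[ts sr]; have Es := E s hs; split=> //.
  have sb : a <= s < b by apply: IN; move: sr; rewrite -ltrBlDl !lt_min ts => /andP[_]; lra.
  have S0 : phi' s + psi' s != 0.
    by rewrite -normc_gt0; apply: lt_le_trans p1 (sum s hs).
  apply/eqP; rewrite -subr_eq0; apply/eqP; apply: (mulIf S0); rewrite mul0r.
  have -> : (phi' s - psi' s) * (phi' s + psi' s) = phi' s ^+ 2 - psi' s ^+ 2 by ring.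
  by rewrite Ophi // Opsi // Es subrr.
Qed.

End ODE.
End Uniqueness.

(** * Uniqueness at a double pole *)

Section Pole.
Context {R : realType}.
Local Notation C := R[i].
Local Notation Re := (@complex.Re R).
Local Notation Im := (@complex.Im R).
Variables (e1 e2 e3 r0 : R).
Hypothesis r0_gt0 : 0 < r0.

Definition double_pole (phi : R -> C) := forall e : R, 0 < e -> exists2 r : R, 0 < r &
  forall x : R, 0 < x < r -> normc (x%:C ^+ 2 * phi x - 1) <= e.

Definition cubic_solution (phi phi' : R -> C) := forall x : R, 0 < x < r0 ->
  cder phi x (phi' x) /\ phi' x ^+ 2 = 4 * cubic e1 e2 e3 (phi x).

(** Near the pole the differential equation determines the speed up to sign,
    and the sign is that of [- 2 / x^3]: a solution with increasing real part
    would stay bounded above as [x] decreases to 0. *)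
Lemma pole_expansion (phi phi' : R -> C) (e : R) : 0 < e <= 1 / 18 ->
  double_pole phi -> cubic_solution phi phi' ->
  exists2 r : R, 0 < r <= r0 & forall x, 0 < x < r ->
    [/\ normc (x%:C ^+ 2 * (phi x - e1%:C) - 1) <= e,
        normc (x%:C ^+ 2 * (phi x - e2%:C) - 1) <= e,
        normc (x%:C ^+ 2 * (phi x - e3%:C) - 1) <= e &
        normc (- x%:C ^+ 3 * phi' x / 2 - 1) <= 9 * e].
Proof.
move=> /andP[e_gt0 e_le] pole sol.
have [|r1 r10 H1] := pole (e / 2); first by lra.
pose M := `|e1| + `|e2| + `|e3| + 1.
have ? := normr_ge0 e1; have ? := normr_ge0 e2; have ? := normr_ge0 e3.
have M0 : 0 < M by rewrite /M; lra.
pose r := Num.min (Num.min r0 r1) (Num.min 1 (e / (2 * M))).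
have r_gt0 : 0 < r by rewrite !lt_min r0_gt0 r10 ltr01 divr_gt0 ?mulr_gt0.
have rr0 : r <= r0 by rewrite !ge_min lexx.
have near x d : 0 < x < r -> `|d| <= M -> normc (x%:C ^+ 2 * (phi x - d%:C) - 1) <= e.
  move=> /andP[x0]; rewrite !lt_min => /andP[/andP[_ x1] /andP[x2]].
  rewrite ltr_pdivlMr ?mulr_gt0 // => x3 hd.
  have -> : x%:C ^+ 2 * (phi x - d%:C) - 1 = (x%:C ^+ 2 * phi x - 1) + (- x ^+ 2 * d)%:C.
    by rewrite rmorphM rmorphN rmorphXn /=; ring.
  have := H1 x; rewrite x0 x1 => /(_ isT) h.
  apply: le_trans (le_normcD _ _) _; rewrite normc_real normrM normrN (ger0_norm (sqr_ge0 x)).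
  have a1 : x ^+ 2 * `|d| <= x * M.
    rewrite expr2 -mulrA; apply: ler_wpM2l; first exact: ltW.
    by rewrite -[leRHS]mul1r; apply: ler_pM => //; exact: ltW.
  lra.
have near1 x : 0 < x < r -> normc (x%:C ^+ 2 * (phi x - e1%:C) - 1) <= e.
  by move=> hx; apply: near => //; rewrite /M; lra.
have near2 x : 0 < x < r -> normc (x%:C ^+ 2 * (phi x - e2%:C) - 1) <= e.
  by move=> hx; apply: near => //; rewrite /M; lra.
have near3 x : 0 < x < r -> normc (x%:C ^+ 2 * (phi x - e3%:C) - 1) <= e.
  by move=> hx; apply: near => //; rewrite /M; lra.
have in0 x : 0 < x < r -> 0 < x < r0 by case/andP=> -> /lt_le_trans; apply.
pose X (x : R) := - x%:C ^+ 3 * phi' x / 2.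
have X2 x : 0 < x < r -> normc (X x ^+ 2 - 1) <= 9 * e.
  move=> hx.
  have -> : X x ^+ 2 = (x%:C ^+ 2 * (phi x - e1%:C)) * (x%:C ^+ 2 * (phi x - e2%:C))
     * (x%:C ^+ 2 * (phi x - e3%:C)).
    have := (sol x (in0 x hx)).2; rewrite /X /cubic => E.
    transitivity (x%:C ^+ 6 * (phi' x ^+ 2) / 4); first by field.
    by rewrite E; field.
  by apply: near1M3; [lra|exact: near1|exact: near2|exact: near3].
have ReX x : Re (X x) = - (x ^+ 3 * Re (phi' x) / 2).
  rewrite /X; have -> : - x%:C ^+ 3 * phi' x / 2 = (- (x ^+ 3 / 2))%:C * phi' x.
    by rewrite rmorphN rmorphM rmorphXn /= (fmorphV (real_complex R)) rmorph_nat; ring.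
  by rewrite ReM /= mul0r subr0; ring.
have X0 x : 0 < x < r -> Re (X x) != 0.
  by move=> hx; apply: Re_sqr_near1; apply: le_trans (X2 x hx) _; lra.
have d0 x : 0 < x < r -> Re (phi' x) != 0.
  by move=> hx; apply: contraNneq (X0 x hx) => E; rewrite ReX E mulr0 mul0r oppr0.
exists r; first by rewrite r_gt0.
move=> x /[dup] hx /andP[x0 xr]; split; [exact: near1|exact: near2|exact: near3|].
apply: root_near1; [by lra| |exact: X2].
rewrite lt_def X0 //= leNgt; apply/negP; rewrite ReX.
have x3 : 0 < x ^+ 3 by rewrite exprn_gt0.
move=> neg; have {}neg : 0 < Re (phi' x) by nra.
(* if the speed were positive, the solution could not blow up at 0 *)
have dphi y : 0 < y <= x -> is_derive y (1 : R) (fun z => Re (phi z)) (Re (phi' y)).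
  by case/andP=> y0 yx; apply: (sol y _).1.1; apply: in0; rewrite y0 (le_lt_trans yx).
have pos y : 0 < y <= x -> 0 < Re (phi' y).
  move=> /andP[y0 yx]; have hy z : y <= z <= x -> 0 < z <= x by case/andP=> /(lt_le_trans y0) ->.
  rewrite lt_def d0 ?y0 ?(le_lt_trans yx) //= leNgt; apply/negP => yneg.
  have := @darboux _ (fun z => - Re (phi z)) (fun z => - Re (phi' z)) y x yx.
  have A z : y <= z <= x -> is_derive z (1 : R) (fun z => - Re (phi z)) (- Re (phi' z)).
    by move=> /hy hz; apply: derN; exact: dphi.
  move=> /(_ A); rewrite !oppr_gt0 => B; suff : Re (phi' x) < 0 by lra.
  apply: B => // z hz; rewrite oppr_eq0 d0 //.
  by have /andP[-> zx] := hy z hz; rewrite (le_lt_trans zx).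
pose B := `|Re (phi x)| + 1.
have B0 : 0 < B by rewrite ltr_wpDl.
pose y := Num.min (x / 2) (1 / (4 * B)).
have y0 : 0 < y by rewrite lt_min; apply/andP; split; [lra|rewrite divr_gt0 ?mulr_gt0].
have yx : y <= x / 2 by rewrite ge_min lexx.
have yB : y <= 1 / (4 * B) by rewrite ge_min lexx orbT.
rewrite ler_pdivlMr ?mulr_gt0 // in yB.
have yr : 0 < y < r by lra.
have inc : Re (phi y) <= Re (phi x).
  apply: (@der_ge0_le _ (fun z => Re (phi z)) (fun z => Re (phi' z))); first by lra.
    by move=> z hz; apply: dphi; lra.
  by move=> z hz; apply: ltW; apply: pos; lra.
have r11 : r <= r1 by rewrite !ge_min lexx orbT.
have r12 : r <= 1 by rewrite !ge_min lexx !orbT.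
have := H1 y; have -> : 0 < y < r1 by lra.
move=> /(_ isT) /(le_trans (normr_Re _)).
have -> : Re (y%:C ^+ 2 * phi y - 1) = y ^+ 2 * Re (phi y) - 1.
  by rewrite -rmorphXn /= ReD ReN ReM /= mul0r subr0.
move=> /ler_normlP[h _].
have hB := ler_norm (Re (phi x)); have ? := normr_ge0 (Re (phi x)).
have y2 : 0 < y ^+ 2 by rewrite exprn_gt0.
have c1 : y ^+ 2 * Re (phi y) <= y ^+ 2 * B.
  by apply: ler_wpM2l; [exact: ltW|rewrite /B; lra].
have c2 : y ^+ 2 * B <= y * (y * (4 * B)) / 4 by lra.
have c3 : y * (y * (4 * B)) <= y * 1 by rewrite ler_wpM2l // ltW.
lra.
Qed.

(** [N] and [T] are close to 3 and 2, their limits at the pole. *)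
Lemma Re_ratio_ge0 (N T : C) : normc (N - 3) <= 1 / 10 -> normc (T - 2) <= 2 / 10 ->
  0 <= Re ((N - T) / T).
Proof.
have -> : (3 : C) = (3 : R)%:C by rewrite rmorph_nat.
have -> : (2 : C) = (2 : R)%:C by rewrite rmorph_nat.
move=> hN hT.
have u1 := le_trans (normr_Re _) hN; have u2 := le_trans (normr_Im _) hN.
have v1 := le_trans (normr_Re _) hT; have v2 := le_trans (normr_Im _) hT.
rewrite ReM ReV ImV; move: u1 u2 v1 v2; case: N hN => n1 n2 _; case: T hT => t1 t2 _ /=.
rewrite !subr0 => /ler_normlP[? ?] /ler_normlP[? ?] /ler_normlP[? ?] /ler_normlP[? ?].
have m0 : 0 < t1 ^+ 2 + t2 ^+ 2 by have := sqr_ge0 t2; nra.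
have -> : (n1 - t1) * (t1 / (t1 ^+ 2 + t2 ^+ 2)) - (n2 - t2) * (- t2 / (t1 ^+ 2 + t2 ^+ 2))
     = ((n1 - t1) * t1 + (n2 - t2) * t2) / (t1 ^+ 2 + t2 ^+ 2).
  by field; exact: lt0r_neq0.
apply: divr_ge0; last exact: ltW.
have : 1 <= (n1 - t1) * t1 by nra.
have : -1 <= (n2 - t2) * t2 by nra.
lra.
Qed.

(** The difference of two such solutions satisfies
    [phi' - psi' = - 2 (phi - psi) N / (x T)] with [N] close to 3 and [T] close
    to 2, so that the squared modulus of [x^2 (phi - psi)] decreases with [x].
    As it tends to 0 at the pole, it vanishes. *)
Lemma pole_unique (phi phi' psi psi' : R -> C) :
  double_pole phi -> double_pole psi ->
  cubic_solution phi phi' -> cubic_solution psi psi' ->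
  exists2 r : R, 0 < r <= r0 & forall x, 0 < x < r ->
    phi x = psi x /\ phi' x = psi' x.
Proof.
move=> pphi ppsi sphi spsi.
have e01 : 0 < (1 / 100 : R) <= 1 / 18 by lra.
have [ra /andP[ra0 rar] Ha] := pole_expansion e01 pphi sphi.
have [rb /andP[rb0 rbr] Hb] := pole_expansion e01 ppsi spsi.
pose r := Num.min ra rb.
have r_gt0 : 0 < r by rewrite lt_min ra0.
have rra : r <= ra by rewrite ge_min lexx.
have rrb : r <= rb by rewrite ge_min lexx orbT.
exists r; first by rewrite r_gt0 (le_trans rra).
have key x : 0 < x < r -> exists N T : C, [/\ normc (N - 3) <= 1 / 10, normc (T - 2) <= 2 / 10 &
    phi' x - psi' x = - 2 * (phi x - psi x) * N / (x%:C * T)].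
  move=> /andP[x0 xr].
  have [a1 a2 a3 aX] := Ha x (ltac:(lra)); have [b1 b2 b3 bX] := Hb x (ltac:(lra)).
  exists (x%:C ^+ 2 * (phi x - e2%:C) * (x%:C ^+ 2 * (phi x - e3%:C))
    + x%:C ^+ 2 * (psi x - e1%:C) * (x%:C ^+ 2 * (phi x - e3%:C))
    + x%:C ^+ 2 * (psi x - e1%:C) * (x%:C ^+ 2 * (psi x - e2%:C))).
  exists (- x%:C ^+ 3 * phi' x / 2 + - x%:C ^+ 3 * psi' x / 2).
  set X := - x%:C ^+ 3 * phi' x / 2 in aX *; set Y := - x%:C ^+ 3 * psi' x / 2 in bX *.
  set A2 := x%:C ^+ 2 * (phi x - e2%:C) in a2 *; set A3 := x%:C ^+ 2 * (phi x - e3%:C) in a3 *.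
  set B1 := x%:C ^+ 2 * (psi x - e1%:C) in b1 *; set B2 := x%:C ^+ 2 * (psi x - e2%:C) in b2 *.
  have hT : normc (X + Y - 2) <= 2 / 10.
    have -> : X + Y - 2 = (X - 1) + (Y - 1) by ring.
    by apply: le_trans (le_normcD _ _) _; lra.
  have e1' : 1 / 100 <= 1 :> R by lra.
  split=> //.
    have -> : A2 * A3 + B1 * A3 + B1 * B2 - 3 = (A2 * A3 - 1) + (B1 * A3 - 1) + (B1 * B2 - 1) by ring.
    apply: le_trans (le_normcD _ _) _; have := le_normcD (A2 * A3 - 1) (B1 * A3 - 1).
    have := near1M e1' a2 a3; have := near1M e1' b1 a3; have := near1M e1' b1 b2; lra.
  have T0 : X + Y != 0.
    apply/negP => /eqP E; move: hT; rewrite E sub0r normcN.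
    have -> : (2 : C) = (2 : R)%:C by rewrite rmorph_nat.
    rewrite normc_real normr_nat; lra.
  have xC : x%:C != 0 :> C by rewrite fmorph_eq0 lt0r_neq0.
  have S0 : phi' x + psi' x != 0.
    apply: contra_neq T0 => E; rewrite /X /Y.
    have -> : - x%:C ^+ 3 * phi' x / 2 + - x%:C ^+ 3 * psi' x / 2 = - x%:C ^+ 3 * (phi' x + psi' x) / 2 by field.
    by rewrite E mulr0 mul0r.
  have hx : 0 < x < r0 by lra.
  have o1 := (sphi x hx).2; have o2 := (spsi x hx).2.
  apply: (mulIf S0).
  have -> : (phi' x - psi' x) * (phi' x + psi' x) = phi' x ^+ 2 - psi' x ^+ 2 by ring.
  have -> : X + Y = - x%:C ^+ 3 * (phi' x + psi' x) / 2 by rewrite /X /Y; field.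
  rewrite o1 o2 /cubic /A2 /A3 /B1 /B2.
  by field; rewrite S0.
pose E (x : R) := x%:C ^+ 2 * (phi x - psi x).
have dE x : 0 < x < r -> exists2 dn, is_derive x (1 : R) (fun y => sqmod (E y)) dn & dn <= 0.
  move=> /[dup] hx /andP[x0 xr]; have [N [T [hN hT Ed]]] := key x hx.
  have hx0 : 0 < x < r0 by lra.
  have D := cderB (sphi x hx0).1 (spsi x hx0).1.
  have Dx := cder_real (der_id x).
  have DE : cder E x (E x * ((2 / x)%:C * (1 - N / T))).
    apply: cder_eq (cder_ext _ (cderM (cderM Dx Dx) D)) _ => [y|]; first by rewrite /E; ring.
    have T0 : T != 0.
      apply/negP => /eqP ET; move: hT; rewrite ET sub0r normcN.
      have -> : (2 : C) = (2 : R)%:C by rewrite rmorph_nat.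
      rewrite normc_real normr_nat; lra.
    have xC : x%:C != 0 :> C by rewrite fmorph_eq0 lt0r_neq0.
    rewrite Ed /E rmorphM (fmorphV (real_complex R)) rmorph_nat rmorph1; field.
    by rewrite T0.
  eexists; first exact: cder_sqmod DE.
  rewrite Re_conj_mul pmulr_rle0 //.
  rewrite [X in X <= 0](_ : _ = - ((2 / x) * (sqmod (E x) * Re ((N - T) / T))));
    last first.
    have -> : Re ((2 / x)%:C * (1 - N / T)) = 2 / x * Re (1 - N / T) by rewrite ReM /= mul0r subr0.
    have T0 : T != 0.
      apply/negP => /eqP ET; move: hT; rewrite ET sub0r normcN.
      have -> : (2 : C) = (2 : R)%:C by rewrite rmorph_nat.
      rewrite normc_real normr_nat; lra.
    have -> : 1 - N / T = - ((N - T) / T) by field.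
    by rewrite ReN; ring.
  rewrite oppr_le0; apply: mulr_ge0; first by rewrite divr_ge0 // ltW.
  apply: mulr_ge0; first by rewrite -normc_sqr sqr_ge0.
  exact: Re_ratio_ge0.
have E0 x : 0 < x < r -> E x = 0.
  move=> /andP[x0 xr]; apply: sqmod_le0; apply/ler_addgt0Pl => e e_gt0; rewrite addr0.
  pose e' := Num.min 1 (e / 4).
  have e'0 : 0 < e' by rewrite lt_min ltr01; lra.
  have e'1 : e' <= 1 by rewrite ge_min lexx.
  have e'e : e' <= e / 4 by rewrite ge_min lexx orbT.
  have [s1 s10 S1] := pphi e' e'0; have [s2 s20 S2] := ppsi e' e'0.
  pose y := Num.min (x / 2) (Num.min (s1 / 2) (s2 / 2)).
  have y0 : 0 < y by rewrite !lt_min; lra.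
  have yx : y <= x / 2 by rewrite ge_min lexx.
  have y1 : y <= s1 / 2 by rewrite !ge_min lexx orbT.
  have y2 : y <= s2 / 2 by rewrite !ge_min lexx !orbT.
  have Ey : normc (E y) <= 2 * e'.
    have -> : E y = (y%:C ^+ 2 * phi y - 1) - (y%:C ^+ 2 * psi y - 1) by rewrite /E; ring.
    have h1 : normc (y%:C ^+ 2 * phi y - 1) <= e' by apply: S1; lra.
    have h2 : normc (y%:C ^+ 2 * psi y - 1) <= e' by apply: S2; lra.
    by apply: le_trans (le_normcD _ _) _; rewrite normcN; lra.
  have dec : sqmod (E x) <= sqmod (E y).
    have yx' : y <= x by lra.
    pose dd z := if pselect (0 < z < r) is left h then s2val (cid2 (dE z h)) else 0.
    rewrite -lerN2.
    apply: (@der_ge0_le _ (fun z => - sqmod (E z)) (fun z => - dd z)) yx' _ _ => z hz.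
      apply: derN; rewrite /dd; case: pselect => [h|]; last by case; lra.
      by case: cid2.
    rewrite oppr_ge0 /dd; case: pselect => [h|//].
    by case: cid2.
  by apply: le_trans dec _; rewrite -normc_sqr; have := normc_ge0 (E y); nra.
move=> x hx; have x0 : x%:C != 0 :> C by rewrite fmorph_eq0 lt0r_neq0 //; case/andP: hx.
have Ex : phi x = psi x.
  have := E0 x hx; rewrite /E => /eqP; rewrite mulf_eq0 expf_eq0 (negPf x0) /= subr_eq0.
  by move=> /eqP.
split=> //; have [N [T [_ _]]] := key x hx.
by rewrite Ex subrr mulr0 !mul0r => /eqP; rewrite subr_eq0 => /eqP.
Qed.

End Pole.

(** * Jacobi and Weierstrass functions of a complex argument *)

Section ComplexJacobi.
Context {R : realType}.
Local Notation C := R[i].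
Local Notation Re := (@complex.Re R).
Local Notation Im := (@complex.Im R).
Variables (k k' : R) (s c d s' c' d' : R -> R) (K K' : R).
Hypothesis kk' : k ^+ 2 + k' ^+ 2 = 1.
Hypothesis J : is_jacobi k s c d K.
Hypothesis J' : is_jacobi k' s' c' d' K'.

(** The addition formula for the argument [x + i y], after Jacobi's imaginary
    transformation: primed functions belong to the complementary modulus. *)
Definition jden (x y : R) := c' y ^+ 2 + k ^+ 2 * s x ^+ 2 * s' y ^+ 2.
Definition jsn (x y : R) : C :=
  (s x * d' y / jden x y) +i* (c x * d x * s' y * c' y / jden x y).
Definition jcn (x y : R) : C :=
  (c x * c' y / jden x y) +i* (- (s x * d x * s' y * d' y) / jden x y).
Definition jdn (x y : R) : C :=
  (d x * c' y * d' y / jden x y) +i* (- (k ^+ 2 * s x * c x * s' y) / jden x y).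

Let Ec x : c x ^+ 2 = 1 - s x ^+ 2. Proof. by have := jacobi_sc J x; lra. Qed.
Let Ed x : d x ^+ 2 = 1 - k ^+ 2 * s x ^+ 2. Proof. by have := jacobi_sd J x; lra. Qed.
Let Ec' x : c' x ^+ 2 = 1 - s' x ^+ 2. Proof. by have := jacobi_sc J' x; lra. Qed.
Let Ed' x : d' x ^+ 2 = 1 - (1 - k ^+ 2) * s' x ^+ 2.
Proof.
have k'E : k' ^+ 2 = 1 - k ^+ 2 by rewrite -kk'; ring.
by have := jacobi_sd J' x; rewrite k'E; lra.
Qed.

Lemma jsn_cn x y : jden x y != 0 -> jsn x y ^+ 2 + jcn x y ^+ 2 = 1.
Proof.
have := Ec x; have := Ed x; have := Ec' y; have := Ed' y.
rewrite /jsn /jcn /jden; set a := s x; set b := c x; set e := d x.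
set a' := s' y; set b' := c' y; set e' := d' y => H1 H2 H3 H4 D.
apply: cplx_eq; rewrite !expr2 !ReImE /=; field: H1 H2 H3 H4; by rewrite ?exprMn.
Qed.

Lemma jsn_dn x y : jden x y != 0 -> k%:C ^+ 2 * jsn x y ^+ 2 + jdn x y ^+ 2 = 1.
Proof.
have := Ec x; have := Ed x; have := Ec' y; have := Ed' y.
rewrite /jsn /jdn /jden; set a := s x; set b := c x; set e := d x.
set a' := s' y; set b' := c' y; set e' := d' y => H1 H2 H3 H4 D.
apply: cplx_eq; rewrite !expr2 !ReImE /=; field: H1 H2 H3 H4; by rewrite ?exprMn.
Qed.

Lemma cder_jsn_x x y : jden x y != 0 ->
  cder (fun t => jsn t y) x (jcn x y * jdn x y).
Proof.
have := Ec x; have := Ed x; have := Ec' y; have := Ed' y.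
have := jacobi_ds J x; have := jacobi_dc J x; have := jacobi_dd J x => /= D1 D2 D3 H1 H2 H3 H4 D.
split; rewrite /jsn /jcn /jdn /=.
- rewrite /jden in D *; der; move: D H1 H2 H3 H4; clear.
  set a := s x; set b := c x; set e := d x; set a' := s' y; set b' := c' y; set e' := d' y.
  by move=> D H1 H2 H3 H4; field: H1 H2 H3 H4; by rewrite ?exprMn.
- rewrite /jden in D *; der; move: D H1 H2 H3 H4; clear.
  set a := s x; set b := c x; set e := d x; set a' := s' y; set b' := c' y; set e' := d' y.
  by move=> D H1 H2 H3 H4; field: H1 H2 H3 H4; by rewrite ?exprMn.
Qed.

Lemma cder_jsn_y x y : jden x y != 0 ->
  cder (fun t => jsn x t) y (jcn x y * jdn x y * 'i).
Proof.
have := Ec x; have := Ed x; have := Ec' y; have := Ed' y.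
have := jacobi_ds J' y; have := jacobi_dc J' y; have := jacobi_dd J' y => /=.
have -> : k' ^+ 2 = 1 - k ^+ 2 by rewrite -kk'; ring.
move=> D1 D2 D3 H1 H2 H3 H4 D.
split; rewrite /jsn /jcn /jdn /=.
- rewrite /jden in D *; der; move: D H1 H2 H3 H4; clear.
  set a := s x; set b := c x; set e := d x; set a' := s' y; set b' := c' y; set e' := d' y.
  by move=> D H1 H2 H3 H4; field: H1 H2 H3 H4; by rewrite ?exprMn.
- rewrite /jden in D *; der; move: D H1 H2 H3 H4; clear.
  set a := s x; set b := c x; set e := d x; set a' := s' y; set b' := c' y; set e' := d' y.
  by move=> D H1 H2 H3 H4; field: H1 H2 H3 H4; by rewrite ?exprMn.
Qed.

Hypothesis k0 : 0 < k.

(* The zeros of [s] and [c] are disjoint, so that the denominator vanishes only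
   at the poles. *)
Let c0s' y : c' y = 0 -> s' y != 0.
Proof.
by move=> E; apply/eqP => E'; have := jacobi_sc J' y; rewrite E E' expr0n addr0 => /eqP; rewrite eq_sym oner_eq0.
Qed.

Lemma jden_gt0 x y : 0 < x < 2 * K -> 0 < jden x y.
Proof.
move=> hx; have sx := jacobi_s_gt0 J hx; rewrite /jden.
have [E|E] := eqVneq (c' y) 0.
  rewrite E expr0n add0r; apply: mulr_gt0; first by rewrite mulr_gt0 ?exprn_gt0.
  by rewrite exprn_even_gt0 //= c0s'.
by rewrite ltr_pwDl ?exprn_even_gt0 // mulr_ge0 ?sqr_ge0 // mulr_ge0 ?sqr_ge0.
Qed.

Lemma jsn_neq0 x y : 0 < x < 2 * K -> jsn x y != 0.
Proof.
move=> hx; have sx := jacobi_s_gt0 J hx; have D := jden_gt0 y hx.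
rewrite eq_complex /= negb_and; apply/orP; left.
by rewrite lt0r_neq0 // divr_gt0 // mulr_gt0 // (jacobi_d_gt0 J').
Qed.

Lemma jcn_dn_neq0 x y : 0 < x < K -> jcn x y * jdn x y != 0.
Proof.
move=> /[dup] hx /andP[x0 xK].
have h2 : 0 < x < 2 * K by lra.
have sx := jacobi_s_gt0 J h2; have D := jden_gt0 y h2.
have cx : 0 < c x by apply: (jacobi_c_gt0 J); lra.
have dx := lt0r_neq0 (jacobi_d_gt0 J x); have d'y := lt0r_neq0 (jacobi_d_gt0 J' y).
have {}sx := lt0r_neq0 sx; have {}cx := lt0r_neq0 cx; have {}D := lt0r_neq0 D.
have kn := lt0r_neq0 k0.
have quot a : a != 0 -> a / jden x y != 0 by move=> a0; rewrite mulf_neq0 ?invr_eq0.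
have [E|E] := eqVneq (c' y) 0.
  have s'y := c0s' E.
  apply: mulf_neq0; rewrite eq_complex /= negb_and; apply/orP; right;
    by apply: quot; rewrite oppr_eq0 !mulf_neq0.
by apply: mulf_neq0; rewrite eq_complex /= negb_and; apply/orP; left; apply: quot; rewrite !mulf_neq0.
Qed.

Variables (lam e3 : R).
Hypothesis lam0 : 0 < lam.
(** The Weierstrass function with half periods [K / lam] and [i K' / lam], in the
    form [e3 + (e1 - e3) / sn^2]. *)
Definition jwp (x y : R) : C := e3%:C + lam%:C ^+ 2 / jsn (lam * x) (lam * y) ^+ 2.
Definition jwp' (x y : R) : C :=
  - 2 * lam%:C ^+ 3 * (jcn (lam * x) (lam * y) * jdn (lam * x) (lam * y))
     / jsn (lam * x) (lam * y) ^+ 3.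

Let lamC : lam%:C != 0 :> C. Proof. by rewrite fmorph_eq0 lt0r_neq0. Qed.

Lemma lam_itv x (A : R) : 0 < x < A / lam -> 0 < lam * x < A.
Proof. by move=> /andP[x0]; rewrite ltr_pdivlMr // mulrC mulr_gt0 // => ->. Qed.

Section Points.
Variables (x y : R).
Hypothesis hx : 0 < x < 2 * K / lam.
Let hlx : 0 < lam * x < 2 * K. Proof. exact: lam_itv. Qed.
Let den0 : jden (lam * x) (lam * y) != 0. Proof. exact/lt0r_neq0/jden_gt0. Qed.
Let sn0 : jsn (lam * x) (lam * y) != 0. Proof. exact: jsn_neq0. Qed.

Lemma cder_jwp_x : cder (fun t => jwp t y) x (jwp' x y).
Proof.
have dl : is_derive x (1 : R) (fun t => lam * t) lam by der; ring.
have H := cder_comp dl (cder_jsn_x den0).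
have H2 := cderM H H.
have N2 : jsn (lam * x) (lam * y) * jsn (lam * x) (lam * y) != 0 by rewrite mulf_neq0.
have H3 := cderD (cder_cst x e3%:C) (cderM (cder_cst x (lam%:C ^+ 2)) (cderV N2 H2)).
apply: cder_eq (cder_ext _ H3) _ => [t|]; first by rewrite /jwp expr2.
by rewrite /jwp'; field.
Qed.

Lemma cder_jwp_y : cder (fun t => jwp x t) y (jwp' x y * 'i).
Proof.
have dl : is_derive y (1 : R) (fun t => lam * t) lam by der; ring.
have H := cder_comp dl (cder_jsn_y den0).
have H2 := cderM H H.
have N2 : jsn (lam * x) (lam * y) * jsn (lam * x) (lam * y) != 0 by rewrite mulf_neq0.
have H3 := cderD (cder_cst y e3%:C) (cderM (cder_cst y (lam%:C ^+ 2)) (cderV N2 H2)).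
apply: cder_eq (cder_ext _ H3) _ => [t|]; first by rewrite /jwp expr2.
by rewrite /jwp'; field.
Qed.

Lemma jwp_ode : jwp' x y ^+ 2 =
  4 * cubic (e3 + lam ^+ 2) (e3 + k ^+ 2 * lam ^+ 2) e3 (jwp x y).
Proof.
have h1 := jsn_cn den0; have h2 := jsn_dn den0.
rewrite /jwp' /cubic /jwp !rmorphD !rmorphM /=.
move: h1 h2 sn0; set S := jsn _ _; set CC := jcn _ _; set D := jdn _ _ => h1 h2 S0.
have {h1} h1 : CC ^+ 2 = 1 - S ^+ 2 by rewrite -h1; ring.
have {h2} h2 : D ^+ 2 = 1 - k%:C ^+ 2 * S ^+ 2 by rewrite -h2; ring.
by field: h1 h2.
Qed.
End Points.

Lemma jwp'_neq0 x y : 0 < x < K / lam -> jwp' x y != 0.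
Proof.
move=> /lam_itv h; have K0 := jacobi_K_gt0 J.
have h2 : 0 < lam * x < 2 * K by lra.
rewrite /jwp' !mulf_neq0 ?invr_eq0 ?expf_neq0 ?oppr_eq0 ?jsn_neq0 ?pnatr_eq0 //.
have := jcn_dn_neq0 (lam * y) h; rewrite mulf_eq0 negb_or => /andP[-> _] //.
have := jcn_dn_neq0 (lam * y) h; rewrite mulf_eq0 negb_or => /andP[_ ->] //.
Qed.
End ComplexJacobi.

(** * Comparison of the period lattices *)

Section WpLike.
Context {R : realType}.
Local Notation C := R[i].
Local Notation Re := (@complex.Re R).
Local Notation Im := (@complex.Im R).

Definition rect_lattice (w1 w2 : R) (z : C) : Prop :=
  (exists m : int, Re z = 2 * w1 * m%:~R) /\ (exists n : int, Im z = 2 * w2 * n%:~R).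

(** A solution of the Weierstrass equation with roots [e1], [e2], [e3], half
    periods [w1] and [i w2] and a normalised double pole at each lattice point.
    Unlike the hypotheses on wp, this class is stable under the rotation by a
    right angle, which permits treating the two axes alike. *)
Record wp_like (f f' : C -> C) (e1 e2 e3 w1 w2 : R) : Prop := {
  wl_w1 : 0 < w1;
  wl_w2 : 0 < w2;
  wl_der : forall (a v : C) (t : R), ~ rect_lattice w1 w2 (a + t%:C * v) ->
    cder (fun x => f (a + x%:C * v)) t (f' (a + t%:C * v) * v);
  wl_ode : forall z, ~ rect_lattice w1 w2 z -> f' z ^+ 2 = 4 * cubic e1 e2 e3 (f z);
  wl_pole : forall l, rect_lattice w1 w2 l -> forall e : R, 0 < e ->
    exists2 r : R, 0 < r & forall h : C, h != 0 -> normc h < r ->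
      normc (h ^+ 2 * f (l + h) - 1) <= e }.

Lemma int_mul_itv (w x : R) (m : int) : 0 < w -> 0 < x < 2 * w -> x = 2 * w * m%:~R -> False.
Proof.
move=> w0 /andP[x0 xw] E; have w2 : 0 < 2 * w by rewrite mulr_gt0.
move: x0 xw; rewrite E pmulr_rgt0 // gtr_pMr // ltr0z.
by rewrite ltrz1 gtz0_ge1 ltNge => ->.
Qed.

Lemma off_lattice_Re w1 w2 z : 0 < w1 -> 0 < Re z < 2 * w1 -> ~ rect_lattice w1 w2 z.
Proof. by move=> w0 h [[m E] _]; exact: int_mul_itv w0 h E. Qed.

(** Multiplication of the argument by [i] exchanges the two half periods. *)
Lemma wp_like_rot f f' e1 e2 e3 w1 w2 : wp_like f f' e1 e2 e3 w1 w2 ->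
  wp_like (fun z => - f ('i * z)) (fun z => - 'i * f' ('i * z)) (- e3) (- e2) (- e1) w2 w1.
Proof.
case=> w10 w20 Hd Ho Hp.
have lat z : rect_lattice w2 w1 z <-> rect_lattice w1 w2 ('i * z).
  rewrite /rect_lattice !ReImE /= !mul0r !mul1r sub0r add0r.
  split=> -[[m Em] [n En]]; split; [exists (- n)|exists m|exists n|exists (- m)] => //.
  - by rewrite En mulrNz mulrN.
  - by rewrite mulrNz mulrN -Em opprK.
split=> //.
- move=> a v t; rewrite lat; have -> : 'i * (a + t%:C * v) = 'i * a + t%:C * ('i * v) by ring.
  move=> /Hd H; apply: cder_eq (cder_ext _ (cderN H)) _ => [x|]; last by ring.
  by congr (- f _); ring.
- move=> z; rewrite lat => /Ho; rewrite exprMn sqrrN sqr_i => ->.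
  by rewrite /cubic !rmorphN /=; ring.
- move=> l; rewrite lat => /Hp H e e0; have [r r0 Hr] := H e e0.
  exists r => // h h0 hr.
  have -> : h ^+ 2 * - f ('i * (l + h)) - 1 = ('i * h) ^+ 2 * f ('i * l + 'i * h) - 1.
    by rewrite exprMn sqr_i mulrDr; ring.
  apply: Hr; last by rewrite normcM normc_i mul1r.
  by rewrite mulf_neq0 // -normc_gt0 normc_i.
Qed.

Lemma wp_like_opp f f' e1 e2 e3 w1 w2 : wp_like f f' e1 e2 e3 w1 w2 ->
  wp_like (fun z => f (- z)) (fun z => - f' (- z)) e1 e2 e3 w1 w2.
Proof.
case=> w10 w20 Hd Ho Hp.
have lat z : rect_lattice w1 w2 z <-> rect_lattice w1 w2 (- z).
  rewrite /rect_lattice !ReImE /=.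
  split=> -[[m Em] [n En]]; split; [exists (- m)|exists (- n)|exists (- m)|exists (- n)];
    rewrite mulrNz mulrN.
  - by rewrite Em.
  - by rewrite En.
  - by rewrite -Em opprK.
  - by rewrite -En opprK.
split=> //.
- move=> a v t; rewrite lat; have -> : - (a + t%:C * v) = - a + t%:C * - v by ring.
  move=> /Hd H; apply: cder_eq (cder_ext _ H) _ => [x|]; last by ring.
  by congr f; ring.
- by move=> z; rewrite lat => /Ho; rewrite sqrrN.
- move=> l; rewrite lat => /Hp H e e0; have [r r0 Hr] := H e e0.
  exists r => // h h0 hr.
  have -> : h ^+ 2 * f (- (l + h)) - 1 = (- h) ^+ 2 * f (- l + - h) - 1.
    by rewrite opprD sqrrN.
  by apply: Hr; rewrite ?oppr_eq0 ?normcN.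
Qed.

Section Compare.
Variables (f f' : C -> C) (e3 w1 w2 lam k k' : R) (s c d s' c' d' : R -> R) (K K' : R).
Hypothesis k0 : 0 < k.
Hypothesis k'0 : 0 < k'.
Hypothesis lam0 : 0 < lam.
Hypothesis kk' : k ^+ 2 + k' ^+ 2 = 1.
Hypothesis J : is_jacobi k s c d K.
Hypothesis J' : is_jacobi k' s' c' d' K'.
Hypothesis W : wp_like f f' (e3 + lam ^+ 2) (e3 + k ^+ 2 * lam ^+ 2) e3 w1 w2.

Let K0 := jacobi_K_gt0 J.
Let K'0 := jacobi_K_gt0 J'.
Let w10 := wl_w1 W.
Let w20 := wl_w2 W.
Local Notation g := (jwp k s c d s' c' d' lam e3).
Local Notation g' := (jwp' k s c d s' c' d' lam).

Let s'0 : s' 0 = 0. Proof. exact: jacobi_s0 J'. Qed.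
Let c'0 : c' 0 = 1. Proof. exact: jacobi_c0 J'. Qed.
Let d'0 : d' 0 = 1.
Proof.
have := jacobi_sd J' 0; rewrite s'0 expr0n mulr0 add0r => /eqP; rewrite sqrf_eq1.
by case/orP=> /eqP // E; have := jacobi_d_gt0 J' 0; rewrite E; lra.
Qed.
Let d0 : d 0 = 1.
Proof.
have := jacobi_sd J 0; rewrite (jacobi_s0 J) expr0n mulr0 add0r => /eqP; rewrite sqrf_eq1.
by case/orP=> /eqP // E; have := jacobi_d_gt0 J 0; rewrite E; lra.
Qed.
Let s'2 : s' (2 * K') = 0. Proof. by have := jacobi_sD J' 0; rewrite add0r s'0 oppr0. Qed.
Let c'2 : c' (2 * K') = -1. Proof. by have := jacobi_cD J' 0; rewrite add0r c'0. Qed.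
Let d'2 : d' (2 * K') = 1.
Proof.
have := jacobi_sd J' (2 * K'); rewrite s'2 expr0n mulr0 add0r => /eqP; rewrite sqrf_eq1.
by case/orP=> /eqP // E; have := jacobi_d_gt0 J' (2 * K'); rewrite E; lra.
Qed.
Let c'K : c' K' = 0.
Proof.
have := jacobi_sc J' K'; rewrite (jacobi_sK J') expr1n => E.
have /eqP : c' K' ^+ 2 = 0 by lra.
by rewrite sqrf_eq0 => /eqP.
Qed.

Let lam_neq0 : lam != 0 := lt0r_neq0 lam0.

Lemma jwp_axis x y : s' (lam * y) = 0 -> c' (lam * y) ^+ 2 = 1 -> d' (lam * y) = 1 ->
  g x y = (e3 + lam ^+ 2 / s (lam * x) ^+ 2)%:C.
Proof.
move=> E1 E2 E3; rewrite /jwp.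
have -> : jsn k s c d s' c' d' (lam * x) (lam * y) = (s (lam * x))%:C.
  apply: cplx_eq; rewrite /jsn /jden /= E1 E2 ?E3 expr0n /= !mulr0 addr0; first by rewrite mulr1 divr1.
  by rewrite !mul0r.
by rewrite rmorphD rmorphM fmorphV /= !rmorphXn.
Qed.

Lemma jwp_axis0 x : g x 0 = (e3 + lam ^+ 2 / s (lam * x) ^+ 2)%:C.
Proof. by apply: jwp_axis; rewrite mulr0 // c'0 expr1n. Qed.

Lemma jwp_axis_period x : g x (2 * K' / lam) = g x 0.
Proof.
rewrite jwp_axis0; have E : lam * (2 * K' / lam) = 2 * K' by field.
by apply: jwp_axis; rewrite E // c'2 sqrrN expr1n.
Qed.

Lemma jwp_half x : 0 < x < 2 * K / lam ->
  g x (K' / lam) = (e3 + k ^+ 2 * lam ^+ 2 * s (lam * x) ^+ 2)%:C.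
Proof.
move=> /lam_itv - /(_ lam0) /(jacobi_s_gt0 J) sx; have E : lam * (K' / lam) = K' by field.
have d'K : d' K' = k.
  have := jacobi_sd J' K'; rewrite (jacobi_sK J') expr1n mulr1 => E2.
  have /eqP : d' K' ^+ 2 = k ^+ 2 by have := kk'; lra.
  rewrite eqf_sqr => /orP[/eqP //|/eqP E3]; have := jacobi_d_gt0 J' K'; rewrite E3; have := k0; lra.
have s0 := lt0r_neq0 sx; have kn := lt0r_neq0 k0.
have -> : g x (K' / lam) = e3%:C + lam%:C ^+ 2 / ((k * s (lam * x))^-1)%:C ^+ 2.
  rewrite /jwp E; congr (_ + _ / _ ^+ 2).
  apply: cplx_eq; rewrite /jsn /jden /= c'K (jacobi_sK J') ?d'K ?expr0n ?expr1n /=; first by field; rewrite s0.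
  by rewrite mulr0 mul0r.
rewrite -!rmorphXn -fmorphV /= -rmorphM -rmorphD; congr (_%:C); field.
by rewrite s0.
Qed.

Lemma jwp_double_pole : double_pole (fun x => g x 0).
Proof.
move=> e e_gt0.
pose eta := Num.min (1 / 2) (e / 20).
have eta0 : 0 < eta by rewrite lt_min; lra.
have eta1 : eta <= 1 / 2 by rewrite ge_min lexx.
have eta2 : eta <= e / 20 by rewrite ge_min lexx orbT.
have ds0 : is_derive 0 (1 : R) s 1 by have := jacobi_ds J 0; rewrite (jacobi_c0 J) d0 mulr1.
have [r r0 Hr] := (derP _ _ _).1 ds0 eta eta0.
pose M := `|e3| + 1; have M0 : 0 < M by rewrite ltr_wpDl.
pose r' := Num.min (r / lam) (Num.min 1 (e / (2 * M))).
exists r'; first by rewrite !lt_min ltr01 !divr_gt0 // mulr_gt0.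
move=> x /andP[x0]; rewrite !lt_min => /andP[]; rewrite ltr_pdivlMr // => x1 /andP[x2].
rewrite ltr_pdivlMr ?mulr_gt0 // => x3.
rewrite mulrC in x1.
have h0 : 0 < lam * x by rewrite mulr_gt0.
have := Hr (lam * x); rewrite add0r (jacobi_s0 J) subr0 mul1r gtr0_norm // => /(_ x1).
set h := lam * x in h0 *; set S := s h => /ler_normlP[h1 h2].
have S0 : h / 2 <= S by nra.
have Sn : S != 0 by apply: lt0r_neq0; lra.
rewrite jwp_axis0; set Y := e3 + _.
have -> : x%:C ^+ 2 * Y%:C - 1 = (x ^+ 2 * Y - 1)%:C by rewrite rmorphB rmorphM rmorph1 rmorphXn.
rewrite normc_real /Y -/h -/S.
have -> : x ^+ 2 * (e3 + lam ^+ 2 / S ^+ 2) - 1 = x ^+ 2 * e3 + (h - S) * (h + S) / S ^+ 2.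
  by rewrite /h; field.
apply: le_trans (ler_normD _ _) _.
have b1 : `|x ^+ 2 * e3| <= e / 2.
  rewrite normrM (ger0_norm (sqr_ge0 x)) expr2 -mulrA.
  have : `|e3| <= M by rewrite lerDl.
  have := normr_ge0 e3; nra.
have b2 : `|(h - S) * (h + S) / S ^+ 2| <= e / 2.
  have S2 : 0 < S ^+ 2 by rewrite exprn_even_gt0.
  rewrite normrM normfV (gtr0_norm S2) ler_pdivrMr //.
  rewrite normrM (@ger0_norm _ (h + S)); last by lra.
  have : `|h - S| <= eta * h by rewrite ler_norml; lra.
  have := normr_ge0 (h - S).
  have : 0 <= h + S <= 5 / 2 * h by nra.
  move: (`|h - S|) => q /andP[hS0 hS] q0 q1.
  have a1 : q * (h + S) <= eta * h * (5 / 2 * h) by apply: ler_pM.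
  have a2 : h ^+ 2 <= 4 * S ^+ 2 by nra.
  have a3 : eta * h * (5 / 2 * h) = (5 / 2) * (eta * h ^+ 2) by ring.
  have a4 : eta * h ^+ 2 <= e / 20 * (4 * S ^+ 2) by apply: ler_pM => //; [exact: ltW|exact: sqr_ge0].
  lra.
lra.
Qed.

Lemma wp_line_x (a : C) t : ~ rect_lattice w1 w2 (a + t%:C) ->
  cder (fun x => f (a + x%:C)) t (f' (a + t%:C)).
Proof.
move=> H; have := @wl_der _ _ _ _ _ _ _ W a 1 t; rewrite !mulr1 => /(_ H).
by apply: cder_ext => x; rewrite mulr1.
Qed.

(** Agreement with the reference function starts at the common pole and
    continues along the real axis, up to the first half period of the reference
    function, where its speed vanishes, or the next pole of [f]. *)
Lemma wp_axis x : 0 < x < Num.min (2 * w1) (K / lam) ->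
  f x%:C = g x 0 /\ f' x%:C = g' x 0.
Proof.
pose B := Num.min (2 * w1) (K / lam).
have B0 : 0 < B by rewrite lt_min divr_gt0 // mulr_gt0.
have B1 : B <= 2 * w1 by rewrite ge_min lexx.
have B2 : B <= K / lam by rewrite ge_min lexx orbT.
have B3 : K / lam < 2 * K / lam by rewrite ltr_pM2r ?invr_gt0 //; have := K0; lra.
have sf : cubic_solution (e3 + lam ^+ 2) (e3 + k ^+ 2 * lam ^+ 2) e3 B (fun x => f x%:C) (fun x => f' x%:C).
  move=> t /andP[t0 tB].
  have L : ~ rect_lattice w1 w2 t%:C by apply: off_lattice_Re => //=; lra.
  split; last exact: (wl_ode W).
  have := @wp_line_x 0 t; rewrite add0r => /(_ L).
  by apply: cder_ext => y; rewrite add0r.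
have sg : cubic_solution (e3 + lam ^+ 2) (e3 + k ^+ 2 * lam ^+ 2) e3 B (fun x => g x 0) (fun x => g' x 0).
  move=> t /andP[t0 tB]; have ht : 0 < t < 2 * K / lam by lra.
  by split; [exact: (cder_jwp_x kk' J J' k0 e3 lam0 0 ht)|exact: (jwp_ode kk' J J' k0 e3 lam0 0 ht)].
have pf : double_pole (fun x => f x%:C).
  have lat0 : rect_lattice w1 w2 0 by split; exists 0; rewrite mulr0.
  move=> e /(wl_pole W lat0)[r r0 Hr]; exists r => // y /andP[y0 yr].
  have := Hr y%:C; rewrite add0r; apply; first by rewrite fmorph_eq0 lt0r_neq0.
  by rewrite normc_real gtr0_norm.
have [r /andP[r0 rB] Hr] := pole_unique B0 pf jwp_double_pole sf sg.
move=> /andP[x0 xB]; have [xr|rx] := ltP x r; first by apply: Hr; rewrite x0.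
have hr2 : 0 < r / 2 < r by lra.
have [Ea Ea'] := Hr _ hr2.
have I t : r / 2 <= t < B -> 0 < t < B by lra.
apply: (@ode_unique _ 4 (e3 + lam ^+ 2) (e3 + k ^+ 2 * lam ^+ 2) e3
  (fun x => f x%:C) (fun x => f' x%:C) (fun x => g x 0) (fun x => g' x 0) (r / 2) B).
- move=> t ht; exact: (sf t (I t ht)).1.
- move=> t ht; exact: (sg t (I t ht)).1.
- move=> t ht; exact: (sf t (I t ht)).2.
- move=> t ht; exact: (sg t (I t ht)).2.
- by move=> t ht; apply: (jwp'_neq0 J J' k0 lam0 0); lra.
- exact: Ea.
- exact: Ea'.
- by rewrite xB andbT; lra.
Qed.

(** Otherwise the reference function would be regular at the pole [2 w1]. *)
Lemma axis_bound : K / lam < 2 * w1.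
Proof.
rewrite ltNge; apply/negP => le.
have E : Num.min (2 * w1) (K / lam) = 2 * w1 by apply/min_idPl.
have B3 : K / lam < 2 * K / lam by rewrite ltr_pM2r ?invr_gt0 //; have := K0; lra.
have hw : 0 < 2 * w1 < 2 * K / lam by have := w10; lra.
have Dg := cder_jwp_x kk' J J' k0 e3 lam0 0 hw.
have [r1 r10 H1] := cder_cont Dg ltr01.
have lat : rect_lattice w1 w2 (2 * w1)%:C.
  by split; [exists 1; rewrite mulr1|exists 0; rewrite mulr0].
have [r2 r20 H2] := wl_pole W lat (ltac:(lra) : 0 < (1 / 2 : R)).
pose M := normc (g (2 * w1) 0) + 1.
have M0 : 0 < M by rewrite ltr_wpDl ?normc_ge0.
pose h := Num.min (Num.min (r1 / 2) (r2 / 2)) (Num.min w1 (Num.min 1 (1 / (4 * M)))).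
have h0 : 0 < h.
  by rewrite !lt_min w10 ltr01 !divr_gt0 // mulr_gt0.
have a1 : h <= r1 / 2 by rewrite !ge_min lexx.
have a2 : h <= r2 / 2 by rewrite !ge_min lexx !orbT.
have a3 : h <= w1 by rewrite !ge_min lexx !orbT.
have a4 : h <= 1 by rewrite !ge_min lexx !orbT.
have a5 : h <= 1 / (4 * M) by rewrite !ge_min lexx !orbT.
rewrite ler_pdivlMr ?mulr_gt0 // in a5.
have [Ef _] := @wp_axis (2 * w1 - h) (ltac:(rewrite E; have := w10; lra)).
have := H2 (- h%:C); rewrite oppr_eq0 fmorph_eq0 lt0r_neq0 // normcN normc_real gtr0_norm //.
move=> /(_ isT); have -> : h < r2 by lra.
rewrite -rmorphB /= Ef => /(_ isT) P.
have := H1 (2 * w1 - h); have -> : 2 * w1 - h - 2 * w1 = - h by ring.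
rewrite normrN gtr0_norm //; have -> : h < r1 by lra.
move=> /(_ isT) Q.
have Qn : normc (g (2 * w1 - h) 0) <= M.
  rewrite -(subrK (g (2 * w1) 0) (g (2 * w1 - h) 0)); apply: le_trans (le_normcD _ _) _.
  by rewrite /M; lra.
have : normc ((- h%:C) ^+ 2 * g (2 * w1 - h) 0) <= 1 / 4.
  rewrite sqrrN -rmorphXn normcM normc_real ger0_norm ?sqr_ge0 // expr2.
  have := normc_ge0 (g (2 * w1 - h) 0); nra.
move=> Q2; have := le_normcD ((- h%:C) ^+ 2 * g (2 * w1 - h) 0 - 1) (- ((- h%:C) ^+ 2 * g (2 * w1 - h) 0)).
have -> : (- h%:C) ^+ 2 * g (2 * w1 - h) 0 - 1 + - ((- h%:C) ^+ 2 * g (2 * w1 - h) 0) = - 1 by ring.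
rewrite !normcN normc1; lra.
Qed.

(** On vertical lines off the half periods the speed of the reference function
    never vanishes, so that the agreement extends from the real axis to them. *)
Lemma wp_vertical x y : 0 < x < K / lam -> 0 <= y -> f (x%:C + y%:C * 'i) = g x y.
Proof.
move=> /andP[x0 xK] y0; have AB := axis_bound.
have B3 : K / lam < 2 * K / lam by rewrite ltr_pM2r ?invr_gt0 //; have := K0; lra.
have hx : 0 < x < 2 * K / lam by lra.
have L t : ~ rect_lattice w1 w2 (x%:C + t%:C * 'i).
  by apply: off_lattice_Re => //; rewrite !ReImE /= mulr0 mul0r subr0 addr0; lra.
have [E E'] := @wp_axis x (ltac:(rewrite lt_min; lra)).
refine (proj1 (@ode_unique _ (- 4) (e3 + lam ^+ 2) (e3 + k ^+ 2 * lam ^+ 2) e3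
  (fun t => f (x%:C + t%:C * 'i)) (fun t => f' (x%:C + t%:C * 'i) * 'i)
  (fun t => g x t) (fun t => g' x t * 'i) 0 (y + 1) _ _ _ _ _ _ _ y _)).
- by move=> t _; apply: (wl_der W).
- by move=> t _; exact: (cder_jwp_y kk' J J' k0 e3 lam0 t hx).
- by move=> t _; rewrite exprMn sqr_i (wl_ode W) //; ring.
- by move=> t _; rewrite exprMn sqr_i (jwp_ode kk' J J' k0 e3 lam0 t hx); ring.
- move=> t _; rewrite mulf_neq0 //; last by rewrite -normc_gt0 normc_i.
  by apply: (jwp'_neq0 J J' k0 lam0 t); lra.
- by rewrite mul0r addr0.
- by rewrite mul0r addr0 E'.
- by rewrite y0; lra.
Qed.

(** By the agreement on vertical lines [f] is unbounded near [2 i K' / lam], so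
    that this point belongs to the lattice of poles. *)
Lemma vertical_period : exists n : int, 2 * (K' / lam) = 2 * w2 * n%:~R.
Proof.
have AB := axis_bound.
apply: contrapT => nL.
pose z0 : C := (2 * K' / lam)%:C * 'i.
have L0 : ~ rect_lattice w1 w2 (z0 + 0%:C).
  case=> _ [n]; rewrite !ReImE /= => En; apply: nL; exists n; rewrite -En; ring.
have D := wp_line_x L0.
have [r1 r10 H1] := cder_cont D ltr01.
have [r2 r20 H2] := @jwp_double_pole (1 / 2) (ltac:(lra)).
pose M := normc (f (z0 + 0%:C)) + 1.
have M0 : 0 < M by rewrite ltr_wpDl ?normc_ge0.
pose h := Num.min (Num.min (r1 / 2) (r2 / 2)) (Num.min (K / lam / 2) (Num.min 1 (1 / (4 * M)))).
have h0 : 0 < h.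
  by rewrite !lt_min ltr01 !divr_gt0 // mulr_gt0.
have KL : 0 < K / lam by rewrite divr_gt0.
have a1 : h <= r1 / 2 by rewrite !ge_min lexx.
have a2 : h <= r2 / 2 by rewrite !ge_min lexx !orbT.
have a3 : h <= K / lam / 2 by rewrite !ge_min lexx !orbT.
have a4 : h <= 1 by rewrite !ge_min lexx !orbT.
have a5 : h <= 1 / (4 * M) by rewrite !ge_min lexx !orbT.
rewrite ler_pdivlMr ?mulr_gt0 // in a5.
have Ef : f (z0 + h%:C) = g h 0.
  rewrite addrC wp_vertical ?jwp_axis_period //; last by rewrite !divr_ge0 ?mulr_ge0 ?ltW.
  by lra.
have := H1 h; rewrite subr0 gtr0_norm // Ef; have -> : h < r1 by lra.
move=> /(_ isT) Q.
have := H2 h; rewrite h0; have -> : h < r2 by lra.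
move=> /(_ isT) P.
have Qn : normc (g h 0) <= M.
  rewrite -(subrK (f (z0 + 0%:C)) (g h 0)); apply: le_trans (le_normcD _ _) _.
  by rewrite /M; lra.
have : normc (h%:C ^+ 2 * g h 0) <= 1 / 4.
  rewrite -rmorphXn normcM normc_real ger0_norm ?sqr_ge0 // expr2.
  have := normc_ge0 (g h 0); nra.
move=> Q2; have := le_normcD (h%:C ^+ 2 * g h 0 - 1) (- (h%:C ^+ 2 * g h 0)).
have -> : h%:C ^+ 2 * g h 0 - 1 + - (h%:C ^+ 2 * g h 0) = - 1 by ring.
rewrite !normcN normc1; lra.
Qed.

Lemma wp_half_line x : 0 < x < K / lam ->
  f (x%:C + (K' / lam)%:C * 'i) = (e3 + k ^+ 2 * lam ^+ 2 * s (lam * x) ^+ 2)%:C.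
Proof.
move=> hx; rewrite wp_vertical //; last by rewrite divr_ge0 ?ltW.
have B3 : K / lam < 2 * K / lam by rewrite ltr_pM2r ?invr_gt0 //; have := K0; lra.
by apply: jwp_half; lra.
Qed.

End Compare.
End WpLike.

(** * The Weierstrass function on the row through the imaginary half period *)

Section HalfLine.
Context {R : realType}.
Local Notation C := R[i].
Local Notation Re := (@complex.Re R).
Local Notation Im := (@complex.Im R).

(** The imaginary period of the reference function is a multiple of that of [f];
    the rotated functions give the same for the real period, and
    [axis_bound] excludes proper multiples. *)
Lemma wp_like_half_line (f f' : C -> C) (e3 lam k w1 w2 : R) (s c d : R -> R) (K : R) :
  0 < k < 1 -> 0 < lam -> is_jacobi k s c d K ->
  wp_like f f' (e3 + lam ^+ 2) (e3 + k ^+ 2 * lam ^+ 2) e3 w1 w2 ->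
  K = lam * w1 /\ forall x, 0 < x < w1 ->
    f (x%:C + w2%:C * 'i) = (e3 + k ^+ 2 * lam ^+ 2 * s (lam * x) ^+ 2)%:C.
Proof.
move=> /andP[k0 k1] lam0 J W.
pose k' := Num.sqrt (1 - k ^+ 2).
have k2 : 0 < 1 - k ^+ 2 by nra.
have k'0 : 0 < k' by rewrite sqrtr_gt0.
have k'2 : k' ^+ 2 = 1 - k ^+ 2 by rewrite sqr_sqrtr // ltW.
have k'1 : k' < 1 by nra.
have kk' : k ^+ 2 + k' ^+ 2 = 1 by rewrite k'2; ring.
have k'k : k' ^+ 2 + k ^+ 2 = 1 by rewrite k'2; ring.
have [s' [c' [d' [K' J']]]] : exists s' c' d' K', is_jacobi k' s' c' d' K'.
  by apply: jacobi_exists; rewrite k'0.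
have W' := wp_like_rot W.
have E1 : - e3 = - (e3 + lam ^+ 2) + lam ^+ 2 by ring.
have E2 : - (e3 + k ^+ 2 * lam ^+ 2) = - (e3 + lam ^+ 2) + k' ^+ 2 * lam ^+ 2 by rewrite k'2; ring.
rewrite E1 E2 in W'.
have w10 := wl_w1 W; have w20 := wl_w2 W.
have b1 := axis_bound k0 lam0 kk' J J' W.
have b2 := axis_bound k'0 lam0 k'k J' J W'.
have [n hn] := vertical_period k0 lam0 kk' J J' W.
have [m hm] := vertical_period k'0 lam0 k'k J' J W'.
have one (A w : R) (p : int) : 0 < w -> 0 < A -> A < 2 * w -> 2 * A = 2 * w * p%:~R -> A = w.
  move=> w0 A0 Aw E; have {}E : A = w * p%:~R by lra.
  have p0 : 0 < p by rewrite -(ltr0z R); move: A0; rewrite E pmulr_rgt0.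
  have p2 : p < 2.
    by rewrite -(ltr_int R) -(ltr_pM2l w0) -E mulrC.
  have -> : A = w * 1%:~R by rewrite E; congr (_ * _%:~R); move: p0 p2; case: (p) => [[|[|[|?]]]|].
  by rewrite mulr1.
have KL : K / lam = w1.
  by apply: (one _ _ m) => //; rewrite divr_gt0 // (jacobi_K_gt0 J).
have K'L : K' / lam = w2.
  by apply: (one _ _ n) => //; rewrite divr_gt0 // (jacobi_K_gt0 J').
split; first by rewrite -KL mulrC divfK // lt0r_neq0.
by move=> x; rewrite -KL -K'L => hx; exact: (wp_half_line k0 lam0 kk' J J' W).
Qed.

Lemma periodic_int (T : Type) (F : R -> T) (w : R) : (forall x, F (x + w) = F x) ->
  forall x (m : int), F (x + w * m%:~R) = F x.
Proof.
move=> P; have Pn x (n : nat) : F (x + w * n%:R) = F x.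
  elim: n => [|n IH]; first by rewrite mulr0 addr0.
  by rewrite -natr1 mulrDr mulr1 addrA P.
move=> x [n|n]; first exact: Pn.
rewrite NegzE mulrNz mulrN -[in RHS](subrK (w * n.+1%:R) x).
by rewrite -[LHS](Pn _ n.+1).
Qed.

Lemma reduce_mod (w x : R) : 0 < w -> exists m : int, - w <= x - 2 * w * m%:~R < w.
Proof.
move=> w0; exists (Num.floor ((x + w) / (2 * w))); set m := Num.floor _.
have w2 : 0 < 2 * w by rewrite mulr_gt0.
have /andP[h1 h2] : m%:~R <= (x + w) / (2 * w) < (m + 1)%:~R.
  by rewrite ge_floor floorD1_gt.
rewrite ler_pdivlMr // in h1; rewrite ltr_pdivrMr // rmorphD /= in h2.
by lra.
Qed.

Section Weierstrass.
Variables (g2 g3 : R) (E : weierstrass_data R).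
Hypothesis HE : is_weierstrass g2 g3 E.
Let w1 := omega1 E.
Let w2 := Im (omega2 E).
Let w10 : 0 < w1 := omega1_gt0 HE.
Let w20 : 0 < w2 := Im_omega2_gt0 HE.

Let om2E : omega2 E = w2%:C * 'i.
Proof.
by apply: cplx_eq; rewrite ?(Re_omega2 HE) !ReImE /= ?mulr0 ?mul0r ?mulr1 ?addr0 ?subr0.
Qed.

Lemma period_latticeE z : period_lattice (omega1 E) (omega2 E) z <-> rect_lattice w1 w2 z.
Proof.
have H (m n : int) : (2 * w1)%:C *~ m + (2 * omega2 E) *~ n =
    (2 * w1 * m%:~R) +i* (2 * w2 * n%:~R).
  rewrite om2E -[_ *~ m]mulrzr -[_ *~ n]mulrzr.
  have intC (p : int) : (p%:~R : C) = (p%:~R : R)%:C by rewrite rmorph_int.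
  rewrite !intC.
  have -> : (2 : C) = (2 : R)%:C by rewrite rmorph_nat.
by apply: cplx_eq; rewrite !ReImE /=; ring.
split=> [[m [n ->]]|[[m Em] [n En]]]; first by rewrite H; split; [exists m|exists n].
by exists m, n; rewrite H; apply: cplx_eq.
Qed.

Lemma wp_is_derive z : ~ rect_lattice w1 w2 z -> is_derive (z : C^o) (1 : C^o) (wp E) (derive1 (wp E) z).
Proof.
by move=> L; rewrite derive1E; apply: derivableP; apply: (wp_derivable HE); rewrite period_latticeE.
Qed.

(** The pole at the origin is moved to the other lattice points by
    periodicity. *)
Lemma weierstrass_wp_like (e1 e2 e3 : R) :
  (forall t : R, 4 * t ^+ 3 - g2 * t - g3 = 4 * ((t - e1) * (t - e2) * (t - e3))) ->
  wp_like (wp E) (derive1 (wp E)) e1 e2 e3 w1 w2.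
Proof.
move=> roots; split=> //.
- by move=> a v t L; apply: cder_line; exact: wp_is_derive.
- move=> z L; rewrite (wp_ode HE) ?period_latticeE //.
  have c0 := roots 0; have c1 := roots 1; have c2 := roots (- 1).
  have s1 : e1 + e2 + e3 = 0 by lra.
  have s3 : g3 = 4 * (e1 * e2 * e3) by lra.
  have s2 : g2 = - 4 * (e1 * e2 + e2 * e3 + e1 * e3) by lra.
  have e3E : e3 = - e1 - e2 by lra.
  by rewrite /cubic s3 s2 e3E; ring.
- move=> l Ll e e_gt0.
  have [r r0 Hr] := ccvgP (wp_pole HE) ltr01.
  pose r' := Num.min (Num.min r 1) (Num.min e (Num.min (2 * w1) (2 * w2))).
  exists r'; first by rewrite !lt_min r0 ltr01 e_gt0 !mulr_gt0.
  move=> h h0; rewrite !lt_min => /andP[/andP[hr h1] /andP[he /andP[hw1 hw2]]].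
  have Lh : ~ rect_lattice w1 w2 h.
    case=> -[m Em] [n En].
    have aux (w x : R) (p : int) : 0 < w -> `|x| < 2 * w -> x = 2 * w * p%:~R -> x = 0.
      move=> w0; rewrite ltr_norml => /andP[x1 x2] Ex.
      have [x0|x0|//] := ltgtP x 0; exfalso.
        apply: (@int_mul_itv _ w (- x) (- p)) => //; last by rewrite mulrNz mulrN -Ex.
        by rewrite oppr_gt0 x0 ltrNl.
      by apply: (@int_mul_itv _ w x p) => //; rewrite x0.
    have zr : Re h = 0 by apply: aux w10 _ Em; apply: le_lt_trans (normr_Re _) hw1.
    have zi : Im h = 0 by apply: aux w20 _ En; apply: le_lt_trans (normr_Im _) hw2.
    by move/eqP: h0; apply; apply: cplx_eq.
  have per : wp E (l + h) = wp E h.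
    by rewrite addrC; apply: (wp_periodic HE); rewrite period_latticeE.
  have := Hr h h0 hr; rewrite subr0 per => H.
  have -> : h ^+ 2 * wp E h - 1 = h ^+ 2 * (wp E h - h ^- 2) by field.
  rewrite normcM expr2 normcM; have := normc_ge0 h.
  have := normc_ge0 (wp E h - h ^- 2); nra.
Qed.

Lemma off_lattice_row (x : R) : ~ rect_lattice w1 w2 (x%:C + w2%:C * 'i).
Proof.
case=> _ [n]; rewrite !ReImE /= => En.
have {}En : w2 = 2 * w2 * n%:~R by rewrite -En; ring.
by case: (int_mul_itv w20 _ En); have := w20; lra.
Qed.

Lemma cder_limit (F G : R -> C) t a b r : 0 < r -> cder F t a -> cder G t b ->
  (forall x, 0 < x - t < r -> F x = G x) -> F t = G t.
Proof.
move=> r0 HF HG FG; apply/eqP; rewrite -subr_eq0; apply/eqP/normc_eq0P.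
apply/ler_addgt0Pl => e e0; rewrite addr0.
have [r1 r10 Hr] := cder_cont (cderB HF HG) e0.
pose h := Num.min (r / 2) (r1 / 2).
have h0 : 0 < h by rewrite lt_min; lra.
have h1 : h <= r / 2 by rewrite ge_min lexx.
have h2 : h <= r1 / 2 by rewrite ge_min lexx orbT.
have := Hr (t + h); have -> : t + h - t = h by ring.
rewrite gtr0_norm // FG; last by lra.
by rewrite subrr sub0r normcN => H; apply/ltW/H; lra.
Qed.

(** The comparison covers half of a period; the function [wp E (- z)] satisfies
    the same hypotheses and covers the other half. The end points follow by
    continuity, the whole line by periodicity. *)
Lemma wp_row (e3 lam k : R) (s c d : R -> R) (K : R) :
  0 < k < 1 -> 0 < lam -> is_jacobi k s c d K ->
  (forall t : R, 4 * t ^+ 3 - g2 * t - g3 =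
     4 * ((t - (e3 + lam ^+ 2)) * (t - (e3 + k ^+ 2 * lam ^+ 2)) * (t - e3))) ->
  K = lam * w1 /\ forall x : R, wp E (omega2 E + x%:C) =
    (e3 + k ^+ 2 * lam ^+ 2 * s (lam * x) ^+ 2)%:C.
Proof.
move=> k01 lam0 J roots.
have W := weierstrass_wp_like roots.
have [KE H] := wp_like_half_line k01 lam0 J W.
have [_ H'] := wp_like_half_line k01 lam0 J (wp_like_opp W).
split=> //.
pose G x := (e3 + k ^+ 2 * lam ^+ 2 * s (lam * x) ^+ 2)%:C : C.
pose F x := wp E (x%:C + w2%:C * 'i).
have GD x : exists b, cder G x b.
  have := jacobi_ds J (lam * x) => D.
  eexists; apply: cder_real; der with (notypeclasses refine (der_comp (f := s) _ D)); reflexivity.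
have FD x : exists a, cder F x a.
  eexists; have L := off_lattice_row (x := x).
  have := @cder_line _ (wp E) (w2%:C * 'i) 1 x; rewrite mulr1 addrC => /(_ _ (wp_is_derive L)) D.
  by apply: cder_ext D => y; rewrite mulr1 addrC.
have GP x : G (x + 2 * w1) = G x.
  have E2 : lam * (x + 2 * w1) = lam * x + 2 * K by rewrite KE; ring.
  by rewrite /G E2 (jacobi_sD J) sqrrN.
have FP x : F (x + 2 * w1) = F x.
  have -> : F (x + 2 * w1) = wp E ((x%:C + w2%:C * 'i) + (2 * w1)%:C).
    by rewrite /F rmorphD /=; congr wp; ring.
  apply: (wp_periodic HE); rewrite period_latticeE; first exact: off_lattice_row.
  by split; [exists 1; rewrite mulr1|exists 0; rewrite mulr0].
have GN x : G (- x) = G x by rewrite /G mulrN (jacobi_sN J) sqrrN.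
have FN x : 0 < x < w1 -> F (- x) = G x.
  move=> hx; rewrite /G -(H' x hx).
  have -> : F (- x) = wp E (- (x%:C + w2%:C * 'i) + (0 +i* (2 * w2))).
    by rewrite /F rmorphN; congr wp; apply: cplx_eq; rewrite !ReImE /=; ring.
  apply: (wp_periodic HE); rewrite period_latticeE; last first.
    by split; [exists 0; rewrite mulr0|exists 1; rewrite mulr1].
  case=> _ [n]; rewrite !ReImE /= => En.
  have {}En : w2 = 2 * w2 * (- n)%:~R by rewrite mulrNz mulrN -En; ring.
  by case: (int_mul_itv w20 _ En); have := w20; lra.
have FG0 : F 0 = G 0.
  have [a Ha] := FD 0; have [b Hb] := GD 0; apply: (cder_limit w10 Ha Hb).
  by move=> x; rewrite subr0; exact: H.
have FGm : F (- w1) = G (- w1).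
  have [a Ha] := FD (- w1); have [b Hb] := GD (- w1); apply: (cder_limit w10 Ha Hb).
  by move=> x hx; rewrite -(opprK x) FN ?GN //; have := w10; lra.
have base x : - w1 <= x < w1 -> F x = G x.
  move=> /andP[]; rewrite le_eqVlt => /predU1P[<- //|x1 x2].
  have [x0|x0|->//] := ltgtP x 0; last by apply: H; rewrite x0.
  by rewrite -(opprK x) FN ?GN //; lra.
move=> x; rewrite om2E addrC -/(F x) -/(G x).
have [m /base] := reduce_mod x w10.
by rewrite -mulrN -mulrNz (periodic_int FP) (periodic_int GP).
Qed.
End Weierstrass.
End HalfLine.

(** * The zeta function on that row *)

Section Zeta.
Context {R : realType}.
Local Notation C := R[i].
Local Notation Re := (@complex.Re R).
Local Notation Im := (@complex.Im R).
Variables (g2 g3 : R) (E : weierstrass_data R).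
Hypothesis HE : is_weierstrass g2 g3 E.
Let w1 := omega1 E.
Let w2 := Im (omega2 E).
Let w10 : 0 < w1 := omega1_gt0 HE.
Let w20 : 0 < w2 := Im_omega2_gt0 HE.

Let om2E : omega2 E = w2%:C * 'i.
Proof.
by apply: cplx_eq; rewrite ?(Re_omega2 HE) !ReImE /= ?mulr0 ?mul0r ?mulr1 ?addr0 ?subr0.
Qed.

Lemma cder_zeta (a v : C) (t : R) : ~ rect_lattice w1 w2 (a + t%:C * v) ->
  cder (fun x => wzeta E (a + x%:C * v)) t (- wp E (a + t%:C * v) * v).
Proof.
move=> L; apply: cder_line; apply: (wzeta_derive HE).
by rewrite (period_latticeE HE).
Qed.

Lemma cder0_cst (F : R -> C) (b : R) : 0 <= b ->
  (forall t, 0 <= t <= b -> cder F t 0) -> F 0 = F b.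
Proof.
move=> b0 H; apply: cplx_eq.
- by apply: (der0_cst (f := fun x => Re (F x)) b0) => x /H[].
- by apply: (der0_cst (f := fun x => Im (F x)) b0) => x /H[].
Qed.

(** The derivative of the difference along the line is a difference of two
    equal values of wp. *)
Lemma quasi_period (l a v : C) (b : R) : 0 <= b -> rect_lattice w1 w2 l ->
  (forall t : R, ~ rect_lattice w1 w2 (a + t%:C * v)) ->
  (forall t : R, ~ rect_lattice w1 w2 (a + l + t%:C * v)) ->
  wzeta E (a + l) - wzeta E a = wzeta E (a + l + b%:C * v) - wzeta E (a + b%:C * v).
Proof.
move=> b0 Ll L1 L2.
have := @cder0_cst (fun t => wzeta E (a + l + t%:C * v) - wzeta E (a + t%:C * v)) b b0.
rewrite mul0r !addr0; apply=> t _.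
apply: cder_eq (cderB (cder_zeta (L2 t)) (cder_zeta (L1 t))) _.
have -> : wp E (a + l + t%:C * v) = wp E (a + t%:C * v).
  have -> : a + l + t%:C * v = a + t%:C * v + l by ring.
  by apply: (wp_periodic HE); rewrite (period_latticeE HE).
by rewrite subrr.
Qed.

Lemma not_even_multiple (w : R) (p : int) : w != 0 -> w = 2 * w * p%:~R -> False.
Proof.
move=> w0 H; have {}H : (1 : R) = (2 * p)%:~R.
  by apply: (mulfI w0); rewrite mulr1 {1}H rmorphM /=; ring.
have : (1 : int) = 2 * p by apply/eqP; rewrite -(eqr_int R) -H.
by move/(congr1 (odd \o absz)); rewrite /= abszM oddM.
Qed.

Lemma off_lattice_oddRe (n : int) (z : C) : Re z = w1 * (2 * n + 1)%:~R -> ~ rect_lattice w1 w2 z.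
Proof.
move=> Ez [[m Em] _]; apply: (@not_even_multiple w1 (m - n)); first exact: lt0r_neq0.
by rewrite rmorphB /= mulrBr -Em Ez rmorphD rmorphM /=; ring.
Qed.

Lemma off_lattice_oddIm (n : int) (z : C) : Im z = w2 * (2 * n + 1)%:~R -> ~ rect_lattice w1 w2 z.
Proof.
move=> Ez [_ [m Em]]; apply: (@not_even_multiple w2 (m - n)); first exact: lt0r_neq0.
by rewrite rmorphB /= mulrBr -Em Ez rmorphD rmorphM /=; ring.
Qed.

(** By oddness the increments of zeta from [- w1] to [w1] and from [- omega2] to
    [omega2] are twice its values there. Transported to parallel sides of the
    rectangle with these midpoints, they become the difference and the sum of
    the values at [omega2 + w1] and [omega2 - w1]. *)
Lemma zeta_half_periods :
  wzeta E (omega2 E + w1%:C) = wzeta E w1%:C + wzeta E (omega2 E).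
Proof.
have lat1 : rect_lattice w1 w2 (2 * w1)%:C.
  by split; [exists 1; rewrite mulr1|exists 0; rewrite mulr0].
have lat2 : rect_lattice w1 w2 ((2 * w2)%:C * 'i).
  split; [exists 0|exists 1]; rewrite !ReImE /=; ring.
have H1 := @quasi_period _ (- w1%:C) 'i w2 (ltW w20) lat1.
have H2 := @quasi_period _ (- omega2 E) 1 w1 (ltW w10) lat2.
have A1 : - w1%:C + (2 * w1)%:C = w1%:C by apply: cplx_eq; rewrite !ReImE /=; ring.
have A2 : - omega2 E + (2 * w2)%:C * 'i = omega2 E.
  by rewrite om2E; apply: cplx_eq; rewrite !ReImE /=; ring.
rewrite A1 -om2E in H1; rewrite A2 !mulr1 in H2.
have O1 : wzeta E (- w1%:C) = - wzeta E w1%:C.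
  apply: (wzeta_odd HE); rewrite (period_latticeE HE).
  by apply: (@off_lattice_oddRe 0); rewrite /=; ring.
have O2 : wzeta E (- omega2 E) = - wzeta E (omega2 E).
  apply: (wzeta_odd HE); rewrite (period_latticeE HE).
  by apply: (@off_lattice_oddIm 0); rewrite om2E !ReImE /=; ring.
have O3 : wzeta E (- omega2 E + w1%:C) = - wzeta E (- w1%:C + omega2 E).
  have -> : - omega2 E + w1%:C = - (- w1%:C + omega2 E) by ring.
  apply: (wzeta_odd HE); rewrite (period_latticeE HE).
  by apply: (@off_lattice_oddIm 0); rewrite om2E !ReImE /=; ring.
have {}H1 : 2 * wzeta E w1%:C = wzeta E (omega2 E + w1%:C) - wzeta E (- w1%:C + omega2 E).
  rewrite (addrC (omega2 E)) -H1 ?O1; first by ring.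
  - by move=> t; apply: (@off_lattice_oddRe (-1)); rewrite !ReImE /=; ring.
  - by move=> t; apply: (@off_lattice_oddRe 0); rewrite !ReImE /=; ring.
have {}H2 : 2 * wzeta E (omega2 E) = wzeta E (omega2 E + w1%:C) + wzeta E (- w1%:C + omega2 E).
  rewrite -[X in _ + X]opprK -O3 -H2 ?O2; first by ring.
  - by move=> t; apply: (@off_lattice_oddIm (-1)); rewrite om2E !ReImE /=; ring.
  - by move=> t; apply: (@off_lattice_oddIm 0); rewrite om2E !ReImE /=; ring.
have two : (2 : C) != 0 by rewrite pnatr_eq0.
by apply: (mulfI two); rewrite mulrDr H1 H2; ring.
Qed.

(** The last component expresses the real quasi-period, a value of zeta off
    the row, through the primitive on the row. *)
Lemma zeta_row (U : R -> R) :
  (forall x : R, wp E (omega2 E + x%:C) = (U x)%:C) ->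
  exists Z : R -> R, [/\ Z 0 = 0, forall x, is_derive x (1 : R) Z (- U x),
    forall x, wzeta E (omega2 E + x%:C) = wzeta E (omega2 E) + (Z x)%:C &
    wzeta E w1%:C = (Z w1)%:C].
Proof.
move=> HU; pose F (x : R) := wzeta E (omega2 E + x%:C) - wzeta E (omega2 E).
have D x : cder F x (- U x)%:C.
  have L : ~ rect_lattice w1 w2 (omega2 E + x%:C * 1).
    by rewrite mulr1 om2E addrC; exact: (off_lattice_row HE).
  apply: cder_eq (cder_ext _ (cderB (cder_zeta L) (cder_cst x (wzeta E (omega2 E))))) _.
    by move=> y; rewrite /F mulr1.
  by rewrite !mulr1 subr0 HU rmorphN.
have Im0 x : Im (F x) = 0.
  rewrite -(is_derive_0_is_cst 0 x (fun x => (D x).2)).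
  by rewrite /F addr0 subrr.
have FE x : F x = (Re (F x))%:C by apply: cplx_eq; rewrite ?Im0.
exists (fun x => Re (F x)); split.
- by rewrite /F addr0 subrr.
- by move=> x; exact: (D x).1.
- by move=> x; rewrite -FE /F; ring.
- by rewrite -FE /F zeta_half_periods; ring.
Qed.
End Zeta.

(** * The cyclic Lotka-Volterra system *)

Section Volterra.
Context {R : realType}.
Implicit Types (x z : R).

Record lv_solution (y1 y2 y3 : R -> R) : Prop := {
  lv_d1 : forall x, is_derive x (1 : R) y1 (y1 x * (y2 x - y3 x));
  lv_d2 : forall x, is_derive x (1 : R) y2 (y2 x * (y3 x - y1 x));
  lv_d3 : forall x, is_derive x (1 : R) y3 (y3 x * (y1 x - y2 x));
  lv_r1 : forall x, 0 < y1 x < 1;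
  lv_r2 : forall x, 0 < y2 x < 1;
  lv_r3 : forall x, 0 < y3 x < 1 }.

Lemma lv_rot y1 y2 y3 : lv_solution y1 y2 y3 -> lv_solution y2 y3 y1.
Proof. by case=> *; split. Qed.

Lemma lv_shift y1 y2 y3 (t : R) : lv_solution y1 y2 y3 ->
  lv_solution (fun x => y1 (x + t)) (fun x => y2 (x + t)) (fun x => y3 (x + t)).
Proof.
case=> d1 d2 d3 r1 r2 r3; split=> // x.
- by notypeclasses refine (der_eq (der_comp (derD (der_id x) (der_cst x t)) (d1 _)) _); ring.
- by notypeclasses refine (der_eq (der_comp (derD (der_id x) (der_cst x t)) (d2 _)) _); ring.
- by notypeclasses refine (der_eq (der_comp (derD (der_id x) (der_cst x t)) (d3 _)) _); ring.
Qed.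

(* The vector field has bounded differential on the unit cube; the left-hand side
   is the derivative of the squared distance of two solutions. *)
Lemma lv_linear_bound (a1 a2 a3 b1 b2 b3 u v w : R) :
  0 < a1 < 1 -> 0 < a2 < 1 -> 0 < a3 < 1 -> 0 < b1 < 1 -> 0 < b2 < 1 -> 0 < b3 < 1 ->
  `|2 * u * (u * (a2 - a3) + b1 * (v - w)) + 2 * v * (v * (a3 - a1) + b2 * (w - u))
    + 2 * w * (w * (a1 - a2) + b3 * (u - v))| <= 12 * (u ^+ 2 + v ^+ 2 + w ^+ 2).
Proof.
move=> ha1 ha2 ha3 hb1 hb2 hb3.
have term p q r s t' : 0 < p < 1 -> 0 < q < 1 -> 0 < r < 1 ->
    `|2 * s * (s * (q - r) + p * t')| <= 2 * s ^+ 2 + s ^+ 2 + t' ^+ 2 :> R.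
  move=> /andP[p0 p1] /andP[q0 q1] /andP[r0 r1'].
  rewrite ler_norml; have := sqr_ge0 s; have := sqr_ge0 t'.
  have := sqr_ge0 (s + p * t'); have := sqr_ge0 (s - p * t').
  have : p ^+ 2 * t' ^+ 2 <= t' ^+ 2.
    by rewrite ler_piMl ?sqr_ge0 // expr_le1 // ltW.
  by move=> *; apply/andP; split; nra.
have T1 := term _ _ _ u (v - w) hb1 ha2 ha3.
have T2 := term _ _ _ v (w - u) hb2 ha3 ha1.
have T3 := term _ _ _ w (u - v) hb3 ha1 ha2.
apply: le_trans (ler_normD _ _) _.
have := ler_normD (2 * u * (u * (a2 - a3) + b1 * (v - w))) (2 * v * (v * (a3 - a1) + b2 * (w - u))).
have := sqr_ge0 (u + v + w); have := sqr_ge0 u; have := sqr_ge0 v; have := sqr_ge0 w.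
nra.
Qed.

Lemma lv_compare (y1 y2 y3 z1 z2 z3 : R -> R) : lv_solution y1 y2 y3 -> lv_solution z1 z2 z3 ->
  forall X x, `|x| <= X ->
  (y1 x - z1 x) ^+ 2 + (y2 x - z2 x) ^+ 2 + (y3 x - z3 x) ^+ 2 <=
  ((y1 0 - z1 0) ^+ 2 + (y2 0 - z2 0) ^+ 2 + (y3 0 - z3 0) ^+ 2) * expR (12 * X).
Proof.
case=> d1 d2 d3 r1 r2 r3 [e1 e2 e3 r4 r5 r6] X x xX.
pose N t := (y1 t - z1 t) ^+ 2 + (y2 t - z2 t) ^+ 2 + (y3 t - z3 t) ^+ 2.
pose N' t := 2 * (y1 t - z1 t) * (y1 t * (y2 t - y3 t) - z1 t * (z2 t - z3 t))
  + 2 * (y2 t - z2 t) * (y2 t * (y3 t - y1 t) - z2 t * (z3 t - z1 t))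
  + 2 * (y3 t - z3 t) * (y3 t * (y1 t - y2 t) - z3 t * (z1 t - z2 t)).
apply: (@gronwall_abs _ N N' 12 X) => // t _.
  have := d1 t; have := d2 t; have := d3 t; have := e1 t; have := e2 t; have := e3 t => *.
  by rewrite /N; der; rewrite /N' /=; ring.
have := lv_linear_bound (y1 t - z1 t) (y2 t - z2 t) (y3 t - z3 t) (r1 t) (r2 t) (r3 t) (r4 t) (r5 t) (r6 t).
by congr (`| _ | <= _); rewrite /N'; ring.
Qed.

(** Second order comparison: [D] is a solution of the linearised system along
    [z], and the vector field is quadratic, so the error of the first order
    expansion is quadratic in the difference of the initial values. *)
Lemma lv_compare2 (y1 y2 y3 z1 z2 z3 D1 D2 D3 : R -> R) (dl : R) :
  lv_solution y1 y2 y3 -> lv_solution z1 z2 z3 ->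
  (forall x, is_derive x (1 : R) D1 (D1 x * (z2 x - z3 x) + z1 x * (D2 x - D3 x))) ->
  (forall x, is_derive x (1 : R) D2 (D2 x * (z3 x - z1 x) + z2 x * (D3 x - D1 x))) ->
  (forall x, is_derive x (1 : R) D3 (D3 x * (z1 x - z2 x) + z3 x * (D1 x - D2 x))) ->
  forall X x, `|x| <= X ->
  (y1 x - z1 x - dl * D1 x) ^+ 2 + (y2 x - z2 x - dl * D2 x) ^+ 2 + (y3 x - z3 x - dl * D3 x) ^+ 2 <=
  ((y1 0 - z1 0 - dl * D1 0) ^+ 2 + (y2 0 - z2 0 - dl * D2 0) ^+ 2 + (y3 0 - z3 0 - dl * D3 0) ^+ 2
   + 2 * (((y1 0 - z1 0) ^+ 2 + (y2 0 - z2 0) ^+ 2 + (y3 0 - z3 0) ^+ 2) * expR (12 * X)) ^+ 2) * expR (13 * X).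
Proof.
move=> Hy Hz dD1 dD2 dD3 X x xX.
have cmp := lv_compare Hy Hz.
case: Hy => d1 d2 d3 r1 r2 r3; case: Hz => e1 e2 e3 r4 r5 r6.
set N0 := _ * expR (12 * X).
pose E1 t := y1 t - z1 t - dl * D1 t; pose E2 t := y2 t - z2 t - dl * D2 t.
pose E3 t := y3 t - z3 t - dl * D3 t.
pose h1 t := y1 t - z1 t; pose h2 t := y2 t - z2 t; pose h3 t := y3 t - z3 t.
pose M t := E1 t ^+ 2 + E2 t ^+ 2 + E3 t ^+ 2 + 2 * N0 ^+ 2.
pose L t := 2 * E1 t * (E1 t * (z2 t - z3 t) + z1 t * (E2 t - E3 t))
  + 2 * E2 t * (E2 t * (z3 t - z1 t) + z2 t * (E3 t - E1 t))
  + 2 * E3 t * (E3 t * (z1 t - z2 t) + z3 t * (E1 t - E2 t)).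
pose Q t := 2 * E1 t * (h1 t * (h2 t - h3 t)) + 2 * E2 t * (h2 t * (h3 t - h1 t))
  + 2 * E3 t * (h3 t * (h1 t - h2 t)).
suff : M x <= M 0 * expR (13 * X).
  by apply: le_trans; rewrite /M lerDl mulr_ge0 ?sqr_ge0.
apply: (@gronwall_abs _ M (fun t => L t + Q t) 13 X) => // t tX.
  have := d1 t; have := d2 t; have := d3 t; have := e1 t; have := e2 t; have := e3 t.
  have := dD1 t; have := dD2 t; have := dD3 t => *.
  by rewrite /M /E1 /E2 /E3; der; rewrite /L /Q /E1 /E2 /E3 /h1 /h2 /h3 /=; ring.
have B1 : `|L t| <= 12 * (E1 t ^+ 2 + E2 t ^+ 2 + E3 t ^+ 2) by apply: lv_linear_bound.
have Nt : h1 t ^+ 2 + h2 t ^+ 2 + h3 t ^+ 2 <= N0 by exact: cmp.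
have B2 : `|Q t| <= E1 t ^+ 2 + E2 t ^+ 2 + E3 t ^+ 2 + 2 * N0 ^+ 2.
  have N2 : (h1 t ^+ 2 + h2 t ^+ 2 + h3 t ^+ 2) ^+ 2 <= N0 ^+ 2.
    by rewrite ler_sqr ?nnegrE // ?addr_ge0 ?sqr_ge0 // (le_trans _ Nt) // ?addr_ge0 ?sqr_ge0.
  have P1 : (h1 t * (h2 t - h3 t)) ^+ 2 + (h2 t * (h3 t - h1 t)) ^+ 2 + (h3 t * (h1 t - h2 t)) ^+ 2
      <= 2 * N0 ^+ 2.
    apply: le_trans (_ : 2 * (h1 t ^+ 2 + h2 t ^+ 2 + h3 t ^+ 2) ^+ 2 <= _); last by rewrite ler_pM2l.
    rewrite -subr_ge0.
    rewrite (_ : _ - _ = 2 * ((h1 t ^+ 2) ^+ 2 + (h2 t ^+ 2) ^+ 2 + (h3 t ^+ 2) ^+ 2)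
      + 2 * ((h1 t * h2 t) ^+ 2 + (h2 t * h3 t) ^+ 2 + (h1 t * h3 t) ^+ 2)
      + 2 * (h1 t * h2 t * h1 t * h3 t + h1 t * h2 t * h2 t * h3 t + h1 t * h3 t * h2 t * h3 t)); last by ring.
    have := sqr_ge0 (h1 t * h2 t + h2 t * h3 t + h1 t * h3 t).
    have := sqr_ge0 (h1 t ^+ 2); have := sqr_ge0 (h2 t ^+ 2); have := sqr_ge0 (h3 t ^+ 2).
    have := sqr_ge0 (h1 t * h2 t); have := sqr_ge0 (h2 t * h3 t); have := sqr_ge0 (h1 t * h3 t).
    nra.
  have ab (p q : R) : `|2 * p * q| <= p ^+ 2 + q ^+ 2.
    rewrite ler_norml; have := sqr_ge0 (p + q); have := sqr_ge0 (p - q).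
    by move=> *; apply/andP; split; nra.
  apply: le_trans (ler_normD _ _) _.
  have := ler_normD (2 * E1 t * (h1 t * (h2 t - h3 t))) (2 * E2 t * (h2 t * (h3 t - h1 t))).
  have := ab (E1 t) (h1 t * (h2 t - h3 t)); have := ab (E2 t) (h2 t * (h3 t - h1 t)).
  have := ab (E3 t) (h3 t * (h1 t - h2 t)).
  lra.
have := sqr_ge0 N0 => N00.
by apply: le_trans (ler_normD _ _) _; rewrite /M; lra.
Qed.

Lemma lv_unique (y1 y2 y3 z1 z2 z3 : R -> R) : lv_solution y1 y2 y3 -> lv_solution z1 z2 z3 ->
  y1 0 = z1 0 -> y2 0 = z2 0 -> y3 0 = z3 0 ->
  forall x, [/\ y1 x = z1 x, y2 x = z2 x & y3 x = z3 x].
Proof.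
move=> Hy Hz E1 E2 E3 x; have := lv_compare Hy Hz (lexx `|x|).
rewrite E1 E2 E3 !subrr expr0n /= !addr0 mul0r => H.
have := sqr_ge0 (y1 x - z1 x); have := sqr_ge0 (y2 x - z2 x); have := sqr_ge0 (y3 x - z3 x) => h3 h2 h1.
by split; apply/eqP; rewrite -subr_eq0 -sqrf_eq0; apply/eqP; lra.
Qed.

(** A periodic trajectory of half period [om] on the level [y1 y2 y3 = c],
    started at its symmetric point where [y3] is minimal. *)
Record lv_orbit (c om : R) (y1 y2 y3 : R -> R) : Prop := {
  lvo_sol : lv_solution y1 y2 y3;
  lvo_om : 0 < om;
  lvo_sum : forall x, y1 x + y2 x + y3 x = 1;
  lvo_prod : forall x, y1 x * y2 x * y3 x = c;
  lvo_even1 : forall x, y1 (- x) = y2 x;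
  lvo_even3 : forall x, y3 (- x) = y3 x;
  lvo_per1 : forall x, y1 (x + 2 * om) = y1 x;
  lvo_per2 : forall x, y2 (x + 2 * om) = y2 x;
  lvo_per3 : forall x, y3 (x + 2 * om) = y3 x;
  lvo_gap : forall x, 0 < x < om -> y2 x < y1 x;
  lvo_min : y3 0 < 1 / 3;
  lvo_max : y1 0 < y3 om }.

Section Orbit.
Variables (c om : R) (y1 y2 y3 : R -> R).
Hypothesis O : lv_orbit c om y1 y2 y3.
Let S := lvo_sol O.
Let om0 := lvo_om O.

Lemma lvo_even2 x : y2 (- x) = y1 x.
Proof. by rewrite -(lvo_even1 O) opprK. Qed.

Lemma lvo_sym0 : y1 0 = y2 0.
Proof. by rewrite -(lvo_even1 O) oppr0. Qed.

Lemma lvo_symom : y1 om = y2 om.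
Proof.
rewrite -(lvo_even1 O) -(lvo_per1 O (- om)); congr y1; ring.
Qed.

Lemma lvo_gap2 x : om < x < 2 * om -> y1 x < y2 x.
Proof.
move=> hx; have E1 : y1 x = y2 (2 * om - x).
  by rewrite -(lvo_even1 O) -(lvo_per1 O (- _)); congr y1; ring.
have E2 : y2 x = y1 (2 * om - x).
  by rewrite -lvo_even2 -(lvo_per2 O (- _)); congr y2; ring.
by rewrite E1 E2; apply: (lvo_gap O); lra.
Qed.

Lemma lvo_y3_lt x z : 0 <= x -> x < z -> z <= om -> y3 x < y3 z.
Proof.
move=> x0 xz zo; apply: (der_gt0_lt xz (d := fun x => y3 x * (y1 x - y2 x))).
  by move=> t _; exact: (lv_d3 S).
move=> t ht; have /andP[r0 _] := lv_r3 S t.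
by rewrite mulr_gt0 // subr_gt0; apply: (lvo_gap O); lra.
Qed.

(** The system is invariant under the cyclic rotation of the components. At the
    time [tau] at which [y3] takes the value [y1 0], the invariants force the
    orbit into the rotated initial position, so that translation by [tau] is
    rotation; then [3 tau] is a period, and it is the first one because the
    components 1 and 2 agree only at multiples of [om]. *)
Lemma lvo_shift : forall x, [/\ y1 (x + 2 * om / 3) = y2 x,
  y2 (x + 2 * om / 3) = y3 x & y3 (x + 2 * om / 3) = y1 x].
Proof.
have m := lvo_min O; have M := lvo_max O; have om1 := om0.
have E0 := lvo_sum O 0; have s0 := lvo_sym0; rewrite -s0 in E0.
have [tau /andP[t0 t1] Et] : exists2 t, 0 <= t <= om & y3 t = y1 0.
  apply: der_IVT; first exact: ltW.
    by move=> t _; exact: der_cont (lv_d3 S t).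
  by rewrite (ltW M) andbT; lra.
have t0' : 0 < tau.
  by rewrite lt_neqAle t0 andbT; apply/eqP => E; move: Et; rewrite -E; lra.
have t1' : tau < om.
  by rewrite lt_neqAle t1 andbT; apply/eqP => E; move: Et; rewrite E; lra.
have g := lvo_gap O (ltac:(lra) : 0 < tau < om).
have Es := lvo_sum O tau; have Ep := lvo_prod O tau; have Ep0 := lvo_prod O 0.
have /andP[a0 _] := lv_r1 S 0.
have P0 : (y1 tau - y1 0) * (y1 tau - (1 - 2 * y1 0)) = 0.
  have N : y1 0 != 0 by apply: lt0r_neq0.
  apply: (mulIf N); rewrite mul0r.
  have -> : y1 tau = 1 - y1 0 - y2 tau by rewrite -Et; lra.
  have E3 : y3 0 = 1 - 2 * y1 0 by lra.
  rewrite -s0 E3 in Ep0; rewrite Et in Ep.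
  have E4 : y1 tau = 1 - y1 0 - y2 tau by rewrite -Et; lra.
  by rewrite E4 in Ep; nra.
have Ey1 : y1 tau = y1 0.
  move/eqP: P0; rewrite mulf_eq0 => /orP[/eqP|/eqP] h; first by lra.
  by exfalso; lra.
have Ey2 : y2 tau = y3 0 by lra.
have U := lv_unique (lv_shift tau S) (lv_rot S).
have {}U x : [/\ y1 (x + tau) = y2 x, y2 (x + tau) = y3 x & y3 (x + tau) = y1 x].
  by apply: U; rewrite ?add0r ?Ey1 ?Ey2 ?Et.
suff -> : 2 * om / 3 = tau by [].
have P3 x : y1 (x + 3 * tau) = y1 x /\ y3 (x + 3 * tau) = y3 x.
  have -> : x + 3 * tau = x + tau + tau + tau by ring.
  have [-> _ ->] := U (x + tau + tau); have [-> -> _] := U (x + tau).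
  by have [_ -> ->] := U x.
have [p1 p3] := P3 0; rewrite add0r in p1 p3.
have p2 : y2 (3 * tau) = y1 0.
  by have := lvo_sum O (3 * tau); rewrite p1 p3; lra.
have [h|h|h] := ltgtP (3 * tau) (2 * om); last by lra.
- exfalso; have [h'|h'|h'] := ltgtP (3 * tau) om.
  + by have := lvo_gap O (ltac:(lra) : 0 < 3 * tau < om); rewrite p1 p2 ltxx.
  + by have := lvo_gap2 (ltac:(lra) : om < 3 * tau < 2 * om); rewrite p1 p2 ltxx.
  + by move: p3; rewrite h'; lra.
- exfalso; have := lvo_gap O (ltac:(lra) : 0 < 3 * tau - 2 * om < om).
  by rewrite -(lvo_per1 O) -(lvo_per2 O) subrK p1 p2 ltxx.
Qed.

(** On each half of the period [y3] is strictly monotone, and the sign of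
    [y1 - y2] tells the halves apart. *)
Lemma lvo_inj x z : - om <= x < om -> - om <= z < om -> y1 x = y1 z -> y2 x = y2 z -> y3 x = y3 z -> x = z.
Proof.
move=> hx hz E1 E2 E3; have om1 := om0.
have gapN t : - om < t < 0 -> y1 t < y2 t.
  move=> ht; have := @lvo_gap _ _ _ _ _ O (- t).
  by rewrite (lvo_even1 O) lvo_even2; apply; lra.
have inj t u : 0 <= t -> t <= om -> 0 <= u -> u <= om -> y3 t = y3 u -> t = u.
  move=> t1 t2 u1 u2 E; have [h|h|//] := ltgtP t u.
    by have := lvo_y3_lt t1 h u2; rewrite E ltxx.
  by have := lvo_y3_lt u1 h t2; rewrite E ltxx.
have symom : y1 (- om) = y2 (- om) by rewrite (lvo_even1 O) lvo_even2 lvo_symom.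
have sgn t : - om <= t < om -> (t < 0 -> t = - om \/ y1 t < y2 t) /\ (0 <= t -> y2 t <= y1 t).
  move=> ht; split=> t0.
    have [->|tn] := eqVneq t (- om); [by left|right; apply: gapN].
    by rewrite t0 andbT lt_def tn; case/andP: ht.
  have [->|tn] := eqVneq t 0; first by rewrite lvo_sym0.
  by apply/ltW/(lvo_gap O); rewrite lt_def tn t0; case/andP: ht.
have [x0|x0] := ltP x 0; have [z0|z0] := ltP z 0.
- have : - x = - z by apply: inj; rewrite ?(lvo_even3 O) //; lra.
  by move/oppr_inj.
- exfalso; have [h _] := sgn x hx; have [_ h'] := sgn z hz.
  have Ex : - x = z by apply: inj; rewrite ?(lvo_even3 O) //; lra.
  case: (h x0) => [E|]; first by lra.
  by rewrite E1 E2; have := h' z0; lra.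
- exfalso; have [h _] := sgn z hz; have [_ h'] := sgn x hx.
  have Ex : - z = x by apply: inj; rewrite ?(lvo_even3 O) //; lra.
  case: (h z0) => [E|]; first by lra.
  by rewrite -E1 -E2; have := h' x0; lra.
- by apply: inj => //; lra.
Qed.

(** On the level curve [y3] lies between its values at the two symmetric points,
    where [y1 = y2], and determines the other two components up to their order;
    the reflection of the time exchanges them. *)
Lemma lvo_surj a1 a2 a3 : 0 < a1 -> 0 < a2 -> 0 < a3 -> a1 + a2 + a3 = 1 ->
  a1 * a2 * a3 = c -> exists x, [/\ y1 x = a1, y2 x = a2 & y3 x = a3].
Proof.
move=> p1 p2 p3 Es Ep; have om1 := om0.
have s0 := lvo_sum O 0; have q0 := lvo_prod O 0; rewrite -lvo_sym0 in s0 q0.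
have s1 := lvo_sum O om; have q1 := lvo_prod O om; rewrite -lvo_symom in s1 q1.
have m := lvo_min O; have M := lvo_max O.
have /andP[A0 _] := lv_r1 S 0; have /andP[B0 _] := lv_r1 S om.
have /andP[C0 _] := lv_r3 S 0; have /andP[C1 _] := lv_r3 S om.
have [x hx Ex] : exists2 x, 0 <= x <= om & y3 x = a3.
  apply: der_IVT; first exact: ltW.
    by move=> t _; exact: der_cont (lv_d3 S t).
  have D : 4 * c <= a3 * (1 - a3) ^+ 2.
    have -> : a3 * (1 - a3) ^+ 2 = 4 * c + a3 * (a1 - a2) ^+ 2 by rewrite (_ : 1 - a3 = a1 + a2) -?Ep; [ring|lra].
    by rewrite lerDl mulr_ge0 ?sqr_ge0 // ltW.
  have E0 : y3 0 = 1 - 2 * y1 0 by lra.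
  have E1 : y3 om = 1 - 2 * y1 om by lra.
  have h (u v : R) : v * (1 - v) ^+ 2 - u * (1 - u) ^+ 2 = (v - u) * ((1 - u - v) ^+ 2 - u * v) by ring.
  apply/andP; split; rewrite leNgt; apply/negP => lt.
  - have := h a3 (y3 0).
    have -> : y3 0 * (1 - y3 0) ^+ 2 = 4 * c by rewrite -q0 E0; ring.
    have : 0 < (1 - a3 - y3 0) ^+ 2 - a3 * y3 0 by nra.
    by move=> b0; have : 0 < (y3 0 - a3) * ((1 - a3 - y3 0) ^+ 2 - a3 * y3 0); [rewrite mulr_gt0 // subr_gt0|lra].
  - have := h (y3 om) a3.
    have -> : y3 om * (1 - y3 om) ^+ 2 = 4 * c by rewrite -q1 E1; ring.
    have w1 : 1 / 3 < y3 om by lra.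
    have a31 : a3 < 1 by lra.
    have : 0 < y3 om * a3 - (1 - y3 om - a3) ^+ 2 by nra.
    move=> b0; have : 0 < (a3 - y3 om) * (y3 om * a3 - (1 - y3 om - a3) ^+ 2).
      by rewrite mulr_gt0 // subr_gt0.
    lra.
have S' := lvo_sum O x; have Q := lvo_prod O x; rewrite Ex in S' Q.
have a3n := lt0r_neq0 p3.
have Pq : a1 * a2 = y1 x * y2 x by apply: (mulIf a3n); rewrite Ep Q.
have : (a1 - y1 x) * (a1 - y2 x) = 0.
  have E2 : y2 x = a1 + a2 - y1 x by lra.
  by rewrite E2 in Pq *; nra.
move/eqP; rewrite mulf_eq0 => /orP[/eqP E|/eqP E].
- by exists x; split=> //; lra.
- exists (- x); rewrite (lvo_even1 O) lvo_even2 (lvo_even3 O).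
  by split=> //; lra.
Qed.
End Orbit.
End Volterra.

(** * The orbit attached to the Weierstrass functions *)

Section JacobiOrbit.
Context {R : realType}.

(** The roots of the Weierstrass cubic are [1/12 - t^2] for the roots [t] of
    [2 t^3 - t^2 + c]; the largest of these is parametrised here. It is the
    common value of [y1] and [y2] at time 0. *)
Lemma level_root (c : R) : c3_range c -> exists a, 1 / 3 < a < 1 / 2 /\ a ^+ 2 * (1 - 2 * a) = c.
Proof.
move=> /andP[c0 c1].
have [a /andP[h1 h2] E] : exists2 a, 1 / 3 <= a <= 1 / 2 & - (a ^+ 2 * (1 - 2 * a)) = - c.
  apply: (@der_IVT _ (fun a => - (a ^+ 2 * (1 - 2 * a)))); [lra| |lra].
  move=> x _; apply: (@der_cont _ _ _ (- (2 * x - 6 * x ^+ 2))); der; rewrite /=; ring.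
have {}E : a ^+ 2 * (1 - 2 * a) = c by lra.
exists a; split=> //; apply/andP; split.
- by rewrite lt_neqAle h1 andbT; apply/eqP => e; move: E; rewrite -e; lra.
- by rewrite lt_neqAle h2 andbT; apply/eqP => e; move: E; rewrite e; lra.
Qed.

(* Doubled variables, for which the quadratic relation has integral
   coefficients and can serve as a rewriting rule. *)
Lemma integral_param (a b : R) : b ^+ 2 = (1 - 2 * a) * (a + b) / 2 ->
  exists q r, [/\ a = (1 - q) / 2, b = r / 2 & r ^+ 2 = q - q ^+ 2 + q * r].
Proof.
move=> H; exists (1 - 2 * a), (2 * b); split; [by field|by field|].
by have -> : (2 * b) ^+ 2 = 4 * b ^+ 2; [ring|rewrite H; field].
Qed.

(** The other positive root of [2 t^3 - t^2 + a^2 (1 - 2 a)]. *)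
Lemma second_root (a : R) : 1 / 3 < a < 1 / 2 ->
  exists b, [/\ b ^+ 2 = (1 - 2 * a) * (a + b) / 2, (1 - 2 * a) / 2 < b, b < 1 / 3 & a < 1 - 2 * b].
Proof.
move=> /andP[a3 a2]; pose q := 1 - 2 * a.
have q0 : 0 < q by rewrite /q; lra.
have q1 : q < 1 / 3 by rewrite /q; lra.
have aE : a = (1 - q) / 2 by rewrite /q; lra.
pose d := Num.sqrt (4 * q - 3 * q ^+ 2).
have d0 : 0 <= 4 * q - 3 * q ^+ 2 by nra.
have d2 : d ^+ 2 = 4 * q - 3 * q ^+ 2 by rewrite sqr_sqrtr.
have dn : 0 <= d by rewrite sqrtr_ge0.
have dq : q < d.
  rewrite -(@ltr_pXn2r _ 2) ?nnegrE ?(ltW q0) // d2; nra.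
exists ((q + d) / 4).
have E : ((q + d) / 4) ^+ 2 = q * (a + (q + d) / 4) / 2.
  by rewrite aE; field: d2.
split; rewrite -/q //; first by lra.
  suff : d < 4 / 3 - q by lra.
  rewrite -(@ltr_pXn2r _ 2) ?nnegrE //; last by lra.
  have : 0 < (1 / 3 - q) * (4 / 3 - q) by apply: mulr_gt0; lra.
  by rewrite d2; lra.
suff : d < 1 by lra.
rewrite -(@ltr_pXn2r _ 2) ?nnegrE // expr1n d2.
have : 0 < (1 / 3 - q) * (1 - q) by apply: mulr_gt0; lra.
lra.
Qed.

Section Orbit.
Variables (a b k lam om : R) (s c d : R -> R) (K : R).
Let t0 := (1 - 2 * a) / 2 - b.
Let cc := a ^+ 2 * (1 - 2 * a).
Hypothesis a_itv : 1 / 3 < a < 1 / 2.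
Hypothesis b_root : b ^+ 2 = (1 - 2 * a) * (a + b) / 2.
Hypothesis b_lo : (1 - 2 * a) / 2 < b.
Hypothesis b_hi : b < 1 / 3.
Hypothesis ab : a < 1 - 2 * b.
Hypothesis lam0 : 0 < lam.
Hypothesis om0 : 0 < om.
Hypothesis lamE : lam ^+ 2 = a ^+ 2 - t0 ^+ 2.
Hypothesis kE : k ^+ 2 * lam ^+ 2 = a ^+ 2 - b ^+ 2.
Hypothesis J : is_jacobi k s c d K.
Hypothesis KE : K = lam * om.

(** The function [1/12 - wp] on the row, which is to be the product [y1 y2]. *)
Definition jacobi_v (x : R) : R := a ^+ 2 - (a ^+ 2 - b ^+ 2) * s (lam * x) ^+ 2.
Let v := jacobi_v.
Let v1 (x : R) : R := - (2 * (a ^+ 2 - b ^+ 2) * lam * s (lam * x) * c (lam * x) * d (lam * x)).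

Let dlam x : is_derive x (1 : R) (fun t => lam * t) lam.
Proof. by der; ring. Qed.
Let dv x : is_derive x (1 : R) v (v1 x).
Proof.
have Hs := der_comp (dlam x) (jacobi_ds J (lam * x)).
by rewrite /v /jacobi_v; der; rewrite /v1 /=; ring.
Qed.
Let dv1 x : is_derive x (1 : R) v1 (v x - cc - 6 * v x ^+ 2).
Proof.
have Hs := der_comp (dlam x) (jacobi_ds J (lam * x)).
have Hc := der_comp (dlam x) (jacobi_dc J (lam * x)).
have Hd := der_comp (dlam x) (jacobi_dd J (lam * x)).
rewrite /v1; der; rewrite /v /jacobi_v /cc.
have Ec := jacobi_sc J (lam * x); have Ed := jacobi_sd J (lam * x).
move: (s _) (c _) (d _) Ec Ed => S C D Ec Ed.
have {}Ec : C ^+ 2 = 1 - S ^+ 2 by lra.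
have {}Ed : lam ^+ 2 * D ^+ 2 = lam ^+ 2 - (a ^+ 2 - b ^+ 2) * S ^+ 2.
  by rewrite -kE -{2}[lam ^+ 2]mulr1 -Ed; ring.
transitivity (- 2 * (a ^+ 2 - b ^+ 2) * (C ^+ 2 * (lam ^+ 2 * D ^+ 2)
   - S ^+ 2 * (lam ^+ 2 * D ^+ 2) - (k ^+ 2 * lam ^+ 2) * S ^+ 2 * C ^+ 2)); first by ring.
rewrite Ed Ec kE lamE /t0.
by have [q [r [-> -> H]]] := integral_param b_root; field: H.
Qed.
Let v1_sqr x : v1 x ^+ 2 = (v x - cc) ^+ 2 - 4 * v x ^+ 3.
Proof.
have Ec := jacobi_sc J (lam * x); have Ed := jacobi_sd J (lam * x).
rewrite /v1 /v /jacobi_v /cc; move: (s _) (c _) (d _) Ec Ed => S C D Ec Ed.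
have {}Ec : C ^+ 2 = 1 - S ^+ 2 by lra.
have {}Ed : lam ^+ 2 * D ^+ 2 = lam ^+ 2 - (a ^+ 2 - b ^+ 2) * S ^+ 2.
  by rewrite -kE -{2}[lam ^+ 2]mulr1 -Ed; ring.
transitivity (4 * (a ^+ 2 - b ^+ 2) ^+ 2 * S ^+ 2 * C ^+ 2 * (lam ^+ 2 * D ^+ 2)); first by ring.
rewrite Ed Ec lamE /t0.
by have [q [r [-> -> H]]] := integral_param b_root; field: H.
Qed.
Let b0 : 0 < b. Proof. by have := b_lo; have := a_itv; lra. Qed.
Let B0 : 0 < a ^+ 2 - b ^+ 2.
Proof. by have := b_hi; have := a_itv; have := b0; nra. Qed.
Let v_ge x : b ^+ 2 <= v x.
Proof.
have Ec := jacobi_sc J (lam * x); have := sqr_ge0 (c (lam * x)).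
rewrite /v /jacobi_v; have := B0; move: Ec; set S := s _ ^+ 2; set C := c _ ^+ 2 => Ec; nra.
Qed.
Let ccb : cc = b ^+ 2 * (1 - 2 * b).
Proof. by rewrite /cc; have [q [r [-> -> H]]] := integral_param b_root; field: H. Qed.
Let cc_lt : cc < b ^+ 2.
Proof. by rewrite ccb gtr_pMr ?exprn_gt0 //; have := b0; lra. Qed.
Let cc0 : 0 < cc.
Proof. by rewrite /cc mulr_gt0 ?exprn_gt0 //; have := a_itv; lra. Qed.
Let v0 x : 0 < v x. Proof. exact: lt_trans cc0 (lt_le_trans cc_lt (v_ge x)). Qed.

(* [p] is the logarithmic derivative of [y3], hence has to be [y1 - y2]. *)
Let y3 x := cc / v x.
Let p x := - v1 x / v x.
Let y1 x := (1 - y3 x + p x) / 2.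
Let y2 x := (1 - y3 x - p x) / 2.

Let y12 x : y1 x * y2 x = v x.
Proof.
have N := lt0r_neq0 (v0 x); have E := v1_sqr x.
rewrite /y1 /y2 /y3 /p; field: E; exact: N.
Qed.

Let y3_itv x : 0 < y3 x < 1.
Proof.
rewrite divr_gt0 // ltr_pdivrMr // mul1r; exact: lt_le_trans cc_lt (v_ge x).
Qed.

Let y_pos x : 0 < y1 x /\ 0 < y2 x.
Proof.
have := y12 x; have := v0 x; have := y3_itv x.
have : y1 x + y2 x = 1 - y3 x by rewrite /y1 /y2; lra.
move: (y1 x) (y2 x) (y3 x) (v x) => u w z V E1 /andP[? ?] ? E2; split; nra.
Qed.

Lemma jacobi_orbit_sol : lv_solution y1 y2 y3.
Proof.
have d3 x : is_derive x (1 : R) y3 (y3 x * p x).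
  have N := lt0r_neq0 (v0 x); have D := dv x; rewrite /y3; der.
  by rewrite /p /=; field; exact: N.
have dp x : is_derive x (1 : R) p (2 * v x - y3 x * (1 - y3 x)).
  have N := lt0r_neq0 (v0 x); have D := dv x; have D1 := dv1 x; have E := v1_sqr x.
  by rewrite /p /y3; der; field: E; exact: N.
have E x : v x = y1 x * y2 x by rewrite y12.
split=> x.
- have := d3 x; have := dp x => D1 D2; rewrite /y1; der.
  by rewrite E /y1 /y2; field.
- have := d3 x; have := dp x => D1 D2; rewrite /y2; der.
  by rewrite E /y1 /y2; field.
- by apply: der_eq (d3 x) _; rewrite /y1 /y2; field.
- by have [h1 h2] := y_pos x; rewrite h1 /=; have := y3_itv x; rewrite /y1 /y2 in h1 h2 *; lra.
- by have [h1 h2] := y_pos x; rewrite h2 /=; have := y3_itv x; rewrite /y1 /y2 in h1 h2 *; lra.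
- exact: y3_itv.
Qed.

Let dN x : d (- x) = d x.
Proof.
have := jacobi_sd J (- x); rewrite (jacobi_sN J) sqrrN -[RHS](jacobi_sd J x) => /addrI /eqP.
rewrite eqf_sqr => /orP[/eqP //|/eqP E].
by have := jacobi_d_gt0 J (- x); have := jacobi_d_gt0 J x; rewrite E; lra.
Qed.
Let dD x : d (x + 2 * K) = d x.
Proof.
have := jacobi_sd J (x + 2 * K); rewrite (jacobi_sD J) sqrrN -[RHS](jacobi_sd J x) => /addrI /eqP.
rewrite eqf_sqr => /orP[/eqP //|/eqP E].
by exfalso; have := jacobi_d_gt0 J (x + 2 * K); rewrite E oppr_gt0 ltNge ltW // (jacobi_d_gt0 J).
Qed.
Let vN x : v (- x) = v x. Proof. by rewrite /v /jacobi_v mulrN (jacobi_sN J) sqrrN. Qed.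
Let pN x : p (- x) = - p x.
Proof. by rewrite /p vN /v1 mulrN (jacobi_sN J) (jacobi_cN J) dN; ring. Qed.
Let lamD x : lam * (x + 2 * om) = lam * x + 2 * K. Proof. by rewrite KE; ring. Qed.
Let vD x : v (x + 2 * om) = v x.
Proof. by rewrite /v /jacobi_v lamD (jacobi_sD J) sqrrN. Qed.
Let pD x : p (x + 2 * om) = p x.
Proof. by rewrite /p vD /v1 lamD (jacobi_sD J) (jacobi_cD J) dD; ring. Qed.

Lemma jacobi_orbit : exists y1 y2 y3 : R -> R, lv_orbit cc om y1 y2 y3 /\
  forall x, y1 x * y2 x = jacobi_v x.
Proof.
exists y1, y2, y3; split; last exact: y12.
have v_0 : v 0 = a ^+ 2 by rewrite /v /jacobi_v mulr0 (jacobi_s0 J) expr0n mulr0 subr0.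
have a0 : a != 0 by apply/lt0r_neq0; have := a_itv; lra.
have v_om : v om = b ^+ 2 by rewrite /v /jacobi_v -KE (jacobi_sK J) expr1n; ring.
have y3_0 : y3 0 = 1 - 2 * a by rewrite /y3 v_0 /cc; field.
have y3_om : y3 om = 1 - 2 * b by rewrite /y3 v_om ccb; field; exact: lt0r_neq0.
have p_0 : p 0 = 0 by rewrite /p /v1 mulr0 (jacobi_s0 J); ring.
split.
- exact: jacobi_orbit_sol.
- exact: om0.
- by move=> x; rewrite /y1 /y2; field.
- by move=> x; rewrite y12 /y3 mulrC divfK // lt0r_neq0.
- by move=> x; rewrite /y1 /y2 /y3 vN pN.
- by move=> x; rewrite /y3 vN.
- by move=> x; rewrite /y1 /y3 vD pD.
- by move=> x; rewrite /y2 /y3 vD pD.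
- by move=> x; rewrite /y3 vD.
- move=> x /andP[x0 xo].
  have h : 0 < lam * x by rewrite mulr_gt0.
  have h' : lam * x < K by rewrite KE ltr_pM2l.
  have px : 0 < p x.
    rewrite /p /v1 opprK divr_gt0 // mulr_gt0 ?(jacobi_d_gt0 J) // mulr_gt0 //; last first.
      by apply: (jacobi_c_gt0 J); lra.
    rewrite mulr_gt0 //; last by apply: (jacobi_s_gt0 J); lra.
    by rewrite !mulr_gt0.
  by rewrite /y1 /y2; lra.
- by rewrite y3_0; have := a_itv; lra.
- by rewrite /y1 p_0 y3_0 y3_om; have := ab; lra.
Qed.
End Orbit.

(** The roots of the cubic give the modulus and the scaling of the Jacobi
    functions in terms of [c]. *)
Lemma weierstrass_orbit (E : weierstrass_data R) (c : R) :
  c3_range c -> is_weierstrass (inv2 c) (inv3 c) E ->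
  exists y1 y2 y3 Z : R -> R,
    [/\ lv_orbit c (omega1 E) y1 y2 y3,
        forall x : R, wp E (omega2 E + x%:C) = (12^-1 - y1 x * y2 x)%:C,
        Z 0 = 0 /\ (forall x, is_derive x (1 : R) Z (y1 x * y2 x - 12^-1)),
        forall x : R, wzeta E (omega2 E + x%:C) = wzeta E (omega2 E) + (Z x)%:C &
        wzeta E (omega1 E)%:C = (Z (omega1 E))%:C].
Proof.
move=> hc HE; have [a [a_itv cE]] := level_root hc.
have [b [b_root b_lo b_hi ab]] := second_root a_itv.
have om0 := omega1_gt0 HE.
pose t0 := (1 - 2 * a) / 2 - b.
have /andP[a1 a2] := a_itv.
have b0 : 0 < b by lra.
have lam2 : 0 < a ^+ 2 - t0 ^+ 2 by rewrite /t0; nra.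
have B2 : 0 < a ^+ 2 - b ^+ 2 by nra.
have bt : t0 ^+ 2 < b ^+ 2 by rewrite /t0; nra.
pose lam := Num.sqrt (a ^+ 2 - t0 ^+ 2).
pose k := Num.sqrt ((a ^+ 2 - b ^+ 2) / (a ^+ 2 - t0 ^+ 2)).
have lam0 : 0 < lam by rewrite sqrtr_gt0.
have lamE : lam ^+ 2 = a ^+ 2 - t0 ^+ 2 by rewrite sqr_sqrtr // ltW.
have k0 : 0 < k by rewrite sqrtr_gt0 divr_gt0.
have k2 : k ^+ 2 = (a ^+ 2 - b ^+ 2) / (a ^+ 2 - t0 ^+ 2) by rewrite sqr_sqrtr // ltW // divr_gt0.
have k1 : k < 1.
  have : k ^+ 2 < 1 by rewrite k2 ltr_pdivrMr // mul1r; lra.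
  by nra.
have kE : k ^+ 2 * lam ^+ 2 = a ^+ 2 - b ^+ 2 by rewrite k2 lamE divfK // lt0r_neq0.
have k01 : 0 < k < 1 by rewrite k0.
have [s [cn [d [K J]]]] := jacobi_exists k01.
have roots (t : R) : 4 * t ^+ 3 - inv2 c * t - inv3 c =
    4 * ((t - ((12^-1 - a ^+ 2) + lam ^+ 2)) * (t - ((12^-1 - a ^+ 2) + k ^+ 2 * lam ^+ 2)) * (t - (12^-1 - a ^+ 2))).
  rewrite /inv2 /inv3 kE lamE /t0 -cE.
  by have [q [r [-> -> H]]] := integral_param b_root; field: H.
have [KE H] := wp_row HE k01 lam0 J roots.
have [u1 [u2 [u3 [orb yv]]]] := jacobi_orbit a_itv b_root b_lo b_hi ab lam0 om0 lamE kE J KE.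
have wpE x : wp E (omega2 E + x%:C) = (12^-1 - u1 x * u2 x)%:C.
  by rewrite H yv /jacobi_v kE; congr (_%:C); ring.
have [Z [Z0 dZ zE zomE]] := zeta_row HE wpE.
exists u1, u2, u3, Z; split=> //.
- by rewrite -cE; exact: orb.
- by split=> // x; apply: der_eq (dZ x) _; ring.
Qed.
End JacobiOrbit.

(** * Dependence of the orbits on the level *)

(** The explicit form of total differentiability suits functions that are only
    controlled for [c] in an open interval. *)
Definition diff2 (R : realType) (F : R -> R -> R) (c0 s0 A B : R) : Prop :=
  forall e : R, 0 < e -> exists2 r : R, 0 < r & forall c s, `|c - c0| < r -> `|s - s0| < r ->
    `|F c s - F c0 s0 - A * (c - c0) - B * (s - s0)| <= e * (`|c - c0| + `|s - s0|).

Section Diff2.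
Context {R : realType}.
Implicit Types (F g : R -> R -> R).

Lemma diff2_comp F g c0 s0 A B A' B' :
  diff2 F c0 (g c0 s0) A B -> diff2 g c0 s0 A' B' ->
  diff2 (fun c s => F c (g c s)) c0 s0 (A + B * A') (B * B').
Proof.
move=> HF Hg e e0.
pose L := `|A'| + `|B'| + 1.
have nA := normr_ge0 A'; have nB := normr_ge0 B'; have nBB := normr_ge0 B.
have L1 : 1 <= L by rewrite /L; lra.
have e1 : 0 < e / (2 * (1 + L)) by rewrite divr_gt0 // mulr_gt0 //; lra.
have e2 : 0 < e / (2 * (`|B| + 1)) by rewrite divr_gt0 // mulr_gt0 //; lra.
have [r1 r10 H1] := HF _ e1; have [r2 r20 H2] := Hg _ e2.
have [r3 r30 H3] := Hg _ (@ltr01 R).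
pose r := Num.min (Num.min (r1 / (2 * L)) r1) (Num.min r2 r3).
exists r; first by rewrite !lt_min r10 r20 r30 divr_gt0 // mulr_gt0 //; lra.
move=> c s; rewrite !lt_min => /andP[/andP[c1 c1'] /andP[c2 c3]] /andP[/andP[s1 s1'] /andP[s2 s3]].
have {}H2 := H2 c s c2 s2; have {}H3 := H3 c s c3 s3; rewrite mul1r in H3.
have dc := normr_ge0 (c - c0); have ds := normr_ge0 (s - s0).
have G : `|g c s - g c0 s0| <= L * (`|c - c0| + `|s - s0|).
  have -> : g c s - g c0 s0 = (g c s - g c0 s0 - A' * (c - c0) - B' * (s - s0)) + (A' * (c - c0) + B' * (s - s0)) by ring.
  apply: le_trans (ler_normD _ _) _.
  have := ler_normD (A' * (c - c0)) (B' * (s - s0)); rewrite !normrM /L; nra.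
have L2 : 0 < 2 * L by lra.
rewrite ltr_pdivlMr // in c1; rewrite ltr_pdivlMr // in s1.
have Gr : `|g c s - g c0 s0| < r1 by apply: le_lt_trans G _; lra.
have {}H1 := H1 c (g c s) c1' Gr.
have -> : F c (g c s) - F c0 (g c0 s0) - (A + B * A') * (c - c0) - B * B' * (s - s0) =
  (F c (g c s) - F c0 (g c0 s0) - A * (c - c0) - B * (g c s - g c0 s0)) +
  B * (g c s - g c0 s0 - A' * (c - c0) - B' * (s - s0)) by ring.
apply: le_trans (ler_normD _ _) _; rewrite normrM.
set T := `|c - c0| + `|s - s0| in H2 H3 G *.
have T0 : 0 <= T by rewrite addr_ge0.
have b1 : e / (2 * (1 + L)) * (`|c - c0| + `|g c s - g c0 s0|) <= e / 2 * T.
  have -> : e / 2 * T = e / (2 * (1 + L)) * ((1 + L) * T) by field; apply/lt0r_neq0; lra.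
  rewrite ler_pM2l //; rewrite mulrDl mul1r lerD // /T; lra.
have b2 : `|B| * `|g c s - g c0 s0 - A' * (c - c0) - B' * (s - s0)| <= e / 2 * T.
  have -> : e / 2 * T = (`|B| + 1) * (e / (2 * (`|B| + 1)) * T) by field; apply/lt0r_neq0; lra.
  apply: le_trans (_ : (`|B| + 1) * `|g c s - g c0 s0 - A' * (c - c0) - B' * (s - s0)| <= _).
    by rewrite ler_wpM2r // lerDl.
  by rewrite ler_pM2l //; lra.
lra.
Qed.

(** The error in the level is uniform in the time; hence the continuity of [V]
    at [x0] suffices to let both variables move. *)
Lemma diff2_level F (V : R -> R) c0 x0 (f' V' C r0 : R) :
  0 < r0 -> 0 < C ->
  (forall c x, `|c - c0| < r0 -> `|x - x0| <= 1 ->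
     `|F c x - F c0 x - (c - c0) * V x| <= C * (c - c0) ^+ 2) ->
  is_derive x0 (1 : R) V V' -> is_derive x0 (1 : R) (F c0) f' ->
  diff2 F c0 x0 (V x0) f'.
Proof.
move=> r00 C0 HF /derP HV /derP Hf e e0.
have e3 : 0 < e / 3 by lra.
have [r1 r10 H1] := Hf _ e3; have [r2 r20 H2] := HV _ (@ltr01 R).
pose M := `|V'| + 1; have M0 : 0 < M by rewrite ltr_wpDl.
pose r := Num.min (Num.min (Num.min r0 1) (Num.min r1 r2)) (Num.min (e / 3 / C) (e / 3 / M)).
exists r; first by rewrite !lt_min r00 ltr01 r10 r20 !divr_gt0.
move=> c x; rewrite !lt_min => /andP[/andP[/andP[c1 _] _] /andP[c2 _]] /andP[/andP[/andP[_ x1] /andP[x2 x3]] /andP[_ x4]].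
rewrite ltr_pdivlMr // in c2; rewrite ltr_pdivlMr // in x4.
have {}HF := HF c x c1 (ltW x1).
have := H1 _ x2; have := H2 _ x3; rewrite !subrKC mul1r => {}H2 {}H1.
have -> : F c x - F c0 x0 - V x0 * (c - c0) - f' * (x - x0) =
  (F c x - F c0 x - (c - c0) * V x) + (F c0 x - F c0 x0 - f' * (x - x0)) + (c - c0) * (V x - V x0) by ring.
apply: le_trans (ler_normD _ _) _; rewrite normrM.
have := ler_normD (F c x - F c0 x - (c - c0) * V x) (F c0 x - F c0 x0 - f' * (x - x0)).
have dc := normr_ge0 (c - c0); have dx := normr_ge0 (x - x0).
have b1 : C * (c - c0) ^+ 2 <= e / 3 * `|c - c0|.
  by rewrite -(real_normK (num_real (c - c0))) expr2; nra.
have b2 : `|V x - V x0| <= M * `|x - x0|.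
  have -> : V x - V x0 = (V x - V x0 - V' * (x - x0)) + V' * (x - x0) by ring.
  by apply: le_trans (ler_normD _ _) _; rewrite normrM /M; lra.
have b3 : `|c - c0| * `|V x - V x0| <= e / 3 * `|c - c0|.
  rewrite mulrC ler_wpM2r //; apply: le_trans b2 _; lra.
have := mulr_ge0 (ltW e3) dx; have := mulr_ge0 (ltW e3) dc.
lra.
Qed.

Lemma diff2_scaled (om : R -> R) c0 s0 om' (q : R) : is_derive c0 (1 : R) om om' ->
  diff2 (fun c s => s * om c / q) c0 s0 (s0 * om' / q) (om c0 / q).
Proof.
move=> /derP H e e0.
pose Q := `|q^-1| + 1; have Q0 : 0 < Q by rewrite ltr_wpDl.
pose S := `|s0| + 1; have S0 : 0 < S by rewrite ltr_wpDl.
have e2 : 0 < e / (2 * Q * S) by rewrite !(divr_gt0, mulr_gt0).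
have [r1 r10 H1] := H _ e2.
pose M := `|om'| + 1; have M0 : 0 < M by rewrite ltr_wpDl.
pose r := Num.min (Num.min r1 1) (e / (2 * Q * M)).
exists r; first by rewrite !lt_min r10 ltr01 !(divr_gt0, mulr_gt0).
move=> c s; rewrite !lt_min => /andP[/andP[c1 _] _] /andP[/andP[_ s1] s2].
have := H1 _ c1; rewrite subrKC => {}H1.
have -> : s * om c / q - s0 * om c0 / q - s0 * om' / q * (c - c0) - om c0 / q * (s - s0) =
  q^-1 * (s * (om c - om c0 - om' * (c - c0)) + (s - s0) * om' * (c - c0)) by ring.
rewrite normrM.
have dc := normr_ge0 (c - c0); have dst := normr_ge0 (s - s0).
rewrite ltr_pdivlMr ?mulr_gt0 // in s2.
have sS : `|s| <= S.
  by have := ler_normD (s - s0) s0; rewrite subrK /S; lra.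
have b1 : `|s * (om c - om c0 - om' * (c - c0))| <= e / (2 * Q) * `|c - c0|.
  rewrite normrM; have -> : e / (2 * Q) * `|c - c0| = S * (e / (2 * Q * S) * `|c - c0|).
    by field; rewrite !lt0r_neq0.
  by apply: ler_pM; rewrite ?normr_ge0.
have b2 : `|(s - s0) * om' * (c - c0)| <= e / (2 * Q) * `|c - c0|.
  rewrite !normrM ler_wpM2r // ler_pdivlMr ?mulr_gt0 //.
  have : `|om'| <= M by rewrite lerDl.
  have := normr_ge0 om'; have := mulr_ge0 dst (ltW Q0); nra.
have qQ : `|q^-1| <= Q by rewrite lerDl.
have N := ler_normD (s * (om c - om c0 - om' * (c - c0))) ((s - s0) * om' * (c - c0)).
apply: le_trans (_ : Q * (e / Q * `|c - c0|) <= _).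
  apply: ler_pM; rewrite ?normr_ge0 //; apply: le_trans N _.
  have -> : e / Q * `|c - c0| = e / (2 * Q) * `|c - c0| + e / (2 * Q) * `|c - c0|.
    by field; rewrite lt0r_neq0.
  lra.
have -> : Q * (e / Q * `|c - c0|) = e * `|c - c0| by field; rewrite lt0r_neq0.
by rewrite ler_pM2l // lerDl.
Qed.
End Diff2.

Section Family.
Context {R : realType}.
Variables (om : R -> R) (y1 y2 y3 Z : R -> R -> R).
Hypothesis HO : forall c, c3_range c -> lv_orbit c (om c) (y1 c) (y2 c) (y3 c).
Hypothesis HZ0 : forall c, c3_range c -> Z c 0 = 0.
Hypothesis HZ : forall c (x : R), c3_range c ->
  is_derive x (1 : R) (Z c) (y1 c x * y2 c x - 12^-1).
Variable c0 : R.
Hypothesis c0_range : c3_range c0.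
Let O0 := HO c0_range.

Definition vcoef : R := (2 * c0 * (1 - 27 * c0))^-1.
Let D := vcoef.
Definition vb1 (x : R) := D * (3 * y2 c0 x + y3 c0 x - 6 * y1 c0 x * y2 c0 x - 18 * c0).
Definition vb2 (x : R) := D * (3 * y1 c0 x + y3 c0 x - 6 * y1 c0 x * y2 c0 x - 18 * c0).
Definition vb3 (x : R) := D * (- 1 + y3 c0 x + 12 * y1 c0 x * y2 c0 x - 18 * c0).
Definition vtime (x : R) := 6 * D * Z c0 x + (1 / 2 - 18 * c0) * D * x.

(** The derivative of the orbit with respect to its level at fixed time. As in
    the classical formulas of Frobenius and Stickelberger for the derivatives of
    wp in its invariants, it consists of the velocity, multiplied by a
    combination of zeta and of the time, and a polynomial in the orbit. *)
Definition vd1 (x : R) := y1 c0 x * (vtime x * (y2 c0 x - y3 c0 x) + vb1 x).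
Definition vd2 (x : R) := y2 c0 x * (vtime x * (y3 c0 x - y1 c0 x) + vb2 x).
Definition vd3 (x : R) := y3 c0 x * (vtime x * (y1 c0 x - y2 c0 x) + vb3 x).

Lemma vd_linear (x : R) :
  [/\ is_derive x (1 : R) vd1 (vd1 x * (y2 c0 x - y3 c0 x) + y1 c0 x * (vd2 x - vd3 x)),
      is_derive x (1 : R) vd2 (vd2 x * (y3 c0 x - y1 c0 x) + y2 c0 x * (vd3 x - vd1 x)) &
      is_derive x (1 : R) vd3 (vd3 x * (y1 c0 x - y2 c0 x) + y3 c0 x * (vd1 x - vd2 x))].
Proof.
have d1 := lv_d1 (lvo_sol O0) x; have d2 := lv_d2 (lvo_sol O0) x.
have d3 := lv_d3 (lvo_sol O0) x; have dz := HZ x c0_range.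
have Es := lvo_sum O0 x; have Ep := lvo_prod O0 x.
have E3 : y3 c0 x = 1 - y1 c0 x - y2 c0 x by lra.
have Ec : c0 = y1 c0 x * y2 c0 x * (1 - y1 c0 x - y2 c0 x) by rewrite -E3.
split; rewrite /vd1 /vd2 /vd3 /vtime /vb1 /vb2 /vb3; der; move: E3 Ec; set d := D;
  move: (y1 c0 x) (y2 c0 x) (y3 c0 x) (Z c0 x) d => u v w z d -> Ec;
  by rewrite Ec; field.
Qed.

(* The starting point of the orbit is an algebraic function of the level, whose
   derivative [da] is the initial value of the linearised solution. *)
Let level_a c : c3_range c -> [/\ 1 / 3 < y1 c 0, y1 c 0 < 1 / 2, y2 c 0 = y1 c 0,
  y3 c 0 = 1 - 2 * y1 c 0 & c = y1 c 0 ^+ 2 * (1 - 2 * y1 c 0)].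
Proof.
move=> hc; have H := HO hc.
have m := lvo_min H; have s := lvo_sym0 H; have e := lvo_sum H 0; have p := lvo_prod H 0.
have /andP[r _] := lv_r3 (lvo_sol H) 0.
rewrite -s in e p; have E3 : y3 c 0 = 1 - 2 * y1 c 0 by lra.
by split; [lra|lra|by []|by []|rewrite -E3 -[LHS]p; ring].
Qed.

Let a0 := y1 c0 0.
Let da := (2 * a0 * (1 - 3 * a0))^-1.

Let vd_init : [/\ vd1 0 = da, vd2 0 = da & vd3 0 = - 2 * da].
Proof.
have [h1 h2 E2 E3 Ec] := level_a c0_range.
have H1 : a0 != 0 by apply: lt0r_neq0; rewrite /a0; lra.
have H2 : 1 - 3 * a0 != 0 by rewrite lt_eqF // /a0; lra.
have H3 : 1 - 2 * a0 != 0 by apply: lt0r_neq0; rewrite /a0; lra.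
have H4 : 1 + 6 * a0 != 0 by apply: lt0r_neq0; rewrite /a0; lra.
have E27 : 1 - 27 * c0 = (1 - 3 * a0) ^+ 2 * (1 + 6 * a0) by rewrite {1}Ec /a0; ring.
have ED : D = (2 * (a0 ^+ 2 * (1 - 2 * a0)) * ((1 - 3 * a0) ^+ 2 * (1 + 6 * a0)))^-1.
  by rewrite /D /vcoef E27 {1}Ec.
rewrite /vd1 /vd2 /vd3 /vtime /vb1 /vb2 /vb3 E2 E3 (HZ0 c0_range) ED /da -/a0 [in 18 * c0]Ec -/a0.
by split; field; rewrite ?H1 ?H2 ?H3 ?H4.
Qed.

Let a_quad : exists2 C, 0 < C & forall c, c3_range c ->
  `|y1 c 0 - a0| <= C * `|c - c0| /\ `|y1 c 0 - a0 - (c - c0) * da| <= C * (c - c0) ^+ 2.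
Proof.
have [h1 h2 _ _ Ec0] := level_a c0_range.
rewrite -/a0 in h1 h2 Ec0.
pose m := (6 * a0 + 1) * (3 * a0 - 1) / 9.
have m0 : 0 < m by rewrite divr_gt0 // mulr_gt0; lra.
pose g := 2 * a0 * (3 * a0 - 1).
have g0 : 0 < g by rewrite !mulr_gt0 //; lra.
exists (m^-1 + 4 * m^-1 ^+ 2 / g).
  rewrite ltr_wpDr ?invr_gt0 //; apply: divr_ge0; last exact: ltW.
  by rewrite mulr_ge0 ?sqr_ge0.
move=> c hc; have [k1 k2 _ _ Ec] := level_a hc.
set a := y1 c 0 in k1 k2 Ec *.
pose ga := 2 * (a ^+ 2 + a * a0 + a0 ^+ 2) - (a + a0).
have Ed : c - c0 = - (a - a0) * ga by rewrite Ec [in LHS]Ec0 /ga; ring.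
have gam : m <= ga by rewrite /m /ga; nra.
have A1 : `|a - a0| <= m^-1 * `|c - c0|.
  rewrite Ed normrM normrN (@ger0_norm _ ga); last by lra.
  rewrite mulrCA ler_peMr ?normr_ge0 // mulrC ler_pdivlMr // mul1r //.
have q0 : 0 <= m^-1 by rewrite invr_ge0 ltW.
split.
  apply: le_trans A1 _; rewrite ler_wpM2r ?normr_ge0 // lerDl; apply: divr_ge0; last exact: ltW.
  by rewrite mulr_ge0 ?sqr_ge0.
have -> : a - a0 - (c - c0) * da = (a - a0) ^+ 2 * (1 - 2 * (a + 2 * a0)) / g.
  have N1 : a0 != 0 by apply: lt0r_neq0; lra.
  have N2 : 1 - 3 * a0 != 0 by rewrite lt_eqF //; lra.
  have N3 : 3 * a0 - 1 != 0 by rewrite lt0r_neq0 //; lra.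
  by rewrite Ed /ga /da /g; field; rewrite N1 N2 N3.
rewrite normrM normfV (gtr0_norm g0) normrM (ger0_norm (sqr_ge0 _)) ler_pdivrMr //.
have B : `|1 - 2 * (a + 2 * a0)| <= 4 by rewrite ler_norml; lra.
have A2 : (a - a0) ^+ 2 <= m^-1 ^+ 2 * (c - c0) ^+ 2.
  by rewrite -exprMn -(real_normK (num_real (a - a0))) -(real_normK (num_real (m^-1 * _)))
   ler_sqr ?nnegrE ?normr_ge0 // normrM (ger0_norm q0).
apply: le_trans (_ : (m^-1 ^+ 2 * (c - c0) ^+ 2) * 4 <= _).
  by apply: ler_pM; rewrite ?sqr_ge0 ?normr_ge0.
have -> : (m^-1 + 4 * m^-1 ^+ 2 / g) * (c - c0) ^+ 2 * g
    = m^-1 * g * (c - c0) ^+ 2 + m^-1 ^+ 2 * (c - c0) ^+ 2 * 4.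
  by field; rewrite ?(lt0r_neq0 m0) ?(lt0r_neq0 g0).
by rewrite lerDr; apply: mulr_ge0; [rewrite mulr_ge0 // ltW|exact: sqr_ge0].
Qed.

(** Both sides have the same first order expansion at time 0, and the second
    order comparison propagates the quadratic error. *)
Lemma orbit_level_derivative (X : R) : exists2 C, 0 < C & forall c x, c3_range c -> `|x| <= X ->
  [/\ `|y1 c x - y1 c0 x - (c - c0) * vd1 x| <= C * (c - c0) ^+ 2,
      `|y2 c x - y2 c0 x - (c - c0) * vd2 x| <= C * (c - c0) ^+ 2 &
      `|y3 c x - y3 c0 x - (c - c0) * vd3 x| <= C * (c - c0) ^+ 2].
Proof.
have [K K0 HK] := a_quad.
pose B := (6 * K ^+ 2 + 2 * (6 * K ^+ 2 * expR (12 * X)) ^+ 2) * expR (13 * X).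
have B0 : 0 < B.
  rewrite mulr_gt0 ?expR_gt0 // ltr_pwDl ?mulr_gt0 ?exprn_gt0 //.
  by rewrite mulr_ge0 ?sqr_ge0.
exists (Num.sqrt B); first by rewrite sqrtr_gt0.
move=> c x hc xX; have [_ _ e2 e3 _] := level_a hc; have [_ _ f2 f3 _] := level_a c0_range.
have [i1 i2 i3'] := vd_init.
have [A1 A2] := HK c hc.
have := lv_compare2 (c - c0) (lvo_sol (HO hc)) (lvo_sol O0)
  (fun x => let: And3 h _ _ := vd_linear x in h)
  (fun x => let: And3 _ h _ := vd_linear x in h)
  (fun x => let: And3 _ _ h := vd_linear x in h) xX.
rewrite i1 i2 i3' e2 e3 f2 f3 -/a0.
set a := y1 c 0 in A1 A2 *; set dl := c - c0 in A1 A2 *.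
move=> H.
have dl0 : 0 <= dl ^+ 2 by exact: sqr_ge0.
have M1 : (a - a0 - dl * da) ^+ 2 <= K ^+ 2 * (dl ^+ 2) ^+ 2.
  rewrite -exprMn -(real_normK (num_real (a - a0 - dl * da))).
  by rewrite ler_sqr ?nnegrE ?normr_ge0 // mulr_ge0 // ltW.
have M2 : (a - a0) ^+ 2 <= K ^+ 2 * dl ^+ 2.
  rewrite -exprMn -(real_normK (num_real (a - a0))) -(real_normK (num_real (K * dl))).
  by rewrite ler_sqr ?nnegrE ?normr_ge0 // normrM (gtr0_norm K0).
have {}H : (y1 c x - y1 c0 x - dl * vd1 x) ^+ 2 + (y2 c x - y2 c0 x - dl * vd2 x) ^+ 2 +
   (y3 c x - y3 c0 x - dl * vd3 x) ^+ 2 <= B * (dl ^+ 2) ^+ 2.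
  apply: le_trans H _; rewrite /B [leRHS]mulrAC ler_wpM2r ?expR_ge0 //.
  have -> : (a - a0 - dl * da) ^+ 2 + (a - a0 - dl * da) ^+ 2 +
     (1 - 2 * a - (1 - 2 * a0) - dl * (- 2 * da)) ^+ 2 = 6 * (a - a0 - dl * da) ^+ 2 by ring.
  have -> : (a - a0) ^+ 2 + (a - a0) ^+ 2 + (1 - 2 * a - (1 - 2 * a0)) ^+ 2 = 6 * (a - a0) ^+ 2 by ring.
  have M3 : (6 * (a - a0) ^+ 2 * expR (12 * X)) ^+ 2 <= (6 * K ^+ 2 * expR (12 * X)) ^+ 2 * (dl ^+ 2) ^+ 2.
    have nn (p q : R) : 0 <= q -> 0 <= 6 * p ^+ 2 * q.
      by move=> q0; apply: mulr_ge0 => //; apply: mulr_ge0 => //; exact: sqr_ge0.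
    have s1 := nn (a - a0) _ (expR_ge0 (12 * X)).
    have s2 := mulr_ge0 (nn K _ (expR_ge0 (12 * X))) dl0.
    rewrite -exprMn ler_sqr ?nnegrE //.
    by rewrite [leRHS]mulrAC ler_wpM2r ?expR_ge0 // -mulrA ler_pM2l.
  lra.
have sq (q : R) : q ^+ 2 <= B * (dl ^+ 2) ^+ 2 -> `|q| <= Num.sqrt B * dl ^+ 2.
  move=> hq; have nn : 0 <= Num.sqrt B * dl ^+ 2 by exact: mulr_ge0 (sqrtr_ge0 B) dl0.
  rewrite -ler_sqr ?nnegrE ?normr_ge0 //.
  by rewrite exprMn (sqr_sqrtr (ltW B0)) real_normK ?num_real.
have q1 := sqr_ge0 (y1 c x - y1 c0 x - dl * vd1 x).
have q2 := sqr_ge0 (y2 c x - y2 c0 x - dl * vd2 x).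
have q3 := sqr_ge0 (y3 c x - y3 c0 x - dl * vd3 x).
by split; apply: sq; lra.
Qed.

Let om0 := om c0.
Let om00 : 0 < om0 := lvo_om O0.

Let level_near : exists2 r, 0 < r & forall c, `|c - c0| < r -> c3_range c.
Proof.
have /andP[h1 h2] := c0_range.
exists (Num.min c0 (27^-1 - c0)); first by rewrite lt_min h1; lra.
move=> c; rewrite lt_min !ltr_norml => /andP[/andP[? ?] /andP[? ?]].
by rewrite /c3_range /=; apply/andP; split; lra.
Qed.

Let level_b c : c3_range c -> [/\ 0 < y1 c (om c), y1 c (om c) < 1 / 3,
  y2 c (om c) = y1 c (om c), y3 c (om c) = 1 - 2 * y1 c (om c) &
  c = y1 c (om c) ^+ 2 * (1 - 2 * y1 c (om c))].
Proof.
move=> hc; have H := HO hc.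
have m := lvo_max H; have s := lvo_symom H; have e := lvo_sum H (om c); have p := lvo_prod H (om c).
have [h1 _ _ _ _] := level_a hc.
have /andP[r _] := lv_r1 (lvo_sol H) (om c).
rewrite -s in e p; have E3 : y3 c (om c) = 1 - 2 * y1 c (om c) by lra.
by split=> //; [lra|rewrite -E3 -[LHS]p; ring].
Qed.

Let b0 := y1 c0 om0.

Let b_lipschitz : exists2 C, 0 < C & forall c, c3_range c ->
  `|y1 c (om c) - b0| <= C * `|c - c0|.
Proof.
have [h0 h1 _ _ Ec0] := level_b c0_range.
rewrite -/om0 -/b0 in h0 h1 Ec0.
pose m := Num.min (b0 * (1 - 2 * b0)) ((1 + 6 * b0) * (1 - 3 * b0) / 9).
have m0 : 0 < m by rewrite lt_min; apply/andP; split; [apply: mulr_gt0|apply: divr_gt0 => //; apply: mulr_gt0]; lra.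
have m1 : m <= b0 * (1 - 2 * b0) by rewrite ge_min lexx.
have m2 : m <= (1 + 6 * b0) * (1 - 3 * b0) / 9 by rewrite ge_min lexx orbT.
exists m^-1; first by rewrite invr_gt0.
move=> c hc; have [k0 k1 _ _ Ec] := level_b hc.
set b := y1 c (om c) in k0 k1 Ec *.
pose g := b + b0 - 2 * (b ^+ 2 + b * b0 + b0 ^+ 2).
have Ed : c - c0 = (b - b0) * g by rewrite Ec [in LHS]Ec0 /g; ring.
have gm : m <= g.
  have : (1 - 3 * b) * m <= (1 - 3 * b) * (b0 * (1 - 2 * b0)) by rewrite ler_wpM2l //; lra.
  have : 3 * b * m <= 3 * b * ((1 + 6 * b0) * (1 - 3 * b0) / 9) by rewrite ler_wpM2l //; lra.
  have : 0 <= 2 * b * (1 / 3 - b) by apply: mulr_ge0; lra.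
  rewrite /g; lra.
rewrite Ed normrM (@ger0_norm _ g); last by lra.
rewrite mulrCA ler_peMr ?normr_ge0 // mulrC ler_pdivlMr // mul1r //.
Qed.

Let orbit_lipschitz (X : R) : exists2 C, 0 < C & forall c x, c3_range c -> `|x| <= X ->
  `|y1 c x - y2 c x - (y1 c0 x - y2 c0 x)| <= C * `|c - c0| /\ `|y3 c x - y3 c0 x| <= C * `|c - c0|.
Proof.
have [K K0 HK] := a_quad.
pose B := 6 * K ^+ 2 * expR (12 * X).
have B0 : 0 < B by rewrite mulr_gt0 ?expR_gt0 // mulr_gt0 // exprn_gt0.
exists (2 * Num.sqrt B); first by rewrite mulr_gt0 // sqrtr_gt0.
move=> c x hc xX; have [_ _ e2 e3 _] := level_a hc; have [_ _ f2 f3 _] := level_a c0_range.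
have [A1 _] := HK c hc.
have := lv_compare (lvo_sol (HO hc)) (lvo_sol O0) xX; rewrite e2 e3 f2 f3 -/a0.
set a := y1 c 0 in A1 *; set dl := c - c0 in A1 *.
have -> : (a - a0) ^+ 2 + (a - a0) ^+ 2 + (1 - 2 * a - (1 - 2 * a0)) ^+ 2 = 6 * (a - a0) ^+ 2 by ring.
move=> H.
have M2 : (a - a0) ^+ 2 <= K ^+ 2 * dl ^+ 2.
  rewrite -exprMn -(real_normK (num_real (a - a0))) -(real_normK (num_real (K * dl))).
  by rewrite ler_sqr ?nnegrE ?normr_ge0 // normrM (gtr0_norm K0).
have {}H : (y1 c x - y1 c0 x) ^+ 2 + (y2 c x - y2 c0 x) ^+ 2 + (y3 c x - y3 c0 x) ^+ 2 <= B * dl ^+ 2.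
  apply: le_trans H _; rewrite /B [leRHS]mulrAC ler_wpM2r ?expR_ge0 //; lra.
have sq (q : R) : q ^+ 2 <= B * dl ^+ 2 -> `|q| <= Num.sqrt B * `|dl|.
  move=> hq; have nn : 0 <= Num.sqrt B * `|dl| by rewrite mulr_ge0 ?sqrtr_ge0 ?normr_ge0.
  rewrite -ler_sqr ?nnegrE ?normr_ge0 //.
  by rewrite exprMn (sqr_sqrtr (ltW B0)) !real_normK ?num_real.
have q1 := sqr_ge0 (y1 c x - y1 c0 x); have q2 := sqr_ge0 (y2 c x - y2 c0 x).
have q3 := sqr_ge0 (y3 c x - y3 c0 x).
have s1 : `|y1 c x - y1 c0 x| <= Num.sqrt B * `|dl| by apply: sq; lra.
have s2 : `|y2 c x - y2 c0 x| <= Num.sqrt B * `|dl| by apply: sq; lra.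
have s3 : `|y3 c x - y3 c0 x| <= Num.sqrt B * `|dl| by apply: sq; lra.
split.
  have -> : y1 c x - y2 c x - (y1 c0 x - y2 c0 x) = (y1 c x - y1 c0 x) - (y2 c x - y2 c0 x) by ring.
  by apply: le_trans (ler_normB _ _) _; lra.
by have := normr_ge0 (y3 c x - y3 c0 x); lra.
Qed.

(** At the half period [y3] is maximal, and its value there is a continuous
    function of the level: this excludes an early turning point. Just after the
    half period of [c0] the sign of [y1 - y2] has changed, which persists for
    nearby levels: this excludes a late one. *)
Lemma half_period_continuous (e : R) : 0 < e -> exists2 r, 0 < r &
  forall c, c3_range c -> `|c - c0| < r -> `|om c - om0| < e.
Proof.
move=> e0; have w0 := om00.
pose d := Num.min (e / 2) (om0 / 2).
have d0 : 0 < d by rewrite lt_min; apply/andP; split; lra.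
have de : d < e by rewrite gt_min; apply/orP; left; lra.
have dw : d <= om0 / 2 by rewrite ge_min lexx orbT.
have [C1 C10 HC1] := orbit_lipschitz (2 * om0).
have [C2 C20 HC2] := b_lipschitz.
have [_ _ _ f3 _] := level_b c0_range; rewrite -/om0 -/b0 in f3.
pose q1 := y3 c0 om0 - y3 c0 (om0 - d).
have q10 : 0 < q1 by rewrite subr_gt0; apply: (lvo_y3_lt O0); rewrite -/om0; lra.
pose q2 := y2 c0 (om0 + d) - y1 c0 (om0 + d).
have q20 : 0 < q2 by rewrite subr_gt0; apply: (lvo_gap2 O0); rewrite -/om0; lra.
have C120 : 0 < C1 + 2 * C2 by lra.
exists (Num.min (q1 / (C1 + 2 * C2)) (q2 / C1)); first by rewrite lt_min !divr_gt0.
move=> c hc; rewrite lt_min !ltr_pdivlMr // => /andP[r1 r2].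
have [_ _ _ k3 _] := level_b hc.
have omc := lvo_om (HO hc).
have nc := normr_ge0 (c - c0).
rewrite ltr_norml; apply/andP; split.
  rewrite ltNge; apply/negP => le.
  have lo : om c <= om0 - d by lra.
  have /(HC1 c _ hc)[_ /ler_normlP[_ u1]] : `|om c| <= 2 * om0 by rewrite gtr0_norm //; lra.
  have /ler_normlP[_ u2] := HC2 c hc.
  have u3 : y3 c0 (om c) <= y3 c0 (om0 - d).
    move: lo; rewrite le_eqVlt => /predU1P[->//|lo]; apply/ltW/(lvo_y3_lt O0) => //; rewrite -/om0; lra.
  by rewrite k3 in u1; rewrite /q1 f3 in r1; lra.
rewrite ltNge; apply/negP => le.
have hi : om0 + d <= om c by lra.
have /(HC1 c _ hc)[/ler_normlP[u1 u1'] _] : `|om0 + d| <= 2 * om0 by rewrite gtr0_norm //; lra.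
have u3 : y2 c (om0 + d) <= y1 c (om0 + d).
  move: hi; rewrite le_eqVlt => /predU1P[->|hi]; first by rewrite (lvo_symom (HO hc)).
  by apply/ltW/(lvo_gap (HO hc)); lra.
by rewrite /q2 in r2; lra.
Qed.

(** The half period is a simple zero of [y1 - y2], so the implicit equation can
    be differentiated. *)
Lemma half_period_derivative : is_derive c0 (1 : R) om (- vtime om0).
Proof.
have [h0 h1 f2 f3 _] := level_b c0_range; rewrite -/om0 -/b0 in h0 h1 f2 f3.
pose g x := y1 c0 x - y2 c0 x.
pose ga := 2 * b0 * (3 * b0 - 1).
have dg : is_derive om0 (1 : R) g ga.
  have := lv_d1 (lvo_sol O0) om0; have := lv_d2 (lvo_sol O0) om0 => ? ?.
  by rewrite /g; der; rewrite f2 f3 -/b0 /ga; ring.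
have ga0 : 0 < `|ga| by rewrite normr_gt0 lt_eqF // /ga; nra.
pose de x := vd1 x - vd2 x.
have deE : de om0 = vtime om0 * ga.
  by rewrite /de /vd1 /vd2 /vb1 /vb2 f2 f3 -/b0 /ga; ring.
have [dde Hdde] : exists d, is_derive om0 (1 : R) de d.
  have [D1 D2 _] := vd_linear om0; eexists; rewrite /de; der; reflexivity.
have dec : {for om0, continuous de} := der_cont Hdde.
have [C C0 HC] := orbit_level_derivative (2 * om0).
apply/derP => e e0.
set tau := vtime om0.
pose e' := Num.min (`|ga| / 2) (e * `|ga| / (2 * (`|tau| + 2))).
have t2 : 0 < `|tau| + 2 by have := normr_ge0 tau; lra.
have e'0 : 0 < e' by rewrite lt_min !(divr_gt0, mulr_gt0).
have e'1 : e' <= `|ga| / 2 by rewrite ge_min lexx.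
have e'2 : e' * (2 * (`|tau| + 2)) <= e * `|ga|.
  by rewrite -ler_pdivlMr ?mulr_gt0 // ge_min lexx orbT.
have [r1 r10 H1] := (derP _ _ _).1 dg e' e'0.
have [r2 r20 H2] : exists2 r, 0 < r & forall w, `|w| < r -> `|de (om0 + w) - de om0| <= e'.
  have [r r0 Hr] := (derP _ _ _).1 Hdde _ (@ltr01 R).
  have M0 : 0 < `|dde| + 1 by rewrite ltr_wpDl.
  exists (Num.min r (e' / (`|dde| + 1))); first by rewrite lt_min r0 divr_gt0.
  move=> w; rewrite lt_min ltr_pdivlMr // => /andP[w1 w2].
  have := Hr w w1; rewrite mul1r => w3.
  have -> : de (om0 + w) - de om0 = (de (om0 + w) - de om0 - dde * w) + dde * w by ring.
  by apply: le_trans (ler_normD _ _) _; rewrite normrM; lra.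
have w0 := om00.
have [r3 r30 H3] := half_period_continuous (ltac:(rewrite !lt_min r10 r20; apply/andP; split=> //; lra) : 0 < Num.min (Num.min r1 r2) (om0 / 2)).
have [r4 r40 H4] := level_near.
exists (Num.min (Num.min r3 r4) (e' / (2 * C))); first by rewrite !lt_min r30 r40 divr_gt0 // mulr_gt0.
move=> h; rewrite !lt_min ltr_pdivlMr ?mulr_gt0 // => /andP[/andP[h3 h4] hC].
have hh : c0 + h - c0 = h by ring.
have hc : c3_range (c0 + h) by apply: H4; rewrite hh.
have := H3 _ hc; rewrite hh !lt_min => /(_ h3) /andP[/andP[w1 w2] w3].
set w := om (c0 + h) - om0 in w1 w2 w3.
have omE : om (c0 + h) = om0 + w by rewrite /w; ring.
have wX : `|om0 + w| <= 2 * om0 by apply: le_trans (ler_normD _ _) _; rewrite gtr0_norm //; lra.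
have [q1 q2 _] := HC _ _ hc wX; rewrite hh in q1 q2.
have sym := lvo_symom (HO hc); rewrite omE in sym.
have p1 := H1 _ w1; have p2 := H2 _ w2.
have g0 : g om0 = 0 by rewrite /g f2 -/b0 subrr.
rewrite g0 subr0 in p1.
have hn := normr_ge0 h; have wn := normr_ge0 w.
have key : `|ga * w + h * de om0| <= e' * `|w| + 2 * e' * `|h|.
  have -> : ga * w + h * de om0 = - (g (om0 + w) - ga * w) - h * (de (om0 + w) - de om0)
    - ((y1 (c0 + h) (om0 + w) - y1 c0 (om0 + w) - h * vd1 (om0 + w))
       - (y2 (c0 + h) (om0 + w) - y2 c0 (om0 + w) - h * vd2 (om0 + w))).
    by rewrite sym /g /de; ring.
  apply: le_trans (ler_normB _ _) _.
  have n1 := ler_normB (- (g (om0 + w) - ga * w)) (h * (de (om0 + w) - de om0)).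
  have n2 := ler_normB (y1 (c0 + h) (om0 + w) - y1 c0 (om0 + w) - h * vd1 (om0 + w))
     (y2 (c0 + h) (om0 + w) - y2 c0 (om0 + w) - h * vd2 (om0 + w)).
  rewrite normrN normrM in n1.
  have n3 : `|h| * `|de (om0 + w) - de om0| <= `|h| * e' by rewrite ler_wpM2l.
  have n4 : 2 * (C * h ^+ 2) <= e' * `|h|.
    by rewrite -(real_normK (num_real h)) expr2; nra.
  lra.
have {key} : `|ga| * `|w + tau * h| <= e' * `|w| + 2 * e' * `|h|.
  by rewrite -normrM; have -> : ga * (w + tau * h) = ga * w + h * de om0 by rewrite deE -/tau; ring.
have -> : om (c0 + h) - om c0 - - tau * h = w + tau * h by rewrite /w /om0; ring.
set u := w + tau * h => key.
have wu : `|w| <= `|u| + `|tau| * `|h|.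
  have -> : w = u - tau * h by rewrite /u; ring.
  by apply: le_trans (ler_normB _ _) _; rewrite normrM.
have un := normr_ge0 u.
have k1 : e' * `|w| <= e' * (`|u| + `|tau| * `|h|) by rewrite ler_pM2l.
have k2 : e' * `|u| <= `|ga| / 2 * `|u| by rewrite ler_wpM2r.
have k3 : e' * (2 * (`|tau| + 2)) * `|h| <= e * `|ga| * `|h| by rewrite ler_wpM2r.
rewrite -(ler_pM2l ga0); lra.
Qed.

Variable s0 : R.
Let x0 := s0 * om0 / pi.

Definition vsig := Z c0 x0 - s0 / pi * Z c0 om0.

(** The time [s * om c / pi] also depends on the level. Its derivative removes
    from [vtime] the part linear in the time and subtracts the matching multiple
    of [Z c0 om0], which leaves [6 * vcoef * vsig]. *)
Lemma orbit_total_derivative :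
  [/\ diff2 (fun c s => y1 c (s * om c / pi)) c0 s0
         (y1 c0 x0 * (6 * vcoef * vsig * (y2 c0 x0 - y3 c0 x0) + vb1 x0))
         (y1 c0 x0 * (y2 c0 x0 - y3 c0 x0) * (om0 / pi)),
      diff2 (fun c s => y2 c (s * om c / pi)) c0 s0
         (y2 c0 x0 * (6 * vcoef * vsig * (y3 c0 x0 - y1 c0 x0) + vb2 x0))
         (y2 c0 x0 * (y3 c0 x0 - y1 c0 x0) * (om0 / pi)) &
      diff2 (fun c s => y3 c (s * om c / pi)) c0 s0
         (y3 c0 x0 * (6 * vcoef * vsig * (y1 c0 x0 - y2 c0 x0) + vb3 x0))
         (y3 c0 x0 * (y1 c0 x0 - y2 c0 x0) * (om0 / pi))].
Proof.
have pi0 : pi != 0 :> R by apply: lt0r_neq0; exact: pi_gt0.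
have sc := diff2_scaled s0 pi half_period_derivative.
have [C C0 HC] := orbit_level_derivative (`|x0| + 1).
have [r r0 Hr] := level_near.
have bd x : `|x - x0| <= 1 -> `|x| <= `|x0| + 1.
  by move=> h; have := ler_normD (x - x0) x0; rewrite subrK; lra.
have [D1 D2 D3] := vd_linear x0.
have T1 := diff2_level r0 C0 (fun c x hc hx => let: And3 h _ _ := HC c x (Hr c hc) (bd x hx) in h)
  D1 (lv_d1 (lvo_sol O0) x0).
have T2 := diff2_level r0 C0 (fun c x hc hx => let: And3 _ h _ := HC c x (Hr c hc) (bd x hx) in h)
  D2 (lv_d2 (lvo_sol O0) x0).
have T3 := diff2_level r0 C0 (fun c x hc hx => let: And3 _ _ h := HC c x (Hr c hc) (bd x hx) in h)
  D3 (lv_d3 (lvo_sol O0) x0).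
have E : vtime x0 + s0 * - vtime om0 / pi = 6 * vcoef * vsig.
  rewrite /vtime /vsig -/D -/om0; have -> : (1 / 2 - 18 * c0) * D * x0 = (1 / 2 - 18 * c0) * D * (s0 * om0 / pi) by [].
  by move: (Z c0 x0) (pi : R) pi0 => z p p0; field.
have := diff2_comp T1 sc; have := diff2_comp T2 sc; have := diff2_comp T3 sc.
rewrite -/om0 -/x0 -E => R3 R2 R1; split.
- by move: R1; congr diff2; rewrite /vd1; ring.
- by move: R2; congr diff2; rewrite /vd2; ring.
- by move: R3; congr diff2; rewrite /vd3; ring.
Qed.

End Family.

(** * Derivatives of maps between row spaces *)

Section TotalDerivative.
Context {R : realType}.

Lemma differentiable_eps (V W : normedModType R) (f : V -> W) (df : {linear V -> W}) (p : V) :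
  continuous df ->
  (forall e : R, 0 < e -> exists2 r : R, 0 < r & forall h : V, `|h| < r ->
     `|f (p + h) - f p - df h| <= e * `|h|) ->
  is_diff p f df.
Proof.
move=> dfc H.
have E : f \o shift p = cst (f p) + df +o_ 0 id.
  apply/eqaddoP => e e0; have [r r0 Hr] := H e e0.
  apply/nbhs_ballP; exists r => // h; rewrite -ball_normE /= sub0r normrN => hr.
  rewrite [X in `|X| <= _](_ : _ = f (p + h) - f p - df h); first exact: Hr.
  by rewrite -[LHS]/(f (h + p) - (f p + df h)) opprD addrA (addrC h).
have D := diff_unique dfc E.
apply: DiffDef => //; apply/diff_locallyP; rewrite D; split=> //.
Qed.

Section Row.
Context {n : nat}.
Local Notation V := 'rV[R]_n.
Implicit Types (f g : V -> R) (p v : V).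

Lemma rV_norm_le v (i : 'I_n) : `|v 0 i| <= `|v|.
Proof.
rewrite [leRHS]/Num.Def.normr/= mx_normrE.
exact: (le_bigmax _ (fun ij : 'I_1 * 'I_n => `|v ij.1 ij.2|) (0, i)).
Qed.

Lemma is_diff_pair (F : R -> R -> R) p (i j : 'I_n) (A B : R) :
  diff2 F (p 0 i) (p 0 j) A B ->
  is_diff p (fun q : V => F (q 0 i) (q 0 j)) (fun v => A * v 0 i + B * v 0 j).
Proof.
move=> H.
have lin : linear (fun v : V => A * v 0 i + B * v 0 j : R).
  by move=> k u v; rewrite !mxE -[_ *: _]/(_ * _) /=; ring.
pose dfM := GRing.isLinear.Build _ _ _ _ _ lin.
pose df : {linear V -> R} := HB.pack (fun v : V => A * v 0 i + B * v 0 j : R) dfM.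
apply: (@differentiable_eps _ _ _ df).
  move=> v; have c k : (fun w : V => w 0 k : R) @ v --> v 0 k by exact: coord_continuous.
  have cm (a : R) k : (fun w : V => a * w 0 k) @ v --> a * v 0 k.
    by apply: (@cvgM R V (nbhs v) _ (cst a) (fun w : V => w 0 k)) => //; exact: cvg_cst.
  exact: (@cvgD R R^o V (nbhs v) _ (fun w : V => A * w 0 i) (fun w : V => B * w 0 j)).
move=> e e0; have e2 : 0 < e / 2 by lra.
have [r r0 Hr] := H _ e2; exists r => // h hr.
have := Hr ((p + h) 0 i) ((p + h) 0 j).
have E k : (p + h) 0 k - p 0 k = h 0 k by rewrite mxE addrC addKr.
rewrite !E => /(_ (le_lt_trans (rV_norm_le h i) hr) (le_lt_trans (rV_norm_le h j) hr)).
rewrite /= opprD addrA => /le_trans; apply.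
have := rV_norm_le h i; have := rV_norm_le h j; nra.
Qed.

Lemma is_diff_coord p (i : 'I_n) : is_diff p (fun q : V => q 0 i) (fun v => v 0 i).
Proof.
have D : diff2 (fun x _ : R => x) (p 0 i) (p 0 i) 1 0.
  move=> e e0; exists 1 => // c s _ _; rewrite mul0r subr0 mul1r subrr normr0.
  by rewrite mulr_ge0 ?addr_ge0 // ltW.
by apply: is_diff_eq (is_diff_pair D) _; apply/funext => v; rewrite mul1r mul0r addr0.
Qed.

Lemma is_diff_mul f g df dg p : is_diff p f df -> is_diff p g dg ->
  is_diff p (fun q => f q * g q) (fun v => f p * dg v + g p * df v).
Proof. by move=> Hf Hg; exact: (is_diffM Hf Hg). Qed.

Lemma is_diff_fun (G : R -> R) f df d p : is_derive (f p) (1 : R) G d -> is_diff p f df ->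
  is_diff p (fun q => G (f q)) (fun v => df v * d).
Proof.
move=> HG Hf.
have DG : is_diff (f p) G (fun h => h * d).
  have [D E] := HG; apply: DiffDef; first exact/derivable1_diffP.
  by rewrite deriv1E // derive1E E.
exact: (@is_diff_comp _ _ _ _ f df G _ p Hf DG).
Qed.

End Row.

Lemma is_diff_row n m (f : 'rV[R]_n -> 'rV[R]_m) (F dF : 'I_m -> 'rV[R]_n -> R) (p : 'rV[R]_n) :
  (forall q, f q = \row_j F j q) -> (forall j, is_diff p (F j) (dF j)) ->
  differentiable f p /\ forall v, 'd f p v = \row_j dF j v.
Proof.
move=> fE H.
have D j : differentiable (F j) p by have [] := H j.
have fS : f = \sum_(j < m) (fun q => F j q *: (delta_mx 0 j : 'rV[R]_m)).
  apply/funext => q; rewrite fct_sumE fE [LHS]row_sum_delta.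
  by apply: eq_bigr => j _; rewrite mxE.
have Df : differentiable f p.
  by rewrite fS; apply: differentiable_sum => j; exact: differentiableZl.
split=> // v; apply/rowP => j; rewrite mxE.
have Dc : is_diff (f p) (fun w : 'rV[R]_m => w 0 j) (fun w => w 0 j) by exact: is_diff_coord.
have C := is_diff_comp (differentiableP Df) Dc.
have -> : 'd f p v 0 j = ((fun w : 'rV[R]_m => w 0 j) \o 'd f p) v by [].
have [_ <-] := C.
have -> : (fun w : 'rV[R]_m => w 0 j) \o f = F j.
  by apply/funext => q; rewrite /= fE mxE.
by have [_ ->] := H j.
Qed.
End TotalDerivative.

(** * Arguments of complex numbers *)

Section Angles.
Context {R : realType}.

Lemma cos_eq1_itv (t : R) : - pi <= t < pi -> cos t = 1 -> t = 0.
Proof.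
move=> ht ct; have := @pi_gt0 R => p0.
have : `|t| = 0.
  apply: (@cos_inj R).
  - by rewrite in_itv /= normr_ge0 ler_norml; lra.
  - by rewrite in_itv /= lexx ltW.
  - by rewrite cos_norm ct cos0.
by move/normr0_eq0.
Qed.

Lemma eqmod_2piP (x y : R) : eqmod_2pi x y <-> (cos x = cos y /\ sin x = sin y).
Proof.
have cP t (m : int) : cos (t + 2 * pi * m%:~R) = cos t :> R.
  by apply: periodic_int => z; rewrite mulr_natl; exact: cosD2pi.
have sP t (m : int) : sin (t + 2 * pi * m%:~R) = sin t :> R.
  by apply: periodic_int => z; rewrite mulr_natl; exact: sinD2pi.
split=> [[m E]|[Ec Es]].
  have -> : x = y + 2 * pi * m%:~R by rewrite mulrzr -E; ring.
  by rewrite cP sP.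
have [m hm] := reduce_mod (x - y) (@pi_gt0 R).
exists m; rewrite -mulrzr; apply/eqP; rewrite -subr_eq0; apply/eqP.
apply: cos_eq1_itv hm _.
rewrite -mulrN -mulrNz cP cosB Ec Es -!expr2; exact: cos2Dsin2.
Qed.

Lemma is_arg_exists (z : R[i]) : z != 0 -> exists th, is_arg z th.
Proof.
move=> z0; have n0 : 0 < normc z by rewrite normc_gt0.
have := normc_sqr z; rewrite /sqmod; move: n0; move: (normc z) => r.
case: z z0 => a b /= z0 r0 E.
have rn := lt0r_neq0 r0.
pose u := a / r; pose w := b / r.
have uw : u ^+ 2 + w ^+ 2 = 1 by rewrite /u /w !expr_div_n -mulrDl -E divff ?expf_neq0.
have u1 : -1 <= u <= 1 by have := sqr_ge0 w; nra.
have su : sin (acos u) = `|w|.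
  by rewrite sin_acos // (_ : 1 - u ^+ 2 = w ^+ 2) ?sqrtr_sqr //; lra.
have cu : cos (acos u) = u by apply: acosK; rewrite in_itv.
exists (if 0 <= w then acos u else - acos u).
exists r; first exact: r0.
have -> : expi (if 0 <= w then acos u else - acos u) = u +i* w.
  rewrite /expi; case: ifPn => [w0|]; first by rewrite cu su ger0_norm.
  by rewrite -ltNge => w0; rewrite cosN sinN cu su ltr0_norm // opprK.
apply: cplx_eq; rewrite !ReImE /= mul0r ?subr0 ?addr0 mulrC divfK //.
Qed.

Lemma sqmod_polar (r th : R) : sqmod (r%:C * expi th) = r ^+ 2.
Proof.
rewrite /sqmod !ReImE /= !mul0r subr0 addr0 !exprMn -mulrDr.
by rewrite cos2Dsin2 mulr1.
Qed.

Lemma polar_inj (r r' th th' : R) : 0 < r -> 0 < r' -> r%:C * expi th = r'%:C * expi th' ->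
  r = r' /\ eqmod_2pi th th'.
Proof.
move=> r0 r'0 E.
have rr : r = r'.
  apply/eqP; rewrite -(eqrXn2 (n := 2)) ?ltW //.
  by rewrite -(sqmod_polar r th) E sqmod_polar.
split=> //; apply/eqmod_2piP; have rn := lt0r_neq0 r'0.
have := congr1 (@complex.Re R) E; have := congr1 (@complex.Im R) E.
rewrite !ReImE /= !mul0r !subr0 !addr0 rr => /(mulfI rn) -> /(mulfI rn) ->.
by [].
Qed.
End Angles.

(** * The coordinate frame *)

Lemma wedgeE (K : pzRingType) (n : nat) (u v : 'rV[K]_n) (i j : 'I_n) :
  wedge u v i j = u 0 i * v 0 j - v 0 i * u 0 j.
Proof.
by rewrite /wedge mxE [in X in _ + X]mxE ![(_ *m _) _ _]mxE !big_ord1 !mxE.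
Qed.

Section Frame.
Context {R : realType}.
Variables (ac as_ bc bs X1 U1 X2 U2 : R).

(** The coordinate frame at [(z1, z2)]: the moduli move with logarithmic
    derivatives [ac, bc] along the first coordinate and [as_, bs] along the
    second, the arguments are the last two coordinates. *)
Definition frame : 'M[R]_4 := \matrix_(i < 4, j < 4)
  (nth [::] [:: [:: ac * X1; ac * U1; bc * X2; bc * U2];
       [:: as_ * X1; as_ * U1; bs * X2; bs * U2];
       [:: - U1; X1; 0; 0];
       [:: 0; 0; - U2; X2]] i)`_j.

Hypothesis N1 : X1 ^+ 2 + U1 ^+ 2 != 0.
Hypothesis N2 : X2 ^+ 2 + U2 ^+ 2 != 0.
Let Dl := ac * bs - as_ * bc.
Hypothesis D0 : Dl != 0.

Let row4P (u v : 'rV[R]_4) : u 0 i0 = v 0 i0 -> u 0 i1 = v 0 i1 -> u 0 i2 = v 0 i2 ->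
  u 0 i3 = v 0 i3 -> u = v.
Proof.
move=> h0 h1 h2 h3; apply/rowP => -[[|[|[|[|j]]]] hj] //.
- by rewrite (_ : Ordinal hj = i0) //; apply: val_inj.
- by rewrite (_ : Ordinal hj = i1) //; apply: val_inj.
- by rewrite (_ : Ordinal hj = i2) //; apply: val_inj.
- by rewrite (_ : Ordinal hj = i3) //; apply: val_inj.
Qed.

(* Each block of two columns is a complex number: the row combination moves
   [z^a] by the complex factor with real part the combination of logarithmic
   speeds and imaginary part the speed of the argument. *)
Lemma mul_frame (u : 'rV[R]_4) :
  [/\ (u *m frame) 0 i0 = (u 0 i0 * ac + u 0 i1 * as_) * X1 - u 0 i2 * U1,
      (u *m frame) 0 i1 = (u 0 i0 * ac + u 0 i1 * as_) * U1 + u 0 i2 * X1,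
      (u *m frame) 0 i2 = (u 0 i0 * bc + u 0 i1 * bs) * X2 - u 0 i3 * U2 &
      (u *m frame) 0 i3 = (u 0 i0 * bc + u 0 i1 * bs) * U2 + u 0 i3 * X2].
Proof.
have E j : (u *m frame) 0 j = u 0 i0 * frame i0 j + u 0 i1 * frame i1 j + u 0 i2 * frame i2 j + u 0 i3 * frame i3 j.
  rewrite mxE !big_ord_recl big_ord0 addr0 !addrA.
  by congr (_ + _ + _ + _); congr (u _ _ * frame _ _); apply: val_inj.
by split; rewrite E !mxE /=; ring.
Qed.

Lemma frame_unit : frame \in unitmx.
Proof.
rewrite -row_free_unit; apply: inj_row_free => u uM.
have [] := mul_frame u; rewrite uM !mxE => e0 e1 e2 e3.
have aux (m n X U : R) : X ^+ 2 + U ^+ 2 != 0 -> 0 = m * X - n * U -> 0 = m * U + n * X -> m = 0 /\ n = 0.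
  move=> N h1 h2; split; apply: (mulIf N); rewrite mul0r.
    have -> : m * (X ^+ 2 + U ^+ 2) = (m * X - n * U) * X + (m * U + n * X) * U by ring.
    by rewrite -h1 -h2 !mul0r addr0.
  have -> : n * (X ^+ 2 + U ^+ 2) = (m * U + n * X) * X - (m * X - n * U) * U by ring.
  by rewrite -h1 -h2 !mul0r subr0.
have [m1 n1] := aux _ _ _ _ N1 e0 e1; have [m2 n2] := aux _ _ _ _ N2 e2 e3.
apply: row4P; rewrite !mxE //.
  apply: (mulIf D0); rewrite mul0r.
  transitivity ((u 0 i0 * ac + u 0 i1 * as_) * bs - (u 0 i0 * bc + u 0 i1 * bs) * as_); first by rewrite /Dl; ring.
  by rewrite m1 m2 !mul0r subr0.
apply: (mulIf D0); rewrite mul0r.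
transitivity ((u 0 i0 * bc + u 0 i1 * bs) * ac - (u 0 i0 * ac + u 0 i1 * as_) * bc); first by rewrite /Dl; ring.
by rewrite m1 m2 !mul0r subr0.
Qed.

(** Multiplication by ['i] turns the logarithmic speeds of the first two vectors
    into speeds of the arguments; conversely a rotation becomes a radial vector,
    a combination of the first two vectors by Cramer's rule. *)
Definition frameJ : 'M[R]_4 := \matrix_(b < 4, a < 4)
  (nth [::] [:: [:: 0; 0; ac; bc];
       [:: 0; 0; as_; bs];
       [:: - (bs / Dl); bc / Dl; 0; 0];
       [:: as_ / Dl; - (ac / Dl); 0; 0]] b)`_a.

Lemma frame_complex_structure (b : 'I_4) : Jstd (row b frame) = row b frameJ *m frame.
Proof.
have [e0 e1 e2 e3] := mul_frame (row b frameJ).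
apply: row4P; rewrite ?e0 ?e1 ?e2 ?e3 /Jstd /realify /z1 /z2 !mxE /=;
  case: b {e0 e1 e2 e3} => [[|[|[|[|b]]]] hb] //=; rewrite ?mul0r ?mul1r; by [ring|rewrite /Dl; field; exact: D0].
Qed.

Lemma frame_dual (a b : 'I_4) :
  (Jstd (row b frame) *m col a (invmx frame)) 0 0 = frameJ b a.
Proof.
by rewrite frame_complex_structure colE !mulmxA (mulmxK frame_unit) -colE !mxE.
Qed.

Lemma frame_hitchin (v : 'rV[R]_4) : v 0 i0 = X1 -> v 0 i1 = U1 -> v 0 i2 = X2 -> v 0 i3 = U2 ->
  hitchinQ v = Dl^-1 *: wedge (row i0 frame) (row i1 frame)
               - wedge (row i2 frame) (row i3 frame).
Proof.
move=> v0 v1 v2 v3.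
have h2 : (2%:R : R[i])^-1 = (2^-1)%:C by rewrite fmorphV rmorph_nat.
have E1 (j : 'I_4) : d_z1 R 0 j = [:: 2^-1; 0; 0; 0]`_j +i* [:: 0; - 2^-1; 0; 0]`_j.
  rewrite /d_z1 !mxE /= h2.
  by case: j => [[|[|[|[|j]]]] hj] //=; apply: cplx_eq; rewrite !ReImE /=; ring.
have E2 (j : 'I_4) : d_z2 R 0 j = [:: 0; 0; 2^-1; 0]`_j +i* [:: 0; 0; 0; - 2^-1]`_j.
  rewrite /d_z2 !mxE /= h2.
  by case: j => [[|[|[|[|j]]]] hj] //=; apply: cplx_eq; rewrite !ReImE /=; ring.
apply/matrixP => i j.
have -> : hitchinQ v i j = 4 * complex.Im ('i * z1 v * z2 v * wedge (d_z1 R) (d_z2 R) i j).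
  by rewrite /hitchinQ /sigma mxE; congr (_ * _); rewrite mxE; congr complex.Im; rewrite mxE.
rewrite wedgeE; move: (d_z1 R) (d_z2 R) E1 E2 => D1 D2 E1 E2.
rewrite (E1 i) (E1 j) (E2 i) (E2 j) {E1 E2} /z1 /z2 v0 v1 v2 v3.
have -> : (Dl^-1 *: wedge (row i0 frame) (row i1 frame) - wedge (row i2 frame) (row i3 frame)) i j
  = Dl^-1 * (frame i0 i * frame i1 j - frame i1 i * frame i0 j)
    - (frame i2 i * frame i3 j - frame i3 i * frame i2 j).
  rewrite mxE [in X in _ + X]mxE mxE !wedgeE.
  by rewrite ![row _ _ _ _]mxE.
rewrite !ReImE /= !mxE /=.
have := D0; rewrite /Dl {D1 D2 h2} => D1.
by case: i => [[|[|[|[|i]]]] hi] //=; case: j => [[|[|[|[|j]]]] hj] //=;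
  rewrite ?mulr0 ?mul0r ?mul1r ?subr0 ?addr0 ?add0r ?oppr0; field.
Qed.
End Frame.

(** * The moment coordinates and the chart *)

(** All three [y^k] of the statement are translates of [c_3 / (1/12 - wp)] by
    thirds of the period, hence the three components of the orbit. *)
Lemma elliptic_family_orbits (R : realType) (W : R -> weierstrass_data R) : elliptic_family W ->
  exists f1 f2 f3 Z : R -> R -> R,
  [/\ forall c, c3_range c -> lv_orbit c (omega1 (W c)) (f1 c) (f2 c) (f3 c),
      forall c, c3_range c -> Z c 0 = 0 /\
        forall x, is_derive x (1 : R) (Z c) (f1 c x * f2 c x - 12^-1),
      forall c s, c3_range c ->
        [/\ ysC W c s 1 = (f1 c (s * omega1 (W c) / pi))%:C,
            ysC W c s 2 = (f2 c (s * omega1 (W c) / pi))%:C &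
            ysC W c s 3 = (f3 c (s * omega1 (W c) / pi))%:C] &
      forall c x, c3_range c ->
        varsigmaC W c x = (Z c (x * omega1 (W c) / pi) - x / pi * Z c (omega1 (W c)))%:C].
Proof.
move=> hW; have pi0 : pi != 0 :> R by apply: lt0r_neq0; exact: pi_gt0.
pose P c (t : (R -> R) * (R -> R) * (R -> R) * (R -> R)) := let: (g1, g2, g3, z) := t in
    c3_range c -> [/\ lv_orbit c (omega1 (W c)) g1 g2 g3,
        forall x : R, wp (W c) (omega2 (W c) + x%:C) = (12^-1 - g1 x * g2 x)%:C,
        z 0 = 0 /\ (forall x, is_derive x (1 : R) z (g1 x * g2 x - 12^-1)),
        forall x : R, wzeta (W c) (omega2 (W c) + x%:C) = wzeta (W c) (omega2 (W c)) + (z x)%:C &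
        wzeta (W c) (omega1 (W c))%:C = (z (omega1 (W c)))%:C].
have [F HF] : {F & forall c, P c (F c)}.
  apply: choice => c; have [hc|nc] := pselect (c3_range c).
    have [g1 [g2 [g3 [z H]]]] := weierstrass_orbit hc (hW c hc).
    by exists (g1, g2, g3, z) => _.
  by exists (id, id, id, id).
have {}HF c : c3_range c -> P c (F c) by move=> _; exact: HF.
exists (fun c => (F c).1.1.1), (fun c => (F c).1.1.2), (fun c => (F c).1.2), (fun c => (F c).2).
split.
- by move=> c hc; move: (HF c hc); rewrite /P; case: (F c) => [[[g1 g2] g3] z] /(_ hc) [].
- by move=> c hc; move: (HF c hc); rewrite /P; case: (F c) => [[[g1 g2] g3] z] /(_ hc) [].
- move=> c s hc; move: (HF c hc); rewrite /P; case: (F c) => [[[g1 g2] g3] z] /(_ hc) /= [HO Hwp _ _ _].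
  have sh := lvo_shift HO; set x := s * _ / pi.
  have E (k : nat) : ysC W c s k = (g3 (x + 2 * omega1 (W c) * k%:R / 3))%:C.
    rewrite /ysC Hwp (_ : _ / pi * _ = x + 2 * omega1 (W c) * k%:R / 3); last first.
      by rewrite /x; move: (omega1 _) (pi : R) pi0 (k%:R : R) => w p p0 n; field.
    set t := x + _; rewrite (rmorphB (real_complex R)) fmorphV rmorph_nat subKr -fmorphV -rmorphM; congr (_%:C).
    have /andP[r1 _] := lv_r1 (lvo_sol HO) t; have /andP[r2 _] := lv_r2 (lvo_sol HO) t.
    by rewrite -(lvo_prod HO t) mulrC mulKf // mulf_neq0 ?lt0r_neq0.
  rewrite !E; have [s1 s2 s3] := sh x.
  split; congr (_%:C).
  + by rewrite mulr1 s3.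
  + have [_ _] := sh (x + 2 * omega1 (W c) / 3); rewrite s1 => <-; congr g3; ring.
  + by rewrite mulfK ?(lvo_per3 HO).
- move=> c x hc; move: (HF c hc); rewrite /P; case: (F c) => [[[g1 g2] g3] z] /(_ hc) /= [HO _ _ Hz Hz1].
  by rewrite /varsigmaC Hz Hz1 -rmorphM rmorphB /=; congr (_ - _); rewrite addrC addKr.
Qed.

Lemma diff2_near (R : realType) (F G : R -> R -> R) (c0 s0 A B r0 : R) : 0 < r0 ->
  (forall c s, `|c - c0| < r0 -> F c s = G c s) -> diff2 F c0 s0 A B -> diff2 G c0 s0 A B.
Proof.
move=> r00 E H e e0; have [r rp Hr] := H e e0.
exists (Num.min r r0); first by rewrite lt_min rp.
move=> c s; rewrite !lt_min => /andP[c1 c2] /andP[s1 _].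
by rewrite -!E ?subrr ?normr0 //; exact: Hr.
Qed.

Lemma is_diff_sqrt_ratio (R : realType) (n : nat) (f g L M : 'rV[R]_n -> R) (p : 'rV[R]_n) :
  0 < f p -> 0 < g p -> is_diff p f (fun v => f p * L v) -> is_diff p g (fun v => g p * M v) ->
  is_diff p (fun q => Num.sqrt (f q / g q)) (fun v => Num.sqrt (f p / g p) * ((L v - M v) / 2)).
Proof.
move=> f0 g0 Df Dg; have gn := lt0r_neq0 g0; have fn := lt0r_neq0 f0.
have q0 : 0 < f p / g p by rewrite divr_gt0.
have DV := is_diff_fun (derV gn (der_id (g p))) Dg.
have DM := is_diff_mul Df DV.
have DS := is_diff_fun (@der_sqrt _ id (f p / g p) 1 q0 (der_id _)) DM.
apply: is_diff_eq DS _; apply/funext => v.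
have S2 := sqr_sqrtr (ltW q0); have sn : Num.sqrt (f p / g p) != 0 by rewrite sqrtr_eq0 -ltNge.
move: (Num.sqrt _) sn S2 => S sn S2.
have -> : f p = S ^+ 2 * g p by rewrite S2 divfK.
by field; rewrite sn gn.
Qed.

Section Affine.
Context {R : realType}.
Implicit Type v : 'rV[R]_4.

Lemma realifyK v : realify (z1 v) (z2 v) = v.
Proof.
apply/rowP => -[[|[|[|[|j]]]] hj] //; rewrite mxE /=; congr (v _ _); exact: val_inj.
Qed.

Lemma z1_realify (w1 w2 : R[i]) : z1 (realify w1 w2) = w1.
Proof. by rewrite /z1 !mxE /=; case: w1. Qed.

Lemma z2_realify (w1 w2 : R[i]) : z2 (realify w1 w2) = w2.
Proof. by rewrite /z2 !mxE /=; case: w2. Qed.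

Lemma sqmod_ge0 (z : R[i]) : 0 <= sqmod z.
Proof. by rewrite /sqmod addr_ge0 ?sqr_ge0. Qed.

Lemma moment_ratio v : [/\ 0 < y3 v, sqmod (z1 v) = y1 v / y3 v & sqmod (z2 v) = y2 v / y3 v].
Proof.
have h1 := sqmod_ge0 (z1 v); have h2 := sqmod_ge0 (z2 v).
rewrite /y3 /y1 /y2; move: (sqmod (z1 v)) (sqmod (z2 v)) h1 h2 => a b h1 h2.
have s0 : 0 < 1 + a + b by lra.
have sn := lt0r_neq0 s0.
have -> : 1 - a / (1 + a + b) - b / (1 + a + b) = (1 + a + b)^-1 by field.
by split; [rewrite invr_gt0| rewrite invrK divfK| rewrite invrK divfK].
Qed.

Lemma moment_realify (w1 w2 : R[i]) (a b d : R) : 0 < d -> a + b + d = 1 ->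
  sqmod w1 = a / d -> sqmod w2 = b / d ->
  [/\ y1 (realify w1 w2) = a, y2 (realify w1 w2) = b & y3 (realify w1 w2) = d].
Proof.
move=> d0 E h1 h2; have dn := lt0r_neq0 d0.
have e1 := z1_realify w1 w2; have e2 := z2_realify w1 w2.
have D : 1 + a / d + b / d = d^-1.
  by apply: (mulIf dn); rewrite !mulrDl !divfK // mulVf // mul1r -E; ring.
have E1 : y1 (realify w1 w2) = a by rewrite /y1 e1 e2 h1 h2 D invrK divfK.
have E2 : y2 (realify w1 w2) = b by rewrite /y2 e1 e2 h1 h2 D invrK divfK.
by split=> //; rewrite /y3 E1 E2 -E; ring.
Qed.

Lemma c3_pos v : 0 < c3 v -> [/\ 0 < y1 v, 0 < y2 v & 0 < y3 v].
Proof.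
have [h3 h1 h2] := moment_ratio v; rewrite /c3 (pmulr_lgt0 _ h3).
have := sqmod_ge0 (z1 v); have := sqmod_ge0 (z2 v); rewrite h1 h2.
have i3 : 0 < (y3 v)^-1 by rewrite invr_gt0.
rewrite !(pmulr_lge0 _ i3) => p2 p1 p; split=> //.
  by rewrite lt_def p1 andbT; apply: contraTN p => /eqP ->; rewrite mul0r ltxx.
by rewrite lt_def p2 andbT; apply: contraTN p => /eqP ->; rewrite mulr0 ltxx.
Qed.
End Affine.

Section Chart.
Context {R : realType}.
Variables (W : R -> weierstrass_data R) (f1 f2 f3 Z : R -> R -> R).
Local Notation om c := (omega1 (W c)).
Hypothesis HO : forall c, c3_range c -> lv_orbit c (om c) (f1 c) (f2 c) (f3 c).
Hypothesis HZ : forall c, c3_range c -> Z c 0 = 0 /\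
        forall x, is_derive x (1 : R) (Z c) (f1 c x * f2 c x - 12^-1).
Hypothesis HY : forall c s, c3_range c ->
        [/\ ysC W c s 1 = (f1 c (s * om c / pi))%:C,
            ysC W c s 2 = (f2 c (s * om c / pi))%:C &
            ysC W c s 3 = (f3 c (s * om c / pi))%:C].
Hypothesis HV : forall c x, c3_range c ->
        varsigmaC W c x = (Z c (x * om c / pi) - x / pi * Z c (om c))%:C.

Lemma ys_orbit c s : c3_range c ->
  [/\ ys W c s 1 = f1 c (s * om c / pi), ys W c s 2 = f2 c (s * om c / pi)
    & ys W c s 3 = f3 c (s * om c / pi)].
Proof. by move=> hc; rewrite /ys; have [-> -> ->] := HY s hc. Qed.

Lemma ys_itv c s : c3_range c ->
  [/\ 0 < ys W c s 1, 0 < ys W c s 2, 0 < ys W c s 3,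
      ys W c s 1 + ys W c s 2 + ys W c s 3 = 1 &
      ys W c s 1 * ys W c s 2 * ys W c s 3 = c].
Proof.
move=> hc; have [-> -> ->] := ys_orbit s hc; have O1 := HO hc; have S1 := lvo_sol O1.
split; [by case/andP: (lv_r1 S1 (s * om c / pi)) | by case/andP: (lv_r2 S1 (s * om c / pi))
  | by case/andP: (lv_r3 S1 (s * om c / pi)) | exact: (lvo_sum O1) | exact: (lvo_prod O1)].
Qed.

Lemma ys_total_derivative c s : c3_range c ->
  let D := vcoef c in let vs := varsigma W c s in
  let y1 := ys W c s 1 in let y2 := ys W c s 2 in let y3 := ys W c s 3 in
  [/\ diff2 (fun c s => ys W c s 1) c s
         (y1 * (6 * D * vs * (y2 - y3) + D * (3 * y2 + y3 - 6 * y1 * y2 - 18 * c)))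
         (y1 * ((y2 - y3) * (om c / pi))),
      diff2 (fun c s => ys W c s 2) c s
         (y2 * (6 * D * vs * (y3 - y1) + D * (3 * y1 + y3 - 6 * y1 * y2 - 18 * c)))
         (y2 * ((y3 - y1) * (om c / pi))) &
      diff2 (fun c s => ys W c s 3) c s
         (y3 * (6 * D * vs * (y1 - y2) + D * (- 1 + y3 + 12 * y1 * y2 - 18 * c)))
         (y3 * ((y1 - y2) * (om c / pi)))].
Proof.
move=> hc /=; have [E1 E2 E3] := ys_orbit s hc; rewrite E1 E2 E3.
have EV : varsigma W c s = Z c (s * om c / pi) - s / pi * Z c (om c).
  by rewrite /varsigma HV.
have [H1 H2 H3] := orbit_total_derivative HO (fun c hc => (HZ hc).1)
  (fun c x hc => (HZ hc).2 x) hc s.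
have hc' := hc; case/andP: hc' => c0 c1.
have r0 : 0 < Num.min c (27^-1 - c) by rewrite lt_min c0 subr_gt0.
have near c' : `|c' - c| < Num.min c (27^-1 - c) -> c3_range c'.
  by rewrite lt_min !ltr_norml /c3_range /= => /andP[h1 h2]; apply/andP; split; lra.
rewrite EV ![_ * (_ * (om c / pi))]mulrA; split.
- by apply: (diff2_near r0 _ H1) => c' s' /near h; have [-> _ _] := ys_orbit s' h.
- by apply: (diff2_near r0 _ H2) => c' s' /near h; have [_ -> _] := ys_orbit s' h.
- by apply: (diff2_near r0 _ H3) => c' s' /near h; have [_ _ ->] := ys_orbit s' h.
Qed.

(* The logarithmic derivatives of the moduli [rad1] and [rad2] in the two first
   coordinates. *)
Definition jet_c1 c s := (4 * c * (1 - 27 * c))^-1 *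
  (1 + 3 * ys W c s 2 - 18 * ys W c s 1 * ys W c s 2 - 6 * varsigma W c s * (1 - 3 * ys W c s 2)).
Definition jet_c2 c s := (4 * c * (1 - 27 * c))^-1 *
  (1 + 3 * ys W c s 1 - 18 * ys W c s 1 * ys W c s 2 + 6 * varsigma W c s * (1 - 3 * ys W c s 1)).
Definition jet_s1 c s := om c / (2 * pi) * (3 * ys W c s 2 - 1).
Definition jet_s2 c s := om c / (2 * pi) * (1 - 3 * ys W c s 1).
Definition rad1 c s := Num.sqrt (ys W c s 1 / ys W c s 3).
Definition rad2 c s := Num.sqrt (ys W c s 2 / ys W c s 3).

(** As [rad1] is the square root of [y^1 / y^3], its logarithmic derivative is half
    the difference of those of [y^1] and [y^3], which appear as the second
    factors in [ys_total_derivative]. *)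
Lemma rad_diff (p : 'rV[R]_4) : c3_range (p 0 i0) ->
  is_diff p (fun q : 'rV[R]_4 => rad1 (q 0 i0) (q 0 i1))
    (fun v => rad1 (p 0 i0) (p 0 i1) *
       (v 0 i0 * jet_c1 (p 0 i0) (p 0 i1) + v 0 i1 * jet_s1 (p 0 i0) (p 0 i1))) /\
  is_diff p (fun q : 'rV[R]_4 => rad2 (q 0 i0) (q 0 i1))
    (fun v => rad2 (p 0 i0) (p 0 i1) *
       (v 0 i0 * jet_c2 (p 0 i0) (p 0 i1) + v 0 i1 * jet_s2 (p 0 i0) (p 0 i1))).
Proof.
move=> hc; have [p1 p2 p3 psum _] := ys_itv (p 0 i1) hc.
have [D1 D2 D3] := ys_total_derivative (p 0 i1) hc.
have pi0 : pi != 0 :> R by apply: lt0r_neq0; exact: pi_gt0.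
have hc' := hc; case/andP: hc' => c0 c1.
have c2 : 1 - 27 * p 0 i0 != 0 by apply: lt0r_neq0; lra.
have cn := lt0r_neq0 c0.
have E3 : ys W (p 0 i0) (p 0 i1) 3 = 1 - ys W (p 0 i0) (p 0 i1) 1 - ys W (p 0 i0) (p 0 i1) 2 by rewrite -psum; ring.
have split_diff F (a A B : R) : diff2 F (p 0 i0) (p 0 i1) (a * A) (a * B) ->
    is_diff p (fun q : 'rV[R]_4 => F (q 0 i0) (q 0 i1)) (fun v => a * (A * v 0 i0 + B * v 0 i1)).
  by move=> H; apply: is_diff_eq (is_diff_pair H) _; apply/funext => v; ring.
have {D1}D1 := split_diff _ _ _ _ D1; have {D2}D2 := split_diff _ _ _ _ D2.
have {D3}D3 := split_diff _ _ _ _ D3.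
split.
- apply: is_diff_eq (is_diff_sqrt_ratio p1 p3 D1 D3) _; apply/funext => v.
  congr (_ * _); rewrite /vcoef /jet_c1 /jet_s1 E3.
  move: (ys W _ _ 1) (ys W _ _ 2) (varsigma W _ _) (om _) (pi : R) pi0 => a b z w q q0.
  by field; rewrite q0 cn c2.
- apply: is_diff_eq (is_diff_sqrt_ratio p2 p3 D2 D3) _; apply/funext => v.
  congr (_ * _); rewrite /vcoef /jet_c2 /jet_s2 E3.
  move: (ys W _ _ 1) (ys W _ _ 2) (varsigma W _ _) (om _) (pi : R) pi0 => a b z w q q0.
  by field; rewrite q0 cn c2.
Qed.

Definition chart_frame (p : 'rV[R]_4) : 'M[R]_4 :=
  let c := p 0 i0 in let s := p 0 i1 in let v := chart W p in
  frame (jet_c1 c s) (jet_s1 c s) (jet_c2 c s) (jet_s2 c s) (v 0 i0) (v 0 i1) (v 0 i2) (v 0 i3).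

Lemma chartE (p : 'rV[R]_4) : chart W p = \row_(j < 4)
  [:: rad1 (p 0 i0) (p 0 i1) * cos (p 0 i2); rad1 (p 0 i0) (p 0 i1) * sin (p 0 i2);
      rad2 (p 0 i0) (p 0 i1) * cos (p 0 i3); rad2 (p 0 i0) (p 0 i1) * sin (p 0 i3)]`_j.
Proof.
by rewrite /chart /realify !ReImE /= !mul0r !subr0 !addr0.
Qed.

Lemma chart_differential (p : 'rV[R]_4) : c3_range (p 0 i0) ->
  differentiable (chart W) p /\ jacobian (chart W) p = chart_frame p.
Proof.
move=> hc; have [H1 H2] := rad_diff hc.
have C2 := is_diff_fun (is_derive_cos (p 0 i2)) (is_diff_coord p i2).
have S2 := is_diff_fun (is_derive_sin (p 0 i2)) (is_diff_coord p i2).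
have C3 := is_diff_fun (is_derive_cos (p 0 i3)) (is_diff_coord p i3).
have S3 := is_diff_fun (is_derive_sin (p 0 i3)) (is_diff_coord p i3).
pose F (j : 'I_4) (q : 'rV[R]_4) : R := 
  [:: rad1 (q 0 i0) (q 0 i1) * cos (q 0 i2); rad1 (q 0 i0) (q 0 i1) * sin (q 0 i2);
      rad2 (q 0 i0) (q 0 i1) * cos (q 0 i3); rad2 (q 0 i0) (q 0 i1) * sin (q 0 i3)]`_j.
have [||D E] := @is_diff_row R 4 4 (chart W) F (fun j v => (v *m chart_frame p) 0 j) p.
- exact: chartE.
- have E v := mul_frame (jet_c1 (p 0 i0) (p 0 i1)) (jet_s1 (p 0 i0) (p 0 i1)) 
    (jet_c2 (p 0 i0) (p 0 i1)) (jet_s2 (p 0 i0) (p 0 i1))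
    (chart W p 0 i0) (chart W p 0 i1) (chart W p 0 i2) (chart W p 0 i3) v.
  rewrite -/(chart_frame p) in E.
  case=> [[|[|[|[|j]]]] hj] //.
  + apply: is_diff_eq (is_diff_mul H1 C2) _; apply/funext => v.
    rewrite (_ : Ordinal hj = i0); last exact: val_inj.
    by have [-> _ _ _] := E v; rewrite chartE !mxE /=; ring.
  + apply: is_diff_eq (is_diff_mul H1 S2) _; apply/funext => v.
    rewrite (_ : Ordinal hj = i1); last exact: val_inj.
    by have [_ -> _ _] := E v; rewrite chartE !mxE /=; ring.
  + apply: is_diff_eq (is_diff_mul H2 C3) _; apply/funext => v.
    rewrite (_ : Ordinal hj = i2); last exact: val_inj.
    by have [_ _ -> _] := E v; rewrite chartE !mxE /=; ring.
  + apply: is_diff_eq (is_diff_mul H2 S3) _; apply/funext => v.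
    rewrite (_ : Ordinal hj = i3); last exact: val_inj.
    by have [_ _ _ ->] := E v; rewrite chartE !mxE /=; ring.
split=> //; apply/row_matrixP => b.
rewrite rowE /jacobian mul_rV_lin1 E rowE.
by apply/rowP => j; rewrite mxE.
Qed.

Lemma ysC_real c s k : c3_range c -> (1 <= k <= 3)%N -> ysC W c s k = (ys W c s k)%:C.
Proof.
move=> hc; rewrite /ys; have [h1 h2 h3] := HY s hc.
by case: k => [|[|[|[|k]]]] // _; rewrite ?h1 ?h2 ?h3.
Qed.

(** The zeta terms cancel, and [y^1 y^2 y^3 = c_3] reduces the rest to
    [2 - 54 c], which cancels the factor [1 - 27 c]. *)
Lemma jet_det c s : c3_range c ->
  jet_c1 c s * jet_s2 c s - jet_s1 c s * jet_c2 c s = om c / (4 * pi * c).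
Proof.
move=> hc; have [_ _ _ E P] := ys_itv s hc; have /andP[c0 c1] := hc.
have pi0 : pi != 0 :> R by apply: lt0r_neq0; exact: pi_gt0.
have cn := lt0r_neq0 c0.
have c2 : 1 - 27 * c != 0 by apply: lt0r_neq0; lra.
have P' : c = ys W c s 1 * ys W c s 2 * (1 - ys W c s 1 - ys W c s 2).
  by rewrite -{1}P; congr (_ * _); rewrite -E; ring.
rewrite /jet_c1 /jet_c2 /jet_s1 /jet_s2.
move: (ys W _ _ 1) (ys W _ _ 2) (varsigma W _ _) (om _) (pi : R) pi0 P' => a b z w q q0 P'.
have -> : w / (4 * q * c) = (4 * c * (1 - 27 * c))^-1 * (w / (2 * q)) * (2 - 54 * c).
  by field; rewrite q0 cn c2.
by rewrite [in 2 - 54 * c]P'; ring.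
Qed.

Lemma chart_moments (p : 'rV[R]_4) : c3_range (p 0 i0) ->
  [/\ y1 (chart W p) = ys W (p 0 i0) (p 0 i1) 1, y2 (chart W p) = ys W (p 0 i0) (p 0 i1) 2,
      y3 (chart W p) = ys W (p 0 i0) (p 0 i1) 3 & c3 (chart W p) = p 0 i0].
Proof.
move=> hc; have [p1 p2 p3 E P] := ys_itv (p 0 i1) hc.
have [e1 e2 e3] : [/\ y1 (chart W p) = ys W (p 0 i0) (p 0 i1) 1,
  y2 (chart W p) = ys W (p 0 i0) (p 0 i1) 2 & y3 (chart W p) = ys W (p 0 i0) (p 0 i1) 3].
  by apply: moment_realify => //; rewrite sqmod_polar sqr_sqrtr ?divr_ge0 ?ltW.
by split=> //; rewrite /c3 e1 e2 e3.
Qed.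

Lemma chart_coordinates (v p : 'rV[R]_4) : c3_range (p 0 i0) -> (coordinates_of W v p <-> v = chart W p).
Proof.
move=> hc; have [p1 p2 p3 E P] := ys_itv (p 0 i1) hc; split.
  case=> E0 [h1 h2 h3] [r1 r10 a1] [r2 r20 a2].
  rewrite -E0 !ysC_real // in h1 h2 h3.
  have /complexI e1 := h1; have /complexI e2 := h2; have /complexI e3 := h3.
  have [_ m1 m2] := moment_ratio v; rewrite e1 e2 e3 in m1 m2.
  rewrite -[LHS]realifyK /chart -m1 -m2 a1 a2 !sqmod_polar !sqrtr_sqr !gtr0_norm //.
move=> ->; have [e1 e2 e3 e0] := chart_moments hc.
have e4 : z1 (chart W p) = (Num.sqrt (ys W (p 0 i0) (p 0 i1) 1 / ys W (p 0 i0) (p 0 i1) 3))%:C * expi (p 0 i2).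
  exact: z1_realify.
have e5 : z2 (chart W p) = (Num.sqrt (ys W (p 0 i0) (p 0 i1) 2 / ys W (p 0 i0) (p 0 i1) 3))%:C * expi (p 0 i3).
  exact: z2_realify.
split; rewrite ?e0 //.
- by rewrite e1 e2 e3 !ysC_real.
- by exists (Num.sqrt (ys W (p 0 i0) (p 0 i1) 1 / ys W (p 0 i0) (p 0 i1) 3)); rewrite ?sqrtr_gt0 ?divr_gt0.
- by exists (Num.sqrt (ys W (p 0 i0) (p 0 i1) 2 / ys W (p 0 i0) (p 0 i1) 3)); rewrite ?sqrtr_gt0 ?divr_gt0.
Qed.

Lemma coordinates_exist (v : 'rV[R]_4) : c3_range (c3 v) -> exists p, coordinates_of W v p.
Proof.
move=> hc; have /andP[c0 _] := hc; have [q1 q2 q3] := c3_pos c0.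
have pi0 : pi != 0 :> R by apply: lt0r_neq0; exact: pi_gt0.
have O1 := HO hc; have om0 := lt0r_neq0 (lvo_om O1).
have [|//|x [x1 x2 x3]] := lvo_surj O1 q1 q2 q3; first by rewrite /y3; ring.
have [_ m1 m2] := moment_ratio v.
have nz (w : R[i]) (a : R) : 0 < a -> sqmod w = a / y3 v -> w != 0.
  move=> a0 E; apply/eqP => w0; have : 0 < sqmod w by rewrite E divr_gt0.
  by rewrite w0 /sqmod /= expr0n addr0 ltxx.
have [t1 h1] := is_arg_exists (nz _ _ q1 m1).
have [t2 h2] := is_arg_exists (nz _ _ q2 m2).
exists (mkcoord (c3 v) (x * pi / om (c3 v)) t1 t2).
split; rewrite /mkcoord ?mxE //=.
have [-> -> ->] := HY (x * pi / om (c3 v)) hc.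
have -> : x * pi / om (c3 v) * om (c3 v) / pi = x by rewrite divfK // mulfK.
by rewrite x1 x2 x3.
Qed.

(** Reduction of the two times into one period reduces the uniqueness of [s] to
    the injectivity of the orbit there. *)
Lemma coordinates_unique (v p q : 'rV[R]_4) : c3_range (c3 v) -> coordinates_of W v p ->
  (coordinates_of W v q <->
   [/\ q 0 i0 = p 0 i0, eqmod_2pi (q 0 i1) (p 0 i1),
       eqmod_2pi (q 0 i2) (p 0 i2) & eqmod_2pi (q 0 i3) (p 0 i3)]).
Proof.
move=> hc [P0 P1 P2 P3].
have pi0 : pi != 0 :> R by apply: lt0r_neq0; exact: pi_gt0.
have O1 := HO hc; have om0 := lt0r_neq0 (lvo_om O1).
have per1 := periodic_int (lvo_per1 O1); have per2 := periodic_int (lvo_per2 O1).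
have per3 := periodic_int (lvo_per3 O1).
have arg (w : R[i]) (t t' : R) : is_arg w t -> (is_arg w t' <-> eqmod_2pi t' t).
  case=> r r0 E; split; last first.
    by case/eqmod_2piP => e1 e2; exists r => //; rewrite E /expi e1 e2.
  by case=> r' r'0 E'; have [] : r' = r /\ eqmod_2pi t' t by apply: polar_inj => //; rewrite -E -E'.
rewrite /coordinates_of P0; have [A2 B2] := arg _ _ (q 0 i2) P2; have [A3 B3] := arg _ _ (q 0 i3) P3.
have [a1 a2 a3] := HY (p 0 i1) hc; have [b1 b2 b3] := HY (q 0 i1) hc.
rewrite a1 a2 a3 in P1; case: P1 => /complexI g1 /complexI g2 /complexI g3.
rewrite b1 b2 b3; split.
  case=> E0 [/complexI h1 /complexI h2 /complexI h3] /A2 E2 /A3 E3; split=> //.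
  set x := p 0 i1 * om (c3 v) / pi in g1 g2 g3.
  set y := q 0 i1 * om (c3 v) / pi in h1 h2 h3.
  have [m hm] := reduce_mod x (lvo_om O1); have [n hn] := reduce_mod y (lvo_om O1).
  have xy : x - 2 * om (c3 v) * m%:~R = y - 2 * om (c3 v) * n%:~R.
    by apply: (lvo_inj O1 hm hn); rewrite -!mulrN -!mulrNz ?per1 ?per2 ?per3 -?g1 -?g2 -?g3.
  exists (n - m); rewrite -mulrzr mulrzBr.
  have ww := mulfK pi0; apply: (mulIf om0); apply: (mulIf (invr_neq0 pi0)).
  have -> : (q 0 i1 - p 0 i1) * om (c3 v) / pi = y - x by rewrite /x /y; ring.
  have -> : y - x = 2 * om (c3 v) * (n%:~R - m%:~R) by rewrite mulrBr; lra.
  by move: (pi : R) pi0 => k k0; field.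
case=> E0 [m E1] /B2 E2 /B3 E3; split=> //.
have -> : q 0 i1 * om (c3 v) / pi = p 0 i1 * om (c3 v) / pi + 2 * om (c3 v) * m%:~R.
  have -> : q 0 i1 = p 0 i1 + 2 * pi * m%:~R by rewrite mulrzr -E1; ring.
  by move: (pi : R) pi0 => k k0; field.
by rewrite per1 per2 per3 -g1 -g2 -g3.
Qed.

Lemma chart_frame_nondegenerate (p : 'rV[R]_4) : c3_range (p 0 i0) -> let v := chart W p in
  [/\ v 0 i0 ^+ 2 + v 0 i1 ^+ 2 != 0, v 0 i2 ^+ 2 + v 0 i3 ^+ 2 != 0 &
  jet_c1 (p 0 i0) (p 0 i1) * jet_s2 (p 0 i0) (p 0 i1)
  - jet_s1 (p 0 i0) (p 0 i1) * jet_c2 (p 0 i0) (p 0 i1) != 0].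
Proof.
move=> hc v; have [p1 p2 p3 E P] := ys_itv (p 0 i1) hc.
have [e1 e2 e3 _] := chart_moments hc; have [_ m1 m2] := moment_ratio v.
rewrite e1 e2 e3 /sqmod /= in m1 m2; split.
- by rewrite m1 lt0r_neq0 ?divr_gt0.
- by rewrite m2 lt0r_neq0 ?divr_gt0.
- rewrite jet_det // lt0r_neq0 // divr_gt0 ?(lvo_om (HO hc)) //.
  by have /andP[c0 _] := hc; rewrite !mulr_gt0 // pi_gt0.
Qed.

Lemma chart_coordinate_system : is_coordinate_system W.
Proof.
split.
- exact: coordinates_exist.
- exact: coordinates_unique.
- exact: chart_coordinates.
- move=> p hc; have [D ->] := chart_differential hc; split=> //.
  have [n1 n2 n3] := chart_frame_nondegenerate hc; exact: frame_unit.
Qed.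
End Chart.

Theorem proposition6p6 (R : realType) (W : R -> weierstrass_data R)
    (hW : elliptic_family W) :
  [/\ is_coordinate_system W,
      (forall c s (k : nat), c3_range c -> (1 <= k <= 3)%N ->
         (ys W c s k)%:C = ysC W c s k),
      (forall c x, c3_range c -> (varsigma W c x)%:C = varsigmaC W c x) &
      forall c s theta1 theta2 : R, c3_range c ->
      let p := mkcoord c s theta1 theta2 in
      let w1 := omega1 (W c) in
      let Y1 := ys W c s 1 in
      let Y2 := ys W c s 2 in
      let d := dvec W p in
      let J := Jcoef W p in
      let C3 := i0 in let S := i1 in let T1 := i2 in let T2 := i3 in
      hitchinQ (chart W p) =
        (4 * c * pi / w1) *: wedge (d C3) (d S) - wedge (d T1) (d T2)
      /\ [/\ J T1 S = w1 / (2 * pi) * (3 * Y2 - 1)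
             /\ J T2 S = w1 / (2 * pi) * (1 - 3 * Y1),
             J C3 T1 = 4 * pi * c / w1 * - J T2 S
             /\ J C3 T2 = 4 * pi * c / w1 * J T1 S,
             J T1 C3 = (4 * c * (1 - 27 * c))^-1 *
                 (1 + 3 * Y2 - 18 * Y1 * Y2 - 6 * varsigma W c s * (1 - 3 * Y2))
             /\ J T2 C3 = (4 * c * (1 - 27 * c))^-1 *
                 (1 + 3 * Y1 - 18 * Y1 * Y2 + 6 * varsigma W c s * (1 - 3 * Y1)),
             J S T1 = 4 * c * pi / w1 * J T2 C3
             /\ J S T2 = 4 * c * pi / w1 * - J T1 C3 &
             [/\ J C3 C3 = 0, J C3 S = 0, J S C3 = 0 & J S S = 0]
             /\ [/\ J T1 T1 = 0, J T1 T2 = 0, J T2 T1 = 0 & J T2 T2 = 0]]].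
Proof.
have [f1 [f2 [f3 [Z [HO HZ HY HV]]]]] := elliptic_family_orbits hW.
split.
- exact: chart_coordinate_system HO HZ HY HV.
- by move=> c s k hc hk; rewrite (ysC_real HY).
- by move=> c x hc; rewrite /varsigma HV.
move=> c s theta1 theta2 hc p w1 Y1 Y2 d J C3 S T1 T2.
have pi0 : pi != 0 :> R by apply: lt0r_neq0; exact: pi_gt0.
have w0 : w1 != 0 by apply: lt0r_neq0; exact: lvo_om (HO c hc).
have c0 : c != 0 by have /andP[h _] := hc; exact: lt0r_neq0.
have p0 : p 0 i0 = c by rewrite /p /mkcoord mxE.
have p1 : p 0 i1 = s by rewrite /p /mkcoord mxE.
have hp : c3_range (p 0 i0) by rewrite p0.
have [_ EJ] := chart_differential HO HZ HY HV hp.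
have [n1 n2 n3] := chart_frame_nondegenerate HO HY hp.
have JE a b : J a b = frameJ (jet_c1 W c s) (jet_s1 W c s) (jet_c2 W c s) (jet_s2 W c s) b a.
  rewrite /J /Jcoef /dcovec /dvec EJ /chart_frame p0 p1; rewrite p0 p1 in n3.
  exact: frame_dual.
split.
  rewrite /d /dvec EJ /chart_frame p0 p1; rewrite p0 p1 in n3.
  rewrite (frame_hitchin n3 erefl erefl erefl erefl) (jet_det HO HY) // invf_div.
  by congr (_ *: _ - _); rewrite -/w1; field.
rewrite ![J _ _]JE !mxE /= (jet_det HO HY) // -/w1.
split.
- by [].
- by split; move: (pi : R) pi0 => q q0; field; rewrite ?w0 ?c0 ?q0.
- by [].
- by split; move: (pi : R) pi0 => q q0; field; rewrite ?w0 ?c0 ?q0.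
- by [].
Qed.
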